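(* Up to isomorphism, the indecomposable sextuples underlying non-split continuous-type isotropic triples over $\mathbf k$ are parametrized, via $\eta\mapsto\mathcal S_\eta$, by (isomorphism classes of) indecomposable linear endomorphisms $\eta$ of the form $\eta=\frac12\,\mathrm{id}+\zeta$, where $\zeta$ is an indecomposable endomorphism of an even-dimensional space such that $\zeta$ is similar to $-\zeta^*$. Such endomorphisms $\zeta$ are themselves parametrized (up to isomorphism, by their minimal polynomials) by the set $$\{\,r^m\mid m\in\mathbb Z_{>0},\ r\in\mathbf k[x]\text{ monic irreducible with } r(x)=p(x^2)\text{ for some }p\in\mathbf k[x]\,\}\ \cup\ \{\,(x^2)^m\mid m\in\mathbb Z_{>0}\,\}.$$
   Context: Standing assumptions: $\mathbf k$ is a perfect field with $\operatorname{char}\mathbf k\neq 2$; all vector spaces are finite-dimensional over $\mathbf k$. A sextuple $(V;C_i,I_i)$ in $V$ consists of subspaces $I_i\subseteq C_i\subseteq V$, $i=1,2,3$. Isomorphisms are linear bijections $f:V\to V'$ with $f(I_i)=I_i'$, $f(C_i)=C_i'$. A sextuple is indecomposable if $V\ne0$ and there is no decomposition $V=U'\oplus U''$ with $U',U''\ne0$ such that each $I_i$ and each $C_i$ is the direct sum of its intersections with $U'$ and $U''$. It is of continuous type if it is indecomposable with $\dim V=3k$, $\dim C_i=2k$, $\dim I_i=k$ $(i=1,2,3)$ for some $k\ge1$. An isotropic triple is an ordered triple $(I_1,I_2,I_3)$ of isotropic subspaces of a symplectic space $(V,\omega)$; its underlying sextuple is $(V;C_i,I_i)$ with $C_i=I_i^\perp$.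 It is non-split if it is indecomposable with respect to orthogonal direct sums and its underlying sextuple is indecomposable; it is of continuous type if the underlying sextuple is. An endomorphism $(U,\eta)$ is a vector space with a linear map $\eta:U\to U$; $(U,\eta)\cong(U',\eta')$ (also: $\eta$ and $\eta'$ are similar) if there is a linear bijection $f:U\to U'$ with $f\eta=\eta'f$. It is indecomposable if $U\ne0$ and $U$ is not a direct sum of two nonzero $\eta$-invariant subspaces. $\zeta^*:U^*\to U^*$ is the transpose. For $(U,\eta)$, the sextuple $\mathcal S_\eta$ is, in $V=U\times U\times U$: $I_1=U\times0\times0$, $I_2=0\times0\times U$, $I_3=\{(-\eta x,x,-x)\mid x\in U\}$, $C_1=U\times U\times0$, $C_2=0\times U\times U$, $C_3=\{(x,-x,0)\mid x\in U\}+I_3$. *)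

(* Defs.v *)
From HB Require Import structures.
From mathcomp Require Import all_boot all_order all_algebra all_field.

Set Implicit Arguments.
Unset Strict Implicit.
Unset Printing Implicit Defensive.

Import GRing.Theory.
Local Open Scope ring_scope.

Definition perfect_field (k : fieldType) : Prop :=
  forall p : {poly k}, irreducible_poly p -> separable_poly p.

(* Finite-dimensional spaces are [vectType]s, subspaces are [{vspace V}]. *)
Section Decompositions.
Variables (k : fieldType) (V : vectType k).

Definition nontrivial_decomposition (U' U'' : {vspace V}) : Prop :=
  [/\ U' != 0%VS, U'' != 0%VS,
      (U' + U'')%VS = fullv & (U' :&: U'')%VS = 0%VS].

(* For [U'] and [U''] in direct sum, the sum on the right is automatically
   direct. *)
Definition splits (U' U'' W : {vspace V}) : Prop :=
  W = ((W :&: U') + (W :&: U''))%VS.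

End Decompositions.

(* The indices 1, 2, 3 are the elements 0, 1, 2 of ['I_3]. *)
Record sextuple (k : fieldType) (V : vectType k) := Sextuple {
  sextC : 'I_3 -> {vspace V};
  sextI : 'I_3 -> {vspace V};
  sext_sub : forall i, (sextI i <= sextC i)%VS }.

Definition sextuple_iso (k : fieldType) (V V' : vectType k)
    (S : sextuple V) (S' : sextuple V') : Prop :=
  exists f : 'Hom(V, V'), bijective f /\
    forall i, (f @: sextI S i)%VS = sextI S' i /\
              (f @: sextC S i)%VS = sextC S' i.

Section SextupleTypes.
Variables (k : fieldType) (V : vectType k) (S : sextuple V).

Definition sextuple_indecomposable : Prop :=
  (fullv : {vspace V}) != 0%VS /\
  ~ exists U' U'' : {vspace V}, nontrivial_decomposition U' U'' /\
      forall i, splits U' U'' (sextI S i) /\ splits U' U'' (sextC S i).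

Definition sextuple_continuous : Prop :=
  sextuple_indecomposable /\
  exists n : nat, [/\ (1 <= n)%N, \dim {:V} = (3 * n)%N,
    forall i, \dim (sextC S i) = (2 * n)%N & forall i, \dim (sextI S i) = n].

End SextupleTypes.

(* The library's [is_psymplectic] asks for a nondegenerate skew-symmetric form,
   which is alternating when the characteristic is not 2; [orthov] is the
   orthogonal complement. *)
Record isotropic_triple (k : fieldType) (V : vectType k) := IsotropicTriple {
  triple_form : {skew_symmetric V};
  triple_symplectic : is_psymplectic triple_form;
  tripleI : 'I_3 -> {vspace V};
  triple_isotropic : forall i, (tripleI i <= orthov triple_form (tripleI i))%VS }.

Section IsotropicTriples.
Variables (k : fieldType) (V : vectType k) (T : isotropic_triple V).

Definition underlying_sextuple : sextuple V :=
  @Sextuple k V (fun i => orthov (triple_form T) (tripleI T i)) (tripleI T)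
    (triple_isotropic T).

(* The summands of an orthogonal direct sum decomposition of a symplectic space
   are automatically symplectic. *)
Definition triple_indecomposable : Prop :=
  (fullv : {vspace V}) != 0%VS /\
  ~ exists U' U'' : {vspace V},
      [/\ nontrivial_decomposition U' U'',
          (U' <= orthov (triple_form T) U'')%VS &
          forall i, splits U' U'' (tripleI T i)].

Definition triple_nonsplit : Prop :=
  triple_indecomposable /\ sextuple_indecomposable underlying_sextuple.

Definition triple_continuous : Prop := sextuple_continuous underlying_sextuple.

End IsotropicTriples.

Definition endo_iso (k : fieldType) (U U' : vectType k)
    (eta : 'End(U)) (eta' : 'End(U')) : Prop :=
  exists f : 'Hom(U, U'), bijective f /\ (f \o eta)%VF = (eta' \o f)%VF.

Definition endo_indecomposable (k : fieldType) (U : vectType k)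
    (eta : 'End(U)) : Prop :=
  (fullv : {vspace U}) != 0%VS /\
  ~ exists U' U'' : {vspace U},
      [/\ nontrivial_decomposition U' U'',
          (eta @: U' <= U')%VS & (eta @: U'' <= U'')%VS].

Section Transpose.
Variables (k : fieldType) (U : vectType k).

Definition dual : vectType k := 'Hom(U, k^o).

Definition precomp (zeta : 'End(U)) (phi : dual) : dual := (phi \o zeta)%VF.

Fact precomp_linear zeta : linear (precomp zeta).
Proof. by move=> a u v; rewrite /precomp comp_lfunDl comp_lfunZl. Qed.
HB.instance Definition _ zeta :=
  GRing.isLinear.Build k dual dual _ (precomp zeta) (precomp_linear zeta).

Definition transpose (zeta : 'End(U)) : 'End(dual) := linfun (precomp zeta).

End Transpose.

Section SextupleOfEndomorphism.
Variables (k : fieldType) (U : vectType k) (eta : 'End(U)).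

Local Notation V := ((U * U) * U)%type.

Definition mapI1 (x : U) : V := (x, 0, 0).
Definition mapI2 (x : U) : V := (0, 0, x).
Definition mapI3 (x : U) : V := (- eta x, x, - x).
Definition mapC1 (p : U * U) : V := (p.1, p.2, 0).
Definition mapC2 (p : U * U) : V := (0, p.1, p.2).
Definition mapD3 (x : U) : V := (x, - x, 0).

Fact mapI1_linear : linear mapI1.
Proof.
by move=> a u v; congr (_, _, _); rewrite /= ?scaler0 ?addr0.
Qed.
Fact mapI2_linear : linear mapI2.
Proof.
by move=> a u v; congr (_, _, _); rewrite /= ?scaler0 ?addr0.
Qed.
Fact mapI3_linear : linear mapI3.
Proof.
by move=> a u v; congr (_, _, _); rewrite /= ?linearP ?opprD ?scalerN.
Qed.
Fact mapC1_linear : linear mapC1.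
Proof.
by move=> a u v; congr (_, _, _); rewrite /= ?scaler0 ?addr0.
Qed.
Fact mapC2_linear : linear mapC2.
Proof.
by move=> a u v; congr (_, _, _); rewrite /= ?scaler0 ?addr0.
Qed.
Fact mapD3_linear : linear mapD3.
Proof.
by move=> a u v; congr (_, _, _); rewrite /= ?scaler0 ?addr0 ?opprD ?scalerN.
Qed.
HB.instance Definition _ := GRing.isLinear.Build k U V _ mapI1 mapI1_linear.
HB.instance Definition _ := GRing.isLinear.Build k U V _ mapI2 mapI2_linear.
HB.instance Definition _ := GRing.isLinear.Build k U V _ mapI3 mapI3_linear.
HB.instance Definition _ :=
  GRing.isLinear.Build k (U * U)%type V _ mapC1 mapC1_linear.
HB.instance Definition _ :=
  GRing.isLinear.Build k (U * U)%type V _ mapC2 mapC2_linear.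
HB.instance Definition _ := GRing.isLinear.Build k U V _ mapD3 mapD3_linear.

Definition endI1 : {vspace V} := limg (linfun mapI1).
Definition endI2 : {vspace V} := limg (linfun mapI2).
Definition endI3 : {vspace V} := limg (linfun mapI3).
Definition endC1 : {vspace V} := limg (linfun mapC1).
Definition endC2 : {vspace V} := limg (linfun mapC2).
Definition endC3 : {vspace V} := (limg (linfun mapD3) + endI3)%VS.

Fact endI_sub (i : 'I_3) :
  (tnth [tuple endI1; endI2; endI3] i <= tnth [tuple endC1; endC2; endC3] i)%VS.
Proof.
case: i => [[|[|[|i]]] //= ilt].
- apply/subvP => v /memv_imgP[x _ ->].
  by apply/memv_imgP; exists (x, 0); rewrite ?memvf // !lfunE.
- apply/subvP => v /memv_imgP[x _ ->].
  by apply/memv_imgP; exists (0, x); rewrite ?memvf // !lfunE.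
- exact: addvSr.
Qed.

Definition endo_sextuple : sextuple (U * U * U)%type :=
  Sextuple endI_sub.

End SextupleOfEndomorphism.

Definition admissible (k : fieldType) (U : vectType k) (zeta : 'End(U)) : Prop :=
  [/\ endo_indecomposable zeta, ~~ odd (\dim {:U}) &
      endo_iso zeta (- transpose zeta)].

Definition half_shift_admissible (k : fieldType) (U : vectType k)
    (eta : 'End(U)) : Prop :=
  endo_indecomposable eta /\
  exists zeta : 'End(U), admissible zeta /\ eta = 2^-1 *: \1%VF + zeta.

Definition endo_horner (k : fieldType) (U : vectType k)
    (q : {poly k}) (zeta : 'End(U)) : 'End(U) :=
  \sum_(i < size q) q`_i *: iter i (comp_lfun zeta) \1%VF.

Definition is_minpoly (k : fieldType) (U : vectType k)
    (zeta : 'End(U)) (p : {poly k}) : Prop :=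
  p \is monic /\ forall q : {poly k}, endo_horner q zeta = 0 <-> p %| q.

Definition parameter_poly (k : fieldType) (q : {poly k}) : Prop :=
  (exists m (r : {poly k}),
     [/\ (0 < m)%N, r \is monic, irreducible_poly r,
         (exists p : {poly k}, r = p \Po 'X^2) & q = r ^+ m])
  \/ (exists m, (0 < m)%N /\ q = ('X^2) ^+ m).

(* Main.v *)
Require Import Defs.
From HB Require Import structures.
From mathcomp Require Import all_boot all_order all_algebra all_field.
From mathcomp Require Import zify ring.
From Stdlib Require Import Classical.

(** The heart of the matter is that the underlying sextuple [S] of a triple of
    continuous type is some [S_eta]. Two steps lead there.

    Splitting. A subspace [W] of [V], with its induced subspaces, is a direct
    summand as soon as the dual of the space of extensions of [V / W] by [W]
    vanishes ([rigid_splits]). This is linear algebra with traces: the equations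
    for a retraction onto [W] either have a solution or fail a linear condition,
    and the coefficients of such a condition are nilpotent endomorphisms of [W].
    For indecomposable [S] it follows that [S] is semistable for the
    slope that gives every [C i] and [I i] weight one
    ([indecomposable_semistable]), as otherwise the first step of the
    Harder-Narasimhan filtration would split off. It also follows that a largest
    subspace filtered by the lines lying in some [I a :&: C (next a)] is [0] or
    [V] ([no_exceptional_tube]). Since [I a :&: C b] and [I b :&: C a] vanish
    together when [C i] is the orthogonal of [I i], all of these intersections
    with [a != b] are zero.

    Normal form. Subspaces in this general position are encoded by maps
    [beta : X -> Y] and [gamma : Y -> X] ([arrow_form_exists]), and [S] is
    [S_eta] with [eta] the inverse of [beta \o gamma] if both are bijective. By
    [graded_chain], an odd endomorphism of a graded space that is graded
    indecomposable has a kernel of dimension at most one, so [beta] or [gamma] is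
    injective. Injectivity of [beta] means that the [I i] span [V] and that of
    [gamma] that the [C i] have zero intersection, and these are equivalent by
    orthogonality.

    Forms. Homomorphisms between sextuples [S_eta] are diagonal
    ([endo_sextuple_hom_diagonal]), so [S_eta] determines [eta] and is
    indecomposable together with it. A symplectic form on [U * U * U] that makes
    [S_eta] the sextuple of a triple is the same as a nondegenerate skew form [q]
    on [U] with [q (eta x) y + q x (eta y) = q x y], that is, with
    [zeta = eta - 1/2] skew-adjoint ([triple_of_pairing], [triple_pairing_of]).

    It remains to find the indecomposable [zeta] that are skew-adjoint for some
    [q]. An indecomposable endomorphism is multiplication by ['X] on [k['X]]
    modulo a power [p = r ^+ m] of an irreducible polynomial
    ([indecomposable_companion]). On an even-dimensional space, similarity to
    [- zeta^*] makes [p] even, and conversely an even [p] gives a skew form, the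
    top coefficient of [u('X) * v(- 'X)] modulo [p] ([companion_skew_pairing]).
    Finally the even primary polynomials are the powers
    of an even irreducible one and the even powers of ['X]
    ([primary_even_parameter]). *)

Set Implicit Arguments.
Unset Strict Implicit.
Unset Printing Implicit Defensive.

Import GRing.Theory passmx.
Local Open Scope ring_scope.

(** * Linear functionals and the trace *)

Section LinearMaps.
Variables (k : fieldType) (U V : vectType k) (f : 'Hom(U, V)).

Lemma lfun0 : f 0 = 0. Proof. exact: linear0. Qed.
Lemma lfunB u v : f (u - v) = f u - f v. Proof. exact: raddfB. Qed.
Lemma lfunN u : f (- u) = - f u. Proof. exact: raddfN. Qed.
Lemma lfunD u v : f (u + v) = f u + f v. Proof. exact: raddfD. Qed.

Lemma split_vector (u v : U) : u = v + (u - v).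
Proof. by rewrite addrC subrK. Qed.

End LinearMaps.

Section Separation.
Variables (k : fieldType) (V : vectType k).

Lemma separating_functional (W : {vspace V}) (v : V) : v \notin W ->
  exists phi : 'Hom(V, k^o), phi v = 1 /\ forall w, w \in W -> phi w = 0.
Proof.
move=> vW; pose x := v - projv W v.
have x0 : x != 0.
  by apply: contra vW; rewrite subr_eq0 => /eqP->; apply: memv_proj.
pose g (u : V) : k^o := coord [tuple x] ord0 (projv <[x]> (u - projv W u)).
have glin : linear g.
  move=> a u w; rewrite /g linearP.
  by rewrite opprD addrACA -scalerN -scalerDr !linearP.
pose gL : {linear V -> k^o} :=
  HB.pack g (GRing.isLinear.Build k V k^o _ g glin).
exists (linfun gL); split.
  rewrite lfunE /= /g projv_id ?memv_line //.
  have fx : free [tuple x] by rewrite seq1_free.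
  exact: (coord_free ord0 ord0 fx).
by move=> w wW; rewrite lfunE /= /g (projv_id wW) subrr !linear0.
Qed.

End Separation.

Section Trace.
Variables (k : fieldType) (V : vectType k).

Let e := vbasis (fullv : {vspace V}).
Let eb : basis_of fullv e := vbasisP fullv.

Definition ltrace (f : 'End(V)) : k := \tr (mxof e e f).

Lemma ltrace0 : ltrace 0 = 0.
Proof. by rewrite /ltrace linear0 mxtrace0. Qed.

Lemma ltraceD f g : ltrace (f + g) = ltrace f + ltrace g.
Proof. by rewrite /ltrace linearD mxtraceD. Qed.

Lemma ltraceN f : ltrace (- f) = - ltrace f.
Proof. by rewrite /ltrace linearN linearN. Qed.

Lemma ltrace_sum (I : finType) (F : I -> 'End(V)) :
  ltrace (\sum_i F i) = \sum_i ltrace (F i).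
Proof. by rewrite /ltrace !linear_sum. Qed.

Lemma ltraceC f g : ltrace (f \o g)%VF = ltrace (g \o f)%VF.
Proof. by rewrite /ltrace !(mxof_comp _ _ eb) mxtrace_mulC. Qed.

(** On elementary matrices [\tr (G *m delta_mx j i)] is the entry [G i j], so
    the entries of the representing matrix can be read off. *)
Lemma ltrace_represents (phi : {linear 'End(V) -> k^o}) :
  exists g : 'End(V), forall f, phi f = ltrace (g \o f)%VF.
Proof.
exists (hommx e e (\matrix_(i, j) phi (hommx e e (delta_mx j i)))) => f.
rewrite /ltrace (mxof_comp _ _ eb) (hommxK eb eb).
rewrite -{1}(mxofK eb eb f); move: (mxof e e f) => A.
rewrite {1}(matrix_sum_delta A) !linear_sum; apply: eq_bigr => i _ /=.
rewrite mxE !linear_sum; apply: eq_bigr => j _ /=.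
by rewrite mxE !linearZ.
Qed.

Lemma ltrace_nondegenerate (g : 'End(V)) :
  (forall f, ltrace (g \o f)%VF = 0) -> g = 0.
Proof.
move=> g0; apply/eqP; rewrite -(mxof_eq0 eb eb); apply/eqP/matrixP=> i j.
have := g0 (hommx e e (delta_mx j i)).
rewrite /ltrace (mxof_comp _ _ eb) (hommxK eb eb) mxtrace_mulC.
move: (mxof e e g) => A.
rewrite /mxtrace (bigD1 i) //= big1 ?addr0 => [|l /negPf li].
  rewrite !mxE (bigD1 j) //= big1 ?addr0 => [|m /negPf mj].
    by rewrite mxE !eqxx mulr1.
  by rewrite mxE mj mulr0.
by rewrite mxE big1 // => m _; rewrite mxE li andbF mulr0.
Qed.

Lemma tr_nilpotent_mx n m (A : 'M[k]_n) :
  iter m (mulmx A) A = 0 -> \tr A = 0.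
Proof.
elim: m n A => [|m IH] n A /=; first by move=> ->; rewrite mxtrace0.
(* A rank factorization [A = C *m B] trades [A] for [B *m C], whose nilpotency
   index is smaller by one. *)
move: (mulmx_base A) (row_base_free A) (col_base_full A).
move: (col_base A) (row_base A); move: (\rank A) => r C B <- freeB fullC Am.
rewrite mxtrace_mulC; apply: IH.
have shift j : C *m iter j (mulmx (B *m C)) (B *m C) *m B
    = (C *m B) *m iter j (mulmx (C *m B)) (C *m B).
  by elim: j => [|j IHj] /=; rewrite -?IHj !mulmxA.
have := shift m; rewrite Am => /eqP.
rewrite -(mul0mx _ B) (inj_eq (row_free_inj freeB)).
by rewrite -(mulmx0 _ C) (inj_eq (row_full_inj fullC)) => /eqP.
Qed.

Lemma ltrace_nilpotent3 (g : 'End(V)) :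
  (g \o (g \o g) = 0)%VF -> ltrace g = 0.
Proof.
move=> g0; apply: (@tr_nilpotent_mx _ 2) => /=.
by rewrite -!(mxof_comp _ _ eb) -comp_lfunA g0 linear0.
Qed.

(** Fredholm alternative: a family of linear equations in [x], with values in
    endomorphisms, is either solvable or inconsistent under some linear
    combination, and the trace form writes the coefficients of that
    combination as endomorphisms. *)
Lemma fredholm (T : finType) (L : T -> {linear 'End(V) -> 'End(V)})
    (b : T -> 'End(V)) :
  (forall G : T -> 'End(V),
     (forall x, \sum_t ltrace (G t \o L t x)%VF = 0) ->
     \sum_t ltrace (G t \o b t)%VF = 0) ->
  exists x, forall t, L t x = b t.
Proof.
move=> alt.
pose F (x : 'End(V)) : {ffun T -> 'End(V)} := [ffun t => L t x].
have Flin : linear F.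
  by move=> a u v; apply/ffunP=> t; rewrite !ffunE /= linearP.
pose FL : {linear 'End(V) -> {ffun T -> 'End(V)}} :=
  HB.pack F (GRing.isLinear.Build k _ _ _ F Flin).
pose bf : {ffun T -> 'End(V)} := [ffun t => b t].
have [/memv_imgP[x _ bx]|/separating_functional[phi [phi1 phi0]]] :=
  boolP (bf \in limg (linfun FL)).
  by exists x => t; move/ffunP: bx => /(_ t); rewrite lfunE /= !ffunE.
pose inj t (x : 'End(V)) : {ffun T -> 'End(V)} :=
  [ffun s => if s == t then x else 0].
have injlin t : linear (inj t).
  move=> a u v; apply/ffunP=> s; rewrite !ffunE.
  by case: eqP => _ //; rewrite scaler0 addr0.
pose injL t : {linear 'End(V) -> {ffun T -> 'End(V)}} :=
  HB.pack (inj t) (GRing.isLinear.Build k _ _ _ (inj t) (injlin t)).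
have /fin_all_exists [G GP] t : exists g, forall f,
    phi (inj t f) = ltrace (g \o f)%VF.
  have [g gP] := ltrace_represents (phi \o injL t : {linear _ -> _}).
  by exists g => f; rewrite -gP.
have phiE (h : {ffun T -> 'End(V)}) : phi h = \sum_t ltrace (G t \o h t)%VF.
  rewrite (eq_bigr _ (fun t _ => esym (GP t (h t)))) -linear_sum; congr (phi _).
  apply/ffunP=> s; rewrite sum_ffunE (bigD1 s) //= ffunE eqxx big1 ?addr0 //.
  by move=> t ts; rewrite ffunE eq_sym (negPf ts).
have: phi bf = 0.
  rewrite phiE -[RHS](alt G); first by apply: eq_bigr => t _; rewrite ffunE.
  move=> x; rewrite -[RHS](phi0 (F x)).
    by rewrite phiE; apply: eq_bigr => t _; rewrite ffunE.
  by apply/memv_imgP; exists x; rewrite ?memvf // lfunE.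
by rewrite phi1 => /eqP; rewrite oner_eq0.
Qed.

End Trace.

(** * Idempotents and direct summands *)

Section Idempotents.
Variables (k : fieldType) (V : vectType k).

Lemma idempotent_decomposition (p : 'End(V)) :
  (p \o p = p)%VF -> p != 0 -> p != \1%VF ->
  nontrivial_decomposition (limg p) (lker p).
Proof.
move=> pp p0 p1; have pK v : p (p v) = p v by rewrite -comp_lfunE pp.
split.
- apply: contra p0 => /eqP im0; apply/eqP/lfunP => v.
  by rewrite zero_lfunE; apply/eqP; rewrite -memv0 -im0 memv_img ?memvf.
- apply: contra p1 => /lker0P inj; apply/eqP/lfunP => v.
  by rewrite id_lfunE; apply: inj.
- apply/eqP; rewrite eqEsubv subvf; apply/subvP => v _.
  rewrite (split_vector v (p v)) memv_add ?memv_img ?memvf //.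
  by rewrite memv_ker lfunB /= pK subrr.
- apply/eqP; rewrite -subv0; apply/subvP => v /memv_capP[/memv_imgP[w _ ->]].
  by rewrite memv_ker pK memv0.
Qed.

Lemma idempotent_splits (p : 'End(V)) (W : {vspace V}) :
  (p \o p = p)%VF -> (p @: W <= W)%VS -> splits (limg p) (lker p) W.
Proof.
move=> pp pW; have pK v : p (p v) = p v by rewrite -comp_lfunE pp.
have pW' v : v \in W -> p v \in W by move=> /(memv_img p)/(subvP pW).
apply/eqP; rewrite eqEsubv subv_add !capvSl !andbT.
apply/subvP => v vW; rewrite (split_vector v (p v)).
apply: memv_add; rewrite memv_cap; first by rewrite pW' // memv_img ?memvf.
by rewrite memv_ker lfunB pK subrr eqxx andbT memvB // pW'.
Qed.

Lemma decomposition_idempotent (U' U'' : {vspace V}) :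
  nontrivial_decomposition U' U'' ->
  exists p : 'End(V), [/\ (p \o p = p)%VF, p != 0, p != \1%VF,
    {in U', forall v, p v = v} & {in U'', forall v, p v = 0}].
Proof.
move=> [U'0 U''0 full cap]; exists (daddv_pi U' U'').
have p1 : {in U', forall v, daddv_pi U' U'' v = v}.
  by move=> v vU; rewrite daddv_pi_id.
have p2 : {in U'', forall v, daddv_pi U' U'' v = 0}.
  move=> v vU; have vf : v \in (U' + U'')%VS by rewrite full memvf.
  have cap' : (U'' :&: U' = 0)%VS by rewrite capvC.
  have := daddv_pi_add cap vf; rewrite (daddv_pi_id cap' vU) => /eqP.
  by rewrite -subr_eq0 addrK => /eqP.
split=> //.
- by apply/lfunP => v; rewrite comp_lfunE daddv_pi_proj.
- apply: contra U'0 => /eqP p0; rewrite -vpick0.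
  by rewrite -[vpick U']p1 ?memv_pick // p0 zero_lfunE.
- apply: contra U''0 => /eqP pid; rewrite -vpick0.
  by rewrite -[vpick U''](id_lfunE) -pid p2 ?memv_pick.
Qed.

Lemma splits_stable (U' U'' W : {vspace V}) (p : 'End(V)) :
  {in U', forall v, p v = v} -> {in U'', forall v, p v = 0} ->
  splits U' U'' W -> (p @: W <= W)%VS.
Proof.
move=> p1 p2 spl; apply/subvP => _ /memv_imgP[v vW ->]; move: vW; rewrite {1}spl.
move=> /memv_addP[u /memv_capP[uW uU'] [w /memv_capP[wW wU''] ->]].
by rewrite lfunD (p1 _ uU') (p2 _ wU'') addr0.
Qed.

Lemma idempotent_commutes (U' U'' : {vspace V}) (p f : 'End(V)) :
  (U' + U'')%VS = fullv ->
  {in U', forall v, p v = v} -> {in U'', forall v, p v = 0} ->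
  {in U', forall v, f v \in U'} -> {in U'', forall v, f v \in U''} ->
  (p \o f = f \o p)%VF.
Proof.
move=> full p1 p2 f1 f2; apply/lfunP => v; rewrite !comp_lfunE.
have /memv_addP[v1 v1U [v2 v2U ->]] : v \in (U' + U'')%VS.
  by rewrite full memvf.
by rewrite !lfunD (p1 _ v1U) (p2 _ v2U) (p1 _ (f1 _ v1U)) (p2 _ (f2 _ v2U)) linear0.
Qed.

End Idempotents.

Definition sextuple_hom (k : fieldType) (V V' : vectType k)
    (S : sextuple V) (S' : sextuple V') (f : 'Hom(V, V')) : Prop :=
  forall i, (f @: sextI S i <= sextI S' i)%VS /\
            (f @: sextC S i <= sextC S' i)%VS.

Section IndecomposableSextuple.
Variables (k : fieldType) (V : vectType k) (S : sextuple V).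

Lemma indecomposable_sextuple_idempotent (p : 'End(V)) :
  sextuple_indecomposable S -> (p \o p = p)%VF -> sextuple_hom S S p ->
  p = 0 \/ p = \1%VF.
Proof.
move=> [_ indec] pp pS; have [->|p0] := eqVneq p 0; first by left.
have [->|p1] := eqVneq p \1%VF; first by right.
case: indec; exists (limg p), (lker p).
split; first exact: idempotent_decomposition.
by move=> i; have [pI pC] := pS i; split; apply: idempotent_splits.
Qed.

Lemma indecomposable_sextupleI :
  (fullv : {vspace V}) != 0%VS ->
  (forall p : 'End(V), (p \o p = p)%VF -> sextuple_hom S S p ->
     p = 0 \/ p = \1%VF) ->
  sextuple_indecomposable S.
Proof.
move=> V0 idem; split=> // -[U' [U'' [dec spl]]].
have [p [pp p0 p1 pU' pU'']] := decomposition_idempotent dec.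
have [| /eqP|/eqP] := idem p pp; rewrite ?(negPf p0) ?(negPf p1) //.
by move=> i; have [spI spC] := spl i; split; apply: splits_stable pU' pU'' _.
Qed.

End IndecomposableSextuple.

Section IndecomposableEndomorphism.
Variables (k : fieldType) (U : vectType k) (eta : 'End(U)).

Lemma indecomposable_endo_idempotent (p : 'End(U)) :
  endo_indecomposable eta -> (p \o p = p)%VF ->
  (p \o eta = eta \o p)%VF -> p = 0 \/ p = \1%VF.
Proof.
move=> [_ indec] pp pe; have [->|p0] := eqVneq p 0; first by left.
have [->|p1] := eqVneq p \1%VF; first by right.
have peE v : p (eta v) = eta (p v) by rewrite -!comp_lfunE pe.
case: indec; exists (limg p), (lker p).
split; first exact: idempotent_decomposition.
- apply/subvP => _ /memv_imgP[_ /memv_imgP[v _ ->] ->].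
  by rewrite -peE memv_img ?memvf.
- apply/subvP => _ /memv_imgP[v /[!memv_ker]/eqP pv ->].
  by rewrite peE pv linear0.
Qed.

Lemma indecomposable_endoI :
  (fullv : {vspace U}) != 0%VS ->
  (forall p : 'End(U), (p \o p = p)%VF -> (p \o eta = eta \o p)%VF ->
     p = 0 \/ p = \1%VF) ->
  endo_indecomposable eta.
Proof.
move=> U0 idem; split=> // -[U' [U'' [dec e1 e2]]].
have [p [pp p0 p1 pU' pU'']] := decomposition_idempotent dec.
have [|/eqP|/eqP] := idem p pp; rewrite ?(negPf p0) ?(negPf p1) //.
have [_ _ full _] := dec; apply: (idempotent_commutes full) => // v vU.
  exact: (subvP e1) _ (memv_img _ vU).
exact: (subvP e2) _ (memv_img _ vU).
Qed.

End IndecomposableEndomorphism.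

Section Splitting.
Variables (k : fieldType) (V : vectType k) (S : sextuple V).
Local Notation C := (sextC S).
Local Notation I := (sextI S).

(** The dual of the space of extensions of [V / W] by [W], where [W] carries the
    subspaces [C i :&: W] and [I i :&: W]. As in Serre duality for parabolic
    bundles, where a class is paired with a Higgs field having three poles, an
    element is a family of residues [g i : W -> V], each moving the flag
    [0 <= I i <= C i <= V] down by one step, whose sum vanishes modulo [W];
    it is trivial when every [g i] takes values in [W]. *)
Definition extension_cocycle (W : {vspace V}) (g : 'I_3 -> 'End(V)) : Prop :=
  [/\ forall i w, w \in W -> g i w \in C i,
      forall i w, w \in W -> w \in C i -> g i w \in I i,
      forall i w, w \in W -> w \in I i -> g i w = 0
    & forall w, w \in W -> \sum_i g i w \in W].

Definition extension_rigid (W : {vspace V}) : Prop :=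
  forall g, extension_cocycle W g -> forall i w, w \in W -> g i w \in W.

Fact sandwich_linear (a b : 'End(V)) :
  linear (fun x : 'End(V) => (a \o (x \o b))%VF).
Proof.
by move=> c x y; rewrite comp_lfunDl comp_lfunDr -comp_lfunZl -comp_lfunZr.
Qed.

Definition sandwich (a b : 'End(V)) : {linear 'End(V) -> 'End(V)} :=
  HB.pack (fun x : 'End(V) => (a \o (x \o b))%VF)
    (GRing.isLinear.Build k _ _ _ _ (sandwich_linear a b)).

(** A retraction of sextuples onto [W] is a solution of linear equations in
    [x], one for each [C i] and [I i] and one saying that it is the identity on
    [W]. An inconsistent combination of these equations amounts to a
    cocycle [g]; rigidity makes every [g i] an endomorphism of [W] that is
    nilpotent because it moves a flag down, so all traces vanish and the
    combination is consistent after all. *)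
Lemma rigid_splits (W : {vspace V}) : extension_rigid W ->
  exists p : 'End(V), [/\ forall v, p v \in W,
    {in W, forall w, p w = w} & sextuple_hom S S p].
Proof.
move=> rigid; pose T : finType := ('I_3 + 'I_3 + unit)%type.
pose q := projv W.
pose qq (X : {vspace V}) := ((\1 - projv X) \o q)%VF.
have qqE X v : qq X v = q v - projv X (q v).
  by rewrite /qq comp_lfunE add_lfunE opp_lfunE id_lfunE.
have qW v : q v \in W by apply: memv_proj.
have qid w : w \in W -> q w = w by apply: projv_id.
clearbody qq q.
pose L (t : T) : {linear 'End(V) -> 'End(V)} := match t with
  | inl (inl i) => sandwich (qq (C i)) (projv (C i))
  | inl (inr i) => sandwich (qq (I i)) (projv (I i))
  | inr _ => sandwich q q end.
pose b (t : T) : 'End(V) := if t is inr _ then q else 0.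
have [G|x xP] := @fredholm k V T L b; last first.
  exists (q \o x)%VF; split.
  - by move=> v; rewrite comp_lfunE.
  - move=> w wW; move: (xP (inr tt)) => /lfunP/(_ w) /=.
    by rewrite !comp_lfunE (qid _ wW).
  have stab X v : sandwich (qq X) (projv X) x = 0 -> v \in X -> q (x v) \in X.
    move=> /lfunP/(_ v); rewrite /= !comp_lfunE zero_lfunE qqE => eqX vX.
    by move: eqX; rewrite (projv_id vX) => /subr0_eq->; apply: memv_proj.
  move=> i; split; apply/subvP => _ /memv_imgP[v vX ->]; rewrite comp_lfunE.
    exact: stab _ _ (xP (inl (inr i))) vX.
  exact: stab _ _ (xP (inl (inl i))) vX.
move=> alt; rewrite !big_sumType /=.
have big_unit (F : unit -> k) : \sum_(j : unit) F j = F tt.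
  by rewrite (bigD1 tt) //= big1 ?addr0 // => -[].
rewrite [X in X + _ + _]big1 ?add0r; last first.
  by move=> i _; rewrite comp_lfun0r ltrace0.
rewrite [X in X + _]big1 ?add0r; last first.
  by move=> i _; rewrite comp_lfun0r ltrace0.
rewrite big_unit /=.
pose GC i := G (inl (inl i)); pose GI i := G (inl (inr i)); pose GN := G (inr tt).
pose h X H := (projv X \o H \o qq X)%VF.
pose g i := (h (C i) (GC i) + h (I i) (GI i))%VF.
(* The combination kills every [x]; cycling [x] to the end of each trace and
   using that the trace form is nondegenerate, its coefficients cancel. *)
have sumg : (\sum_i g i + (q \o GN \o q) = 0)%VF.
  apply: ltrace_nondegenerate => x; rewrite comp_lfunDl ltraceD.
  rewrite -[RHS](alt x) !big_sumType big_unit /= big_split /=.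
  have cyc (H a c : 'End(V)) :
      ltrace (c \o H \o a \o x)%VF = ltrace (H \o (a \o (x \o c)))%VF.
    by rewrite -!comp_lfunA ltraceC -!comp_lfunA.
  congr (_ + _); last exact: cyc.
  rewrite comp_lfunDl ltraceD; congr (_ + _).
    rewrite (big_morph (fun y => y \o x)%VF (id1 := 0) (op1 := +%R)) ?comp_lfun0l //;
      last by move=> y z; rewrite comp_lfunDl.
    by rewrite ltrace_sum; apply: eq_bigr => i _; apply: cyc.
  rewrite (big_morph (fun y => y \o x)%VF (id1 := 0) (op1 := +%R)) ?comp_lfun0l //;
    last by move=> y z; rewrite comp_lfunDl.
  by rewrite ltrace_sum; apply: eq_bigr => i _; apply: cyc.
have hX X H v : h X H v \in X by rewrite /h !comp_lfunE memv_proj.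
have h0 (X : {vspace V}) H w : w \in W -> w \in X -> h X H w = 0.
  by move=> wW wX; rewrite /h !comp_lfunE qqE (qid _ wW) (projv_id wX) subrr !linear0.
have IC i : (I i <= C i)%VS by apply: sext_sub.
have gE i v : g i v = h (C i) (GC i) v + h (I i) (GI i) v by rewrite add_lfunE.
have gC i v : g i v \in C i by rewrite gE rpredD // (subvP (IC i)).
have gI i w : w \in W -> w \in C i -> g i w \in I i.
  by move=> wW wC; rewrite gE h0 // add0r.
have g0 i w : w \in W -> w \in I i -> g i w = 0.
  by move=> wW wI; rewrite gE !h0 ?addr0 // (subvP (IC i)).
have gW i w : w \in W -> g i w \in W.
  apply: rigid; split=> // {}w _; move/lfunP: sumg => /(_ w).
  rewrite add_lfunE sum_lfunE !comp_lfunE zero_lfunE => /eqP.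
  by rewrite addr_eq0 => /eqP->; rewrite rpredN.
have gq i v : g i v = g i (q v).
  by rewrite !gE /h !comp_lfunE !qqE [q (q v)]qid.
have tr_g i : ltrace (g i) = 0.
  apply: ltrace_nilpotent3; apply/lfunP => v.
  rewrite !comp_lfunE zero_lfunE [g i v]gq.
  have aW := gW i _ (qW v); have aC := gC i (q v).
  by apply: (g0 i (g i (g i (q v)))); [apply: gW | apply: gI].
transitivity (ltrace (q \o GN \o q)%VF).
  rewrite -comp_lfunA [RHS]ltraceC -comp_lfunA; congr (ltrace (_ \o _)%VF).
  by apply/lfunP => v; rewrite comp_lfunE [q (q v)]qid.
move/eqP: sumg; rewrite addrC addr_eq0 => /eqP->.
by rewrite ltraceN ltrace_sum big1 ?oppr0.
Qed.

Lemma rigid_trivial (W : {vspace V}) :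
  sextuple_indecomposable S -> extension_rigid W -> W = 0%VS \/ W = fullv.
Proof.
move=> indec /rigid_splits[p [pW pid pS]].
have pp : (p \o p = p)%VF by apply/lfunP => v; rewrite comp_lfunE pid.
have [p0|p1] := indecomposable_sextuple_idempotent indec pp pS.
  left; apply/eqP; rewrite -subv0; apply/subvP => w wW.
  by rewrite -(pid _ wW) p0 zero_lfunE mem0v.
right; apply/eqP; rewrite eqEsubv subvf; apply/subvP => v _.
by rewrite -[v]id_lfunE -p1.
Qed.

End Splitting.

(** * Semistability *)

Definition i0 : 'I_3 := Ordinal (isT : (0 < 3)%N).
Definition i1 : 'I_3 := Ordinal (isT : (1 < 3)%N).
Definition i2 : 'I_3 := Ordinal (isT : (2 < 3)%N).

Lemma ord3P (P : 'I_3 -> Prop) : P i0 -> P i1 -> P i2 -> forall i, P i.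
Proof.
move=> P0 P1 P2 [[|[|[|m]]] lt] //.
- by have -> : Ordinal lt = i0 by apply: val_inj.
- by have -> : Ordinal lt = i1 by apply: val_inj.
- by have -> : Ordinal lt = i2 by apply: val_inj.
Qed.

Lemma sum3 (M : nmodType) (F : 'I_3 -> M) : \sum_i F i = F i0 + F i1 + F i2.
Proof.
rewrite !big_ord_recl big_ord0 addr0 addrA.
by congr (F _ + F _ + F _); apply: val_inj.
Qed.

Lemma sum3n (F : 'I_3 -> nat) : (\sum_i F i = F i0 + F i1 + F i2)%N.
Proof. exact: (@sum3 nat F). Qed.

Lemma exists_maximizer (T : Type) (x0 : T) (P : T -> Prop) (mu : T -> nat)
    (b : nat) :
  P x0 -> (forall x, (mu x <= b)%N) ->
  exists2 x, P x & forall y, P y -> (mu y <= mu x)%N.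
Proof.
move=> Px0 bound; move: {2}(b - mu x0)%N (leqnn (b - mu x0)%N) => d.
elim: d x0 Px0 => [|d IH] x Px lexd;
    have [max|/not_all_ex_not[y nmax]] := classic (forall y, P y -> (mu y <= mu x)%N).
- by exists x.
- by case: nmax => Py; have := bound y; lia.
- by exists x.
- have [Py /negP] := imply_to_and _ _ nmax; rewrite -ltnNge => lt.
  by apply: (IH y Py); have := bound y; lia.
Qed.

Section DimensionCounts.
Variables (k : fieldType) (V : vectType k).
Implicit Types (g : 'End(V)) (B W X Y : {vspace V}).

Lemma dim_img_preim g B W :
  (\dim (W :&: g @: B) = \dim (g @: (B :&: g @^-1: W)))%N.
Proof.
apply/eqP; rewrite eqn_leq; apply/andP; split; apply/dimvS/subvP => v.
  move=> /memv_capP[vW /memv_imgP[b bB def]]; subst v.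
  by rewrite memv_img // memv_cap bB -memv_preim.
move=> /memv_imgP[b /memv_capP[bB]]; rewrite -memv_preim => gb ->.
by rewrite memv_cap gb memv_img.
Qed.

Lemma dim_img_excess g B W :
  (\dim (g @: B) + \dim (B :&: g @^-1: W) = \dim B + \dim (W :&: g @: B))%N.
Proof.
rewrite dim_img_preim -(limg_ker_dim g B).
rewrite -[in LHS](limg_ker_dim g (B :&: g @^-1: W)).
suff -> : (B :&: g @^-1: W :&: lker g = B :&: lker g)%VS by lia.
apply/vspaceP => v; rewrite !memv_cap -memv_preim memv_ker.
by case: eqP => [->|_]; rewrite ?mem0v ?andbT ?andbF.
Qed.

Lemma dim_add_img g B W :
  (\dim (W + g @: B) + \dim (B :&: g @^-1: W) = \dim W + \dim B)%N.
Proof.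
by have := dim_img_excess g B W; have := dimv_sum_cap W (g @: B); lia.
Qed.

Lemma dim_cap_add_img g B W Y : (g @: B <= Y)%VS ->
  (\dim (Y :&: W) + \dim B <=
     \dim (Y :&: (W + g @: B)) + \dim (B :&: g @^-1: W))%N.
Proof.
move=> gBY; have e := dim_img_excess g B W.
have c := dimv_sum_cap (Y :&: W) (g @: B).
have s : (\dim (Y :&: W + g @: B) <= \dim (Y :&: (W + g @: B)))%N.
  apply/dimvS; rewrite subv_add !subv_cap capvSl gBY addvSr andbT /=.
  by rewrite (subv_trans (capvSr _ _)) ?addvSl.
have t : (\dim (Y :&: W :&: g @: B) <= \dim (W :&: g @: B))%N.
  by apply/dimvS/capvS; rewrite ?capvSr.
by lia.
Qed.

Lemma dim_add_le W1 W2 X : (W1 <= X)%VS -> (W2 <= X)%VS ->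
  (\dim W1 + \dim W2 <= \dim X + \dim (W1 :&: W2))%N.
Proof.
move=> s1 s2; have := dimv_sum_cap W1 W2.
have : (\dim (W1 + W2) <= \dim X)%N by rewrite dimvS // subv_add s1.
by lia.
Qed.

End DimensionCounts.

Section Semistability.
Variables (k : fieldType) (V : vectType k) (S : sextuple V).
Local Notation C := (sextC S).
Local Notation I := (sextI S).
Implicit Types (W X A : {vspace V}).

Definition weight W : nat := \sum_i (\dim (C i :&: W) + \dim (I i :&: W))%N.

(** The difference [weight W - 3 * \dim W], the defect of [W], plays the role of
    a degree; that of [V] is zero when [\dim C i + \dim I i = \dim V] for
    every [i]. *)
Definition semistable : Prop := forall W, (weight W <= 3 * \dim W)%N.

(** The smallest subspace of maximal defect [weight - 3 * \dim] is the first
    step of a Harder-Narasimhan filtration, and there are no nonzero maps from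
    it to a shift of the quotient. Concretely, let [A] be the common kernel
    modulo [W] of a cocycle [g], and [X] the sum of [W] and its images. Counting
    dimensions, the defects of [A] and [X] add up to at least twice that of
    [W]. The defect of [X] is at most that of [W] and the defect of a proper
    [A] is smaller, hence [A = W]. *)
Lemma destabilizing_rigid W :
  (forall X, weight X + 3 * \dim W <= weight W + 3 * \dim X)%N ->
  (forall A, (A <= W)%VS -> A != W ->
     weight A + 3 * \dim W < weight W + 3 * \dim A)%N ->
  extension_rigid S W.
Proof.
move=> maxW minW g [gC gI g0 gsum].
pose Wi i := (W :&: g i @^-1: W)%VS.
pose Wi' i := (W :&: g i @^-1: I i)%VS.
pose A := (Wi i0 :&: Wi i1 :&: Wi i2)%VS.
have AW i : (A <= Wi i)%VS.
  move: i; apply: ord3P; rewrite /A ?capvSr //.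
    by rewrite (subv_trans (capvSl _ _)) ?capvSl.
  by rewrite (subv_trans (capvSl _ _)) ?capvSr.
have WiW i : (Wi i <= W)%VS by apply: capvSl.
have [AeW i w wW|/(minW A (subv_trans (AW i0) (WiW i0))) ltA] := eqVneq A W.
  have : w \in Wi i by apply: (subvP (AW i)); rewrite AeW.
  by rewrite memv_cap -memv_preim => /andP[].
pose X := (W + g i0 @: W + g i1 @: W)%VS.
have gsum3 w : w \in W -> g i0 w + g i1 w + g i2 w \in W.
  by move=> wW; rewrite -(sum3 (fun i => g i w)) gsum.
have gX i : (W + g i @: W <= X)%VS.
  rewrite subv_add; apply/andP; split; first by rewrite /X -addvA addvSl.
  move: i; apply: ord3P; rewrite /X ?addvSr //.
    by rewrite -addvA addvC -addvA addvSl.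
  apply/subvP => _ /memv_imgP[w wW ->].
  have -> : g i2 w = (g i0 w + g i1 w + g i2 w) + g i0 (- w) + g i1 (- w).
    by rewrite !lfunN -[RHS]addrA -opprD addrAC subrr add0r.
  by rewrite !memv_add ?gsum3 ?memv_img ?rpredN.
have cX i : (\dim (C i :&: W) + \dim W <= \dim (C i :&: X) + \dim (Wi i))%N.
  have gWC : (g i @: W <= C i)%VS.
    by apply/subvP => _ /memv_imgP[w wW ->]; apply: gC.
  apply: (leq_trans (dim_cap_add_img W gWC)); rewrite leq_add2r.
  by apply/dimvS/capvS.
have iX i : (\dim (I i :&: W) + \dim (Wi i + Wi' i)
             <= \dim (I i :&: X) + \dim (Wi i))%N.
  have gWI : (g i @: Wi' i <= I i)%VS.
    apply/subvP => _ /memv_imgP[w /memv_capP[_ gw] ->].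
    by rewrite memv_preim.
  have le1 := dim_cap_add_img W gWI.
  have le2 : (\dim (I i :&: (W + g i @: Wi' i)) <= \dim (I i :&: X))%N.
    apply/dimvS/capvS => //; apply: subv_trans (gX i).
    by apply/addvS => //; apply/limgS/capvSl.
  have le3 : (\dim (Wi' i :&: g i @^-1: W) <= \dim (Wi i :&: Wi' i))%N.
    by apply/dimvS/subvP => w; rewrite !memv_cap => /andP[/andP[-> ->] ->].
  by have := dimv_sum_cap (Wi i) (Wi' i); lia.
have iA i : (\dim A + \dim (I i :&: W) <= \dim (Wi i) + \dim (I i :&: A))%N.
  have sI : (I i :&: W <= Wi i)%VS.
    apply/subvP => w /memv_capP[wI wW]; rewrite memv_cap wW -memv_preim.
    by rewrite g0 ?mem0v.
  apply: (leq_trans (dim_add_le (AW i) sI)); rewrite leq_add2l.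
  by rewrite capvC; apply/dimvS/capvS; rewrite ?capvSl.
have cA i : (\dim A + \dim (C i :&: W)
             <= \dim (Wi i + Wi' i) + \dim (C i :&: A))%N.
  have sC : (C i :&: W <= Wi i + Wi' i)%VS.
    apply/subvP => w /memv_capP[wC wW]; apply: (subvP (addvSr _ _)).
    by rewrite memv_cap wW -memv_preim gI.
  have sA : (A <= Wi i + Wi' i)%VS by apply: subv_trans (AW i) (addvSl _ _).
  apply: (leq_trans (dim_add_le sA sC)); rewrite leq_add2l.
  by rewrite capvC; apply/dimvS/capvS; rewrite ?capvSl.
have dimX : (\dim X + \sum_i \dim (Wi i) <= 3 * \dim W + \dim A)%N.
  have e1 := dim_add_img (g i0) W W.
  have e2 := dim_add_img (g i1) W (W + g i0 @: W).
  have s1 : (Wi i1 <= W :&: g i1 @^-1: (W + g i0 @: W))%VS.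
    by apply/capvS => //; apply/lpreimS/addvSl.
  have s2 : (Wi i2 <= W :&: g i1 @^-1: (W + g i0 @: W))%VS.
    apply/subvP => w /memv_capP[wW]; rewrite memv_cap wW -!memv_preim => g2w.
    have -> : g i1 w = (g i0 w + g i1 w + g i2 w - g i2 w) + g i0 (- w).
      by rewrite addrK lfunN addrC addKr.
    by rewrite memv_add ?memv_img ?rpredN ?rpredB ?gsum3.
  have le := dim_add_le s1 s2.
  have le' : (\dim (Wi i1 :&: Wi i2) <= \dim A)%N.
    apply/dimvS/subvP => w /memv_capP[/memv_capP[wW]].
    rewrite -memv_preim => g1w /memv_capP[_]; rewrite -memv_preim => g2w.
    rewrite !memv_cap -!memv_preim wW g1w g2w !andbT /=.
    have -> : g i0 w = g i0 w + g i1 w + g i2 w - g i2 w - g i1 w.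
      by rewrite !addrK.
    by rewrite !rpredB ?gsum3.
  by rewrite sum3n; move: e1 e2 le le'; rewrite -/(Wi i0) -/X; lia.
have := maxW X; move: ltA dimX; rewrite /weight !sum3n.
move: (cX i0) (cX i1) (cX i2) (iX i0) (iX i1) (iX i2).
move: (cA i0) (cA i1) (cA i2) (iA i0) (iA i1) (iA i2).
by lia.
Qed.

(** A destabilizing subspace splits off, so it is [0] or [V], and both have
    defect zero. *)
Lemma indecomposable_semistable :
  sextuple_indecomposable S -> weight fullv = (3 * \dim {:V})%N -> semistable.
Proof.
move=> indec full; pose N := \dim {:V}.
have dimN W : (\dim W <= N)%N by rewrite dimvS ?subvf.
have weightN W : (weight W <= 6 * N)%N.
  rewrite /weight sum3n.
  move: (dimN (C i0 :&: W)%VS) (dimN (C i1 :&: W)%VS) (dimN (C i2 :&: W)%VS).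
  move: (dimN (I i0 :&: W)%VS) (dimN (I i1 :&: W)%VS) (dimN (I i2 :&: W)%VS).
  by lia.
(* Lexicographic order: the defect, shifted by [3 * N] to stay in [nat], counts
   first, and a smaller dimension breaks ties since [N - \dim W <= N < N.+1]. *)
pose mu W := ((weight W + 3 * (N - \dim W)) * N.+1 + (N - \dim W))%N.
have [|W _ maxW] := @exists_maximizer _ 0%VS (fun=> True) mu (9 * N * N.+1 + N) Logic.I.
  by move=> W; rewrite /mu; have := weightN W; have := dimN W; nia.
have defect_le X :
    (weight X + 3 * (N - \dim X) <= weight W + 3 * (N - \dim W))%N.
  have := maxW X Logic.I; rewrite /mu.
  move: (weight X + _)%N (weight W + _)%N => a b.
  have := dimN X; have := dimN W; nia.
have rigid : extension_rigid S W.
  apply: destabilizing_rigid => [X|A AW AneW].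
    by have := defect_le X; have := dimN X; have := dimN W; lia.
  have ltA : (\dim A < \dim W)%N.
    by rewrite ltn_neqAle dimvS // andbT; move: AneW; rewrite eqEdim AW /= -ltnNge; lia.
  have := maxW A Logic.I; have := defect_le A; rewrite /mu.
  have := dimN A; have := dimN W; nia.
have fW : weight W = (3 * \dim W)%N.
  have [->|->] := rigid_trivial indec rigid => //.
  by rewrite /weight dimv0 muln0 big1 // => i _; rewrite !capv0 dimv0.
by move=> X; have := defect_le X; have := dimN X; have := dimN W; rewrite fW; lia.
Qed.

End Semistability.

(** * The exceptional tube *)

Definition next (i : 'I_3) : 'I_3 := i + 1.

Lemma next0 : next i0 = i1. Proof. exact: val_inj. Qed.
Lemma next1 : next i1 = i2. Proof. exact: val_inj. Qed.
Lemma next2 : next i2 = i0. Proof. exact: val_inj. Qed.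
Definition nextE := (next0, next1, next2).

Lemma next_sum3 (M : zmodType) (F : 'I_3 -> M) i :
  \sum_j F j = F i + F (next i) + F (next (next i)).
Proof.
rewrite sum3; move: i; apply: ord3P; rewrite !nextE //.
  by rewrite [RHS]addrC addrA.
by rewrite addrC addrA.
Qed.

Section Tube.
Variables (k : fieldType) (V : vectType k) (S : sextuple V).
Local Notation C := (sextC S).
Local Notation I := (sextI S).
Implicit Types (W Y : {vspace V}).

(** Successive extensions by one-dimensional sextuples whose line lies in [I a]
    and in [C (next a)]. In the tubular family of semistable sextuples of defect
    zero, the three values of [a] give the simple objects of one tube of rank
    three, cyclically permuted by the shift of flags. *)
Inductive tube : {vspace V} -> Prop :=
| tube_zero : tube 0%VS
| tube_extend W v a : tube W -> v \notin W ->
    v \in (I a + W)%VS -> v \in (C (next a) + W)%VS -> tube (W + <[v]>)%VS.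

Lemma dim_add_line W v : v \notin W -> \dim (W + <[v]>)%VS = (\dim W).+1.
Proof.
move=> vW; rewrite dimv_disjoint_sum ?dim_vline.
  by rewrite (_ : v != 0) ?addn1 //; apply: contraNneq vW => ->; apply: mem0v.
apply/eqP; rewrite -subv0; apply/subvP => u /memv_capP[uW /vlineP[c def]].
rewrite memv0 def scaler_eq0; have [//|c0 /=] := eqVneq c 0.
by case/negP: vW; rewrite -[v](scalerK c0) -def memvZ.
Qed.

Lemma dim_cap_line_le Y W v : (\dim (Y :&: W) <= \dim (Y :&: (W + <[v]>)))%N.
Proof. by apply/dimvS/capvS; rewrite ?addvSl. Qed.

Lemma dim_cap_line_lt Y W v : v \notin W -> v \in (Y + W)%VS ->
  (\dim (Y :&: W) < \dim (Y :&: (W + <[v]>)))%N.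
Proof.
move=> vW /memv_addP[y yY [w wW def]].
have yW : y \notin W by apply: contra vW => yW; rewrite def rpredD.
rewrite ltn_neqAle dim_cap_line_le andbT; apply: contra yW.
have sub : (Y :&: W <= Y :&: (W + <[v]>))%VS by rewrite capvS ?addvSl.
rewrite (dimv_leqif_eq sub) => /eqP eqd.
suff : y \in (Y :&: (W + <[v]>))%VS by rewrite -eqd => /memv_capP[].
rewrite memv_cap yY -[y](addrK w) -def addrC.
by rewrite memv_add ?memv_line ?rpredN.
Qed.

Lemma cap_line_eq Y W v : \dim (Y :&: (W + <[v]>)) = \dim (Y :&: W) ->
  forall u, u \in Y -> u \in (W + <[v]>)%VS -> u \in W.
Proof.
have sub : (Y :&: W <= Y :&: (W + <[v]>))%VS by rewrite capvS ?addvSl.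
move=> /esym/eqP; rewrite (dimv_leqif_eq sub) => /eqP eqd u uY uW.
have : u \in (Y :&: (W + <[v]>))%VS by rewrite memv_cap uY.
by rewrite -eqd => /memv_capP[].
Qed.

(** Adding a line of type [a] raises the dimension by one and the weight by at
    least three, and semistability makes this an equality. So the six
    intersections grow exactly as the type prescribes, which leaves no room for
    a line in [I (next a) :&: C a]; such lines are the simple objects of the
    opposite tube. *)
Lemma tube_factors W : semistable S -> tube W ->
  weight S W = (3 * \dim W)%N /\
  forall a u, u \in I (next a) -> u \in C a -> u \in W -> u = 0.
Proof.
move=> semi; elim=> [|{}W v a _ [wW IH] vW vI vC].
  split=> [|a u _ _]; last by rewrite memv0 => /eqP.
  by rewrite /weight dimv0 muln0 big1 // => i _; rewrite !capv0 dimv0.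
have := semi (W + <[v]>)%VS.
have sIC : (I a + W <= C a + W)%VS by apply: addvS => //; apply: sext_sub.
have := dim_cap_line_lt vW (subvP sIC _ vI).
have := dim_cap_line_lt vW vI; have := dim_cap_line_lt vW vC.
have leC i := dim_cap_line_le (C i) W v; have leI i := dim_cap_line_le (I i) W v.
move: wW; rewrite dim_add_line // /weight !sum3n.
move: (leC i0) (leC i1) (leC i2) (leI i0) (leI i1) (leI i2).
move=> leC0 leC1 leC2 leI0 leI1 leI2 wW ltC ltI ltCa semiW.
split.
  by move: a vI vC sIC ltC ltI ltCa; apply: ord3P => _ _ _; rewrite !nextE; lia.
have excl b : \dim (I (next b) :&: (W + <[v]>)) = \dim (I (next b) :&: W)
    \/ \dim (C b :&: (W + <[v]>)) = \dim (C b :&: W).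
  move: a {vI vC sIC} b ltC ltI ltCa.
  by apply: ord3P; apply: ord3P; rewrite !nextE => ltC ltI ltCa; (left; lia) || (right; lia).
move=> b u uI uC uW; apply: (IH b) => //.
by case: (excl b) => /cap_line_eq; apply.
Qed.

(** A cocycle carries a line of type [a] to one of type [next a] modulo [W],
    since residues move [I a] to [0], [C (next a)] to [I (next a)] and
    everything to [C (next (next a))]. If this image were not in [W], it would
    enlarge [W]. *)
Lemma tube_maximal_rigid W : tube W ->
  (forall W', tube W' -> \dim W' <= \dim W)%N -> extension_rigid S W.
Proof.
move=> tW maxW g [gC gI g0 gsum].
suff main W1 : tube W1 -> (W1 <= W)%VS -> forall i w, w \in W1 -> g i w \in W.
  exact: (main W tW (subvv W)).
elim=> [|{}W1 v a _ IH _ vI vC] sW1 i w.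
  by rewrite memv0 => /eqP->; rewrite linear0 mem0v.
move: sW1; rewrite subv_add => /andP[sW1 vW].
have {}IH := IH sW1; have W1W := subvP sW1.
rewrite -memvE in vW.
have [x xI [w1 w1W defx]] := memv_addP vI.
have [y yC [w2 w2W defy]] := memv_addP vC.
have xW : x \in W by rewrite -[x](addrK w1) -defx memvB // W1W.
have yW : y \in W by rewrite -[y](addrK w2) -defy memvB // W1W.
have ga : g a v \in W by rewrite defx lfunD g0 // add0r IH.
have gay : g a y \in W.
  have -> : y = v - w2 by rewrite defy addrK.
  by rewrite lfunB; apply: memvB => //; apply: IH.
have third j : g j y \in W -> g j v \in W.
  by move=> gjy; rewrite defy lfunD; apply: memvD => //; apply: IH.
pose z := g (next a) y.
have zI : z \in I (next a) by rewrite /z gI.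
have g3z : g (next (next a)) y + z \in W.
  have -> : g (next (next a)) y + z = \sum_j g j y - g a y.
    have abel (p q r : V) : r + q = p + q + r - p.
      by rewrite -(addrA p q r) [RHS]addrC addKr addrC.
    by rewrite (next_sum3 _ a); apply: abel.
  by rewrite memvB ?gsum.
have zW : z \in W.
  apply: contraT => zW; have := maxW (W + <[z]>)%VS.
  rewrite dim_add_line // ltnn; apply; apply: (@tube_extend _ _ (next a)) => //.
    by rewrite (subvP (addvSl _ _)).
  have -> : z = - g (next (next a)) y + (g (next (next a)) y + z) by rewrite addKr.
  by rewrite memv_add // rpredN gC.
have gv j : g j v \in W.
  have : [\/ j = a, j = next a | j = next (next a)].
    by move: j a {xI vI vC yC ga gay zI g3z zW z defx defy};
      do 2![apply: ord3P]; rewrite ?nextE;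
      (by constructor 1) || (by constructor 2) || (by constructor 3).
  case=> ->; apply: third => //.
  have -> : g (next (next a)) y = (g (next (next a)) y + z) - z by rewrite addrK.
  by rewrite memvB.
move=> /memv_addP[u uW1 [_ /vlineP[c ->] ->]].
rewrite lfunD linearZ; apply: memvD; first exact: IH.
by apply: memvZ; apply: gv.
Qed.

(** A maximal subspace filtered by the tube splits off, so it is [0] or [V]. In
    the first case no line lies in [I a :&: C (next a)], in the second none lies
    in [I (next a) :&: C a], and [dual] exchanges the two. *)
Lemma no_exceptional_tube : sextuple_indecomposable S -> semistable S ->
  (forall a, (I a :&: C (next a) = 0)%VS <-> (I (next a) :&: C a = 0)%VS) ->
  forall a, (I a :&: C (next a) = 0)%VS /\ (I (next a) :&: C a = 0)%VS.
Proof.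
move=> indec semi dual a.
suff IC : (I a :&: C (next a) = 0)%VS by split=> //; apply/dual.
have [W tW maxW] := @exists_maximizer _ 0%VS tube (fun W => \dim W) (\dim {:V})
  tube_zero (fun W => dimvS (subvf W)).
have [W0|Wf] := rigid_trivial indec (tube_maximal_rigid tW maxW).
  apply/eqP; rewrite -subv0; apply/subvP => v /memv_capP[vI vC]; apply: contraT.
  rewrite memv0 -memv0 => v0; have := maxW (0 + <[v]>)%VS.
  rewrite dim_add_line // W0 dimv0 ltn0; apply.
  by apply: (@tube_extend _ _ a) => //; [apply: tube_zero | rewrite addv0 | rewrite addv0].
apply/dual/eqP; rewrite -subv0; apply/subvP => v /memv_capP[vI vC].
have [_ factors] := tube_factors semi tW.
by rewrite memv0 (factors a v) // Wf memvf.
Qed.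

End Tube.

(** * Polynomials in an endomorphism *)

Section Evaluation.
Variables (k : fieldType) (U : vectType k) (zeta : 'End(U)).
Implicit Types (p q : {poly k}).

Definition endo_pow (i : nat) : 'End(U) := iter i (comp_lfun zeta) \1%VF.

Lemma endo_horner_widen n q : (size q <= n)%N ->
  endo_horner q zeta = \sum_(i < n) q`_i *: endo_pow i.
Proof.
move=> le; rewrite /endo_horner (big_ord_widen n (fun i => q`_i *: endo_pow i) le).
rewrite big_mkcond; apply: eq_bigr => i _ /=.
by case: ltnP => // /leq_sizeP->; rewrite ?scale0r.
Qed.

Fact endo_horner_linear : linear (fun q => endo_horner q zeta).
Proof.
move=> a p q; pose n := maxn (size p) (size q).
rewrite !(@endo_horner_widen n) ?leq_maxl ?leq_maxr //; last first.
  rewrite (leq_trans (size_polyD _ _)) // geq_max leq_maxr andbT.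
  by rewrite (leq_trans (size_scale_leq _ _)) ?leq_maxl.
rewrite scaler_sumr -big_split; apply: eq_bigr => i _ /=.
by rewrite coefD coefZ scalerDl scalerA.
Qed.

Lemma endo_hornerD p q :
  endo_horner (p + q) zeta = endo_horner p zeta + endo_horner q zeta.
Proof. by have := endo_horner_linear 1 p q; rewrite !scale1r. Qed.

Lemma endo_horner0 : endo_horner 0 zeta = 0.
Proof. by rewrite /endo_horner size_poly0 big_ord0. Qed.

Lemma endo_hornerZ a p : endo_horner (a *: p) zeta = a *: endo_horner p zeta.
Proof. by have := endo_horner_linear a p 0; rewrite endo_horner0 !addr0. Qed.

Lemma endo_hornerN p : endo_horner (- p) zeta = - endo_horner p zeta.
Proof. by rewrite -scaleN1r endo_hornerZ scaleN1r. Qed.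

Lemma endo_hornerB p q :
  endo_horner (p - q) zeta = endo_horner p zeta - endo_horner q zeta.
Proof. by rewrite endo_hornerD endo_hornerN. Qed.

Lemma endo_hornerC c : endo_horner c%:P zeta = c *: \1%VF.
Proof.
rewrite (@endo_horner_widen 1) ?size_polyC ?leq_b1 //.
by rewrite big_ord_recl big_ord0 addr0 coefC.
Qed.

Lemma endo_horner1 : endo_horner 1 zeta = \1%VF.
Proof. by rewrite endo_hornerC scale1r. Qed.

Lemma endo_hornerMX q :
  endo_horner (q * 'X) zeta = (zeta \o endo_horner q zeta)%VF.
Proof.
rewrite (@endo_horner_widen (size q).+1); last first.
  by rewrite (leq_trans (size_polyMleq _ _)) // size_polyX addn2.
rewrite big_ord_recl coefMX eqxx scale0r add0r /endo_horner.
apply/lfunP => u; rewrite comp_lfunE !sum_lfunE linear_sum.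
apply: eq_bigr => i _; rewrite coefMX /= !scale_lfunE linearZ.
by rewrite /= comp_lfunE.
Qed.

Lemma endo_hornerX : endo_horner 'X zeta = zeta.
Proof. by rewrite -['X]mul1r endo_hornerMX endo_horner1 comp_lfun1r. Qed.

Lemma endo_hornerM p q :
  endo_horner (p * q) zeta = (endo_horner p zeta \o endo_horner q zeta)%VF.
Proof.
elim/poly_ind: p => [|p c IH]; first by rewrite mul0r !endo_horner0 comp_lfun0l.
rewrite mulrDl !endo_hornerD -mulrA ['X * q]mulrC mulrA !endo_hornerMX.
by rewrite IH mul_polyC endo_hornerZ endo_hornerC comp_lfunDl comp_lfunA -comp_lfunZl comp_lfun1l.
Qed.

Lemma endo_hornerME p q u :
  endo_horner (p * q) zeta u = endo_horner p zeta (endo_horner q zeta u).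
Proof. by rewrite endo_hornerM comp_lfunE. Qed.

Lemma endo_horner_dvd p q : p %| q -> endo_horner p zeta = 0 ->
  endo_horner q zeta = 0.
Proof. by case/dvdpP=> s -> p0; rewrite endo_hornerM p0 comp_lfun0r. Qed.

Lemma endo_hornerXn i : endo_horner 'X^i zeta = endo_pow i.
Proof.
elim: i => [|i IH]; first by rewrite expr0 endo_horner1.
by rewrite exprSr endo_hornerMX IH.
Qed.

End Evaluation.

Lemma endo_horner_intertwine (k : fieldType) (U U' : vectType k)
    (zeta : 'End(U)) (zeta' : 'End(U')) (f : 'Hom(U, U')) q :
  (f \o zeta = zeta' \o f)%VF ->
  (f \o endo_horner q zeta = endo_horner q zeta' \o f)%VF.
Proof.
move=> fz; elim/poly_ind: q => [|q c IH].
  by rewrite !endo_horner0 comp_lfun0l comp_lfun0r.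
rewrite !endo_hornerD !endo_hornerMX !endo_hornerC comp_lfunDr comp_lfunDl.
rewrite comp_lfunA fz -comp_lfunA IH comp_lfunA.
by rewrite -comp_lfunZr -comp_lfunZl comp_lfun1l comp_lfun1r.
Qed.

(** * Cyclic summands *)

(** The ideal of [r ^+ m.-1] is the smallest one containing that of [r ^+ m]
    properly: its image is the socle of the quotient. *)
Lemma primary_bezout (k : fieldType) (r : {poly k}) m q :
  irreducible_poly r -> (0 < m)%N -> ~~ (r ^+ m %| q) ->
  exists s t, s * q + t * r ^+ m = r ^+ m.-1.
Proof.
move=> irr; elim: m q => [//|m IH] q _ ndiv.
have [rq|] := boolP (r %| q); last first.
  rewrite -irreducible_poly_coprime // coprimep_sym.
  case/Bezout_eq1_coprimepP=> -[s t] /= st1.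
  exists (r ^+ m * s), t.
  by rewrite exprS /= -[RHS]mulr1 -st1; ring.
have [q' def] := dvdpP _ _ rq; rewrite def in ndiv *.
have r0 : r != 0 by apply: irredp_neq0.
case: m IH ndiv => [|m] IH ndiv.
  by rewrite expr1 dvdp_mull ?dvdpp in ndiv.
have [|s [t st]] := IH q' isT.
  by apply: contra ndiv => h; rewrite exprSr dvdp_mul.
exists s, t; transitivity (r * (s * q' + t * r ^+ m.+1)).
  by rewrite [in LHS]exprS; ring.
by rewrite st -exprS.
Qed.

(** The submodule of [U] generated by [v] is a copy of [k['X]] modulo
    [p = r ^+ m]. By [top], the functional [phi] is nonzero on the socle, hence
    vanishes on no nonzero ideal, and [(s, t) |-> phi ((s * t) v)] is a
    nondegenerate form. The vectors on which all translates of [phi] vanish then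
    form an invariant complement. *)
Section CyclicSummand.
Variables (k : fieldType) (U : vectType k) (zeta : 'End(U)).
Variables (r : {poly k}) (m : nat) (v : U) (phi : 'Hom(U, k^o)).
Hypotheses (irr : irreducible_poly r) (mon : r \is monic) (m0 : (0 < m)%N).
Let p := r ^+ m.
Let n := (size p).-1.
Hypothesis killv : endo_horner p zeta v = 0.
Hypothesis killphi : forall w, phi (endo_horner p zeta w) = 0.
Hypothesis top : phi (endo_horner (r ^+ m.-1) zeta v) != 0.

Let p_monic : p \is monic. Proof. exact: monic_exp. Qed.

Let sizep : size p = n.+1.
Proof. by rewrite /n prednK // lt0n size_poly_eq0 monic_neq0. Qed.

Lemma size_mod_le (q : {poly k}) : (size (q %% p)%R <= n)%N.
Proof. by rewrite -ltnS -sizep ltn_modp monic_neq0. Qed.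

Lemma cyclic_radical q :
  (forall s, phi (endo_horner (s * q) zeta v) = 0) -> p %| q.
Proof.
move=> rad; apply: contraT => /(primary_bezout irr m0)[s [t st]].
move: top; rewrite -st endo_hornerD add_lfunE lfunD rad.
by rewrite endo_hornerME killv !linear0 addr0 eqxx.
Qed.

Lemma cyclic_annihilator q : endo_horner q zeta v = 0 -> p %| q.
Proof.
by move=> qv; apply: cyclic_radical => s; rewrite endo_hornerME qv !linear0.
Qed.

Fact cyclic_map_linear :
  linear (fun q : {poly_n k} => endo_horner (val q) zeta v).
Proof.
move=> a q s.
by rewrite [val _]linearP endo_hornerD endo_hornerZ add_lfunE scale_lfunE.
Qed.

Definition cyclic_map : {linear {poly_n k} -> U} :=
  HB.pack (fun q : {poly_n k} => endo_horner (val q) zeta v)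
    (GRing.isLinear.Build k _ _ _ _ cyclic_map_linear).

Definition cyclic_span : {vspace U} := limg (linfun cyclic_map).

Fact cyclic_test_linear :
  linear (fun w => [ffun i : 'I_n => phi (endo_pow zeta i w)]).
Proof. by move=> a w u; apply/ffunP => i; rewrite !ffunE !linearP. Qed.

Definition cyclic_test : {linear U -> {ffun 'I_n -> k^o}} :=
  HB.pack (fun w => [ffun i : 'I_n => phi (endo_pow zeta i w)])
    (GRing.isLinear.Build k _ _ _ _ cyclic_test_linear).

Definition cyclic_coker : {vspace U} := lker (linfun cyclic_test).

Lemma cyclic_spanP u :
  reflect (exists q, u = endo_horner q zeta v) (u \in cyclic_span).
Proof.
apply: (iffP memv_imgP) => [[q _ ->]|[q ->]].
  by exists (val q); rewrite lfunE.
exists (npolyp n (q %% p)); first exact: memvf.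
rewrite lfunE /= npolypK ?size_mod_le // {1}(divp_eq q p) endo_hornerD.
by rewrite add_lfunE endo_hornerME killv linear0 add0r.
Qed.

Lemma cyclic_cokerP w :
  reflect (forall q, phi (endo_horner q zeta w) = 0) (w \in cyclic_coker).
Proof.
rewrite memv_ker lfunE /=; apply: (iffP eqP) => [/ffunP w0 q|w0].
  rewrite (divp_eq q p) endo_hornerD add_lfunE lfunD mulrC endo_hornerME.
  rewrite killphi add0r (endo_horner_widen _ (size_mod_le q)) sum_lfunE linear_sum.
  apply: big1 => i _; have := w0 i; rewrite !ffunE scale_lfunE linearZ /= => ->.
  by rewrite scaler0.
by apply/ffunP => i; rewrite !ffunE -endo_hornerXn.
Qed.

Lemma dim_cyclic_span : \dim cyclic_span = n.
Proof.
rewrite /cyclic_span limg_dim_eq ?dim_polyn //.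
apply/eqP; rewrite -subv0; apply/subvP => q /memv_capP[_].
rewrite memv_ker memv0 lfunE /= => /eqP/cyclic_annihilator pq.
apply: contraT => q0; have := dvdp_leq (q0 : val q != 0) pq.
by rewrite leqNgt sizep ltnS size_npoly.
Qed.

Lemma cyclic_cap : (cyclic_span :&: cyclic_coker = 0)%VS.
Proof.
apply/eqP; rewrite -subv0; apply/subvP => u.
move=> /memv_capP[/cyclic_spanP[q ->] /cyclic_cokerP rad].
have /dvdpP[s ->] : p %| q.
  by apply: cyclic_radical => s; rewrite endo_hornerME.
by rewrite endo_hornerME killv linear0 mem0v.
Qed.

Lemma cyclic_add : (cyclic_span + cyclic_coker = fullv)%VS.
Proof.
apply/eqP; rewrite eqEdim subvf dimv_disjoint_sum ?cyclic_cap // dim_cyclic_span.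
rewrite -(limg_ker_dim (linfun cyclic_test) fullv) capfv addnC leq_add2r.
apply: leq_trans (dimvS (subvf _)) _.
by rewrite dimvf /dim /= card_ord muln1.
Qed.

Lemma cyclic_top_neq0 : endo_horner (r ^+ m.-1) zeta v != 0.
Proof. by apply: contra top => /eqP->; rewrite linear0. Qed.

Lemma cyclic_span_neq0 : cyclic_span != 0%VS.
Proof.
apply: contraNneq cyclic_top_neq0 => span0; rewrite -memv0 -span0.
by apply/cyclic_spanP; exists (r ^+ m.-1).
Qed.

End CyclicSummand.

Lemma endo_hornerNX (k : fieldType) (U : vectType k) (zeta : 'End(U)) q :
  endo_horner q (- zeta) = endo_horner (q \Po - 'X) zeta.
Proof.
elim/poly_ind: q => [|q c IH]; first by rewrite comp_poly0 !endo_horner0.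
rewrite comp_polyD comp_polyM comp_polyX comp_polyC mulrN.
rewrite !endo_hornerD !endo_hornerC endo_hornerN !endo_hornerMX IH.
by rewrite comp_lfunNl.
Qed.

Lemma comp_polyNXK (R : comNzRingType) (q : {poly R}) :
  (q \Po - 'X) \Po - 'X = q.
Proof.
have NX : - 'X \Po - 'X = 'X :> {poly R}.
  transitivity ((-1 *: 'X) \Po - 'X : {poly R}); first by rewrite scaleN1r.
  by rewrite comp_polyZ comp_polyX scaleN1r opprK.
by rewrite -comp_polyA NX comp_polyXr.
Qed.

(** The involution [e] is a grading of [Q] for which [N] is odd. A longest
    Jordan chain of [N] that ends in the kernel splits off together with the
    grading, once its top vector [v] and the functional [phi] that
    detects its last vector [u] have been chosen homogeneous. If nothing splits off,
    then this chain is all of [Q], or [N] is injective. *)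
Section GradedChain.
Variables (k : fieldType) (Q : vectType k) (N e : 'End(Q)).
Hypothesis two : (2 : k) != 0.
Hypothesis ee : (e \o e = \1)%VF.
Hypothesis eN : (e \o N = - (N \o e))%VF.
Hypothesis indec : forall P : 'End(Q), (P \o P = P)%VF ->
  (P \o N = N \o P)%VF -> (P \o e = e \o P)%VF -> P = 0 \/ P = \1%VF.

Local Notation pw := (endo_pow N).
Local Notation J j := (lker N :&: limg (pw j))%VS.

Let eeE x : e (e x) = x.
Proof. by rewrite -comp_lfunE ee id_lfunE. Qed.

Let eNE x : e (N x) = - N (e x).
Proof. by rewrite -comp_lfunE eN opp_lfunE comp_lfunE. Qed.

Let e_horner q x :
  e (endo_horner q N x) = endo_horner (q \Po - 'X) N (e x).
Proof.
have eN' : (e \o N = (- N) \o e)%VF by rewrite eN comp_lfunNl.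
by rewrite -comp_lfunE (endo_horner_intertwine _ eN') comp_lfunE endo_hornerNX.
Qed.

Let e_pow j x : e (pw j x) = (-1) ^+ j *: pw j (e x).
Proof.
elim: j => [|j IH]; first by rewrite scale1r /= !id_lfunE.
by rewrite /= !comp_lfunE eNE IH linearZ exprS mulN1r scaleNr.
Qed.

Let J_e j x : x \in J j -> e x \in J j.
Proof.
move=> /memv_capP[]; rewrite memv_cap !memv_ker => /eqP Nx /memv_imgP[y _ def].
apply/andP; split.
  by rewrite -[N (e x)]opprK -eNE Nx linear0 oppr0.
by rewrite def e_pow memvZ // memv_img ?memvf.
Qed.

Let J_vanishes : exists j, J j == 0%VS.
Proof.
pose d := \dim {:Q}.
have [/existsP[j Jj]|/existsPn nJ] := boolP [exists j : 'I_d.+1, J j == 0%VS].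
  by exists j.
suff bound j : (j <= d.+1)%N -> (\dim (limg (pw j)) + j <= d)%N.
  by have := bound d.+1 (leqnn _); rewrite addnS leqNgt ltnS leq_addl.
elim: j => [_|j IH lej]; first by rewrite addn0 dimvS ?subvf.
have := limg_ker_dim N (limg (pw j)); rewrite -limg_comp -[(N \o _)%VF]/(pw j.+1).
have : (0 < \dim (limg (pw j) :&: lker N))%N.
  by rewrite lt0n dimv_eq0 capvC (nJ (Ordinal lej)).
by have := IH (ltnW lej); lia.
Qed.

Lemma graded_chain : (\dim (lker N) <= 1)%N.
Proof.
case: (ex_minnP J_vanishes) => m Jm minm.
have [->|N0] := eqVneq (lker N) 0%VS; first by rewrite dimv0.
have m0 : (0 < m)%N.
  rewrite lt0n; apply: contra N0 => /eqP m0; move: Jm; rewrite m0 /=.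
  by rewrite lim1g capvf.
have Jm1 : J m.-1 != 0%VS.
  by apply: contraT => /negPn/minm; rewrite leqNgt prednK // leqnn.
(* Minimality of [m] provides a nonzero [x] in [J m.-1], and one of its two
   homogeneous components is nonzero. *)
have [s [u [ss u0 uJ eu]]] : exists s u,
    [/\ s * s = 1 :> k, u != 0, u \in J m.-1 & e u = s *: u].
  have xJ := memv_pick (J m.-1); set x := vpick _ in xJ.
  have x0 : x != 0 by rewrite vpick0.
  have eigen (s : k) : s * s = 1 -> e (x + s *: e x) = s *: (x + s *: e x).
    by move=> ss; rewrite lfunD linearZ /= eeE scalerDr scalerA ss scale1r addrC.
  have inJ (s : k) : x + s *: e x \in J m.-1 by rewrite memvD ?memvZ ?J_e.
  have [xe|xe] := eqVneq (x + e x) 0; last first.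
    exists 1, (x + e x); have := eigen 1; have := inJ 1.
    by rewrite !scale1r mulr1 => ? /(_ erefl).
  exists (-1), (x - e x); have := eigen (-1); have := inJ (-1).
  rewrite !scaleN1r mulrNN mulr1 => ? /(_ erefl) ?; split=> //.
  apply: contra x0 => /eqP xe'.
  have : 2 *: x == 0 by rewrite scaler_nat mulr2n -[X in X + _](subrK (e x)) xe' add0r addrC xe.
  by rewrite scaler_eq0 (negPf two).
have [] := memv_capP uJ; rewrite memv_ker => /eqP Nu /memv_imgP[v0 _ defu].
have [t tE tt] : exists2 t : k, t = s * (-1) ^+ m.-1 & t * t = 1.
  by exists (s * (-1) ^+ m.-1); rewrite // mulrACA ss mul1r -expr2 sqrr_sign.
pose v := 2^-1 *: (v0 + t *: e v0).
have ev : e v = t *: v.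
  rewrite /v linearZ /= lfunD linearZ /= eeE [RHS]scalerA mulrC -scalerA.
  by rewrite [t *: (_ + _)]scalerDr scalerA tt scale1r addrC.
have pv : pw m.-1 v = u.
  have pe : pw m.-1 (e v0) = (-1) ^+ m.-1 *: e u.
    by rewrite defu e_pow scalerA -expr2 sqrr_sign scale1r.
  rewrite /v linearZ /= lfunD linearZ /= pe -defu eu !scalerA -mulrA.
  rewrite [(-1) ^+ m.-1 * s]mulrC -tE tt scale1r -mulr2n -scaler_nat scalerA.
  by rewrite mulVf // scale1r.
have [phi0 [phi0u phi0im]] : exists phi : 'Hom(Q, k^o),
    phi u = 1 /\ forall w, w \in limg (pw m) -> phi w = 0.
  apply: separating_functional; apply: contra u0 => uim.
  by rewrite -memv0 -(eqP Jm) memv_cap memv_ker Nu eqxx.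
pose phi : 'Hom(Q, k^o) := 2^-1 *: (phi0 + s *: (phi0 \o e)%VF).
have phiE w : phi w = 2^-1 * (phi0 w + s * phi0 (e w)).
  by rewrite scale_lfunE add_lfunE scale_lfunE comp_lfunE.
have phie w : phi (e w) = s * phi w.
  rewrite !phiE eeE [RHS]mulrCA; congr (_ * _).
  by rewrite mulrDr mulrA ss mul1r addrC.
have phiu : phi u = 1.
  rewrite phiE eu linearZ /= phi0u -[s *: 1]/(s * 1) mulr1 ss.
  by rewrite -[1 + 1]/2%:R mulVf.
have phiim w : phi (pw m w) = 0.
  rewrite phiE e_pow !phi0im ?memvZ ?memv_img ?memvf //.
  by rewrite mulr0 addr0 mulr0.
have irrX : irreducible_poly ('X : {poly k}) by rewrite -['X]subr0; apply: irredp_XsubC.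
have monX : ('X : {poly k}) \is monic by apply: monicX.
have killv : endo_horner ('X ^+ m) N v = 0.
  by rewrite endo_hornerXn -(prednK m0) /= comp_lfunE pv.
have killphi w : phi (endo_horner ('X ^+ m) N w) = 0 by rewrite endo_hornerXn.
have top : phi (endo_horner ('X ^+ m.-1) N v) != 0.
  by rewrite endo_hornerXn pv phiu oner_eq0.
have spanP := cyclic_spanP monX killv.
have cokP := cyclic_cokerP monX killphi.
set Sp := cyclic_span _ _ _ _ in spanP; set K := cyclic_coker _ _ _ _ in cokP.
have Sp0 : Sp != 0%VS := cyclic_span_neq0 monX killv top.
have full : (Sp + K)%VS = fullv := cyclic_add irrX monX m0 killv killphi top.
have cap : (Sp :&: K = 0)%VS := cyclic_cap irrX monX m0 killv killphi top.
have K0 : K = 0%VS.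
  apply/eqP; apply: contraT => K0.
  have [|p [pp p0 p1 pS pK]] := @decomposition_idempotent _ _ Sp K; first by split.
  have [||/eqP|/eqP] := indec pp; rewrite ?(negPf p0) ?(negPf p1) //.
    apply: (idempotent_commutes full) => // w.
      move=> /spanP[q ->]; apply/spanP; exists ('X * q).
      by rewrite endo_hornerME endo_hornerX.
    move=> /cokP w0; apply/cokP => q.
    have -> : endo_horner q N (N w) = endo_horner (q * 'X) N w.
      by rewrite endo_hornerME endo_hornerX.
    exact: w0.
  apply: (idempotent_commutes full) => // w.
    move=> /spanP[q ->]; apply/spanP; exists (t *: (q \Po - 'X)).
    by rewrite e_horner ev linearZ endo_hornerZ scale_lfunE.
  move=> /cokP w0; apply/cokP => q.
  have -> : endo_horner q N (e w) = e (endo_horner (q \Po - 'X) N w).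
    by rewrite e_horner comp_polyNXK.
  by rewrite phie w0 mulr0.
rewrite K0 addv0 in full.
suff ker_line : (lker N <= <[u]>)%VS.
  by apply: leq_trans (dimvS ker_line) _; rewrite dim_vline; case: (u != 0).
apply/subvP => x; rewrite memv_ker => /eqP Nx.
have /spanP[q defx] : x \in Sp by rewrite full memvf.
have : 'X ^+ m %| 'X * q.
  apply: (cyclic_annihilator irrX m0 killv top).
  by rewrite endo_hornerME endo_hornerX -defx.
rewrite -(prednK m0) exprS dvdp_mul2l ?polyX_eq0 // => /dvdpP[a defq].
rewrite defx defq endo_hornerME endo_hornerXn pv.
elim/poly_ind: a {defq} => [|a c _]; first by rewrite endo_horner0 zero_lfunE mem0v.
rewrite endo_hornerD add_lfunE endo_hornerME endo_hornerX Nu linear0 add0r.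
by rewrite endo_hornerC scale_lfunE id_lfunE memvZ ?memv_line.
Qed.

End GradedChain.

(** * Minimal polynomials *)

Section MinimalPolynomial.
Variables (k : fieldType) (U : vectType k) (zeta : 'End(U)).

Fact horner_map_linear n :
  linear (fun q : {poly_n k} => endo_horner (val q) zeta).
Proof. by move=> a p q; rewrite [val _]linearP endo_horner_linear. Qed.

Definition horner_map n : {linear {poly_n k} -> 'End(U)} :=
  HB.pack (fun q : {poly_n k} => endo_horner (val q) zeta)
    (GRing.isLinear.Build k _ _ _ _ (@horner_map_linear n)).

Lemma exists_minpoly : exists p, is_minpoly zeta p.
Proof.
have [|n ker_n min_n] := @ex_minnP (fun n => lker (linfun (horner_map n)) != 0%VS).
  pose d := \dim {: 'End(U)}; exists d.+1; rewrite -dimv_eq0 -lt0n.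
  have := limg_ker_dim (linfun (horner_map d.+1)) fullv.
  rewrite capfv dim_polyn => dim_ker.
  have : (\dim (limg (linfun (horner_map d.+1))) <= d)%N by rewrite dimvS ?subvf.
  by move: dim_ker; move: (\dim _) (\dim _) => a b; lia.
set q := vpick (lker (linfun (horner_map n))).
have q0 : val q != 0 by rewrite -[val q == 0]/(q == 0) vpick0.
have qz : endo_horner (val q) zeta = 0.
  by have := memv_pick (lker (linfun (horner_map n))); rewrite memv_ker lfunE => /eqP.
have c0 : (lead_coef (val q))^-1 != 0 by rewrite invr_eq0 lead_coef_eq0.
exists ((lead_coef (val q))^-1 *: val q); split.
  by rewrite monicE lead_coefZ mulVf // lead_coef_eq0.
move=> f; rewrite dvdpZl //; split=> [fz|]; last by move/endo_horner_dvd; apply.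
apply: contraT => ndiv; pose g := f %% val q.
have g0 : g != 0 by [].
have gz : endo_horner g zeta = 0.
  have -> : g = f - f %/ val q * val q
    by apply/eqP; rewrite eq_sym subr_eq addrC -divp_eq.
  by rewrite endo_hornerB fz endo_hornerM qz comp_lfun0r subr0.
have : (size g < n)%N.
  by apply: leq_trans (size_npoly q); rewrite ltn_modp.
rewrite ltnNge min_n //; apply: contra g0 => /eqP ker0.
suff : npolyp (size g) g \in lker (linfun (horner_map (size g))).
  by rewrite ker0 memv0 => /eqP/(congr1 val)/=; rewrite npolypK // => ->.
by rewrite memv_ker lfunE /= npolypK // gz.
Qed.

Lemma exists_irreducible_factor (p : {poly k}) : (1 < size p)%N ->
  exists r, [/\ irreducible_poly r, r \is monic & r %| p].
Proof.
move=> p1.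
have [|d [d1 dp] mind] := @exists_maximizer _ p
    (fun d => (1 < size d)%N /\ d %| p) (fun d => (size p - size d)%N) (size p) _
    (fun d => leq_subr _ _).
  by rewrite dvdpp.
have p0 : p != 0 by rewrite -size_poly_gt0 (leq_trans _ p1).
have d0 : d != 0 by rewrite -size_poly_gt0 (leq_trans _ d1).
have c0 : (lead_coef d)^-1 != 0 by rewrite invr_eq0 lead_coef_eq0.
exists ((lead_coef d)^-1 *: d); split; last by rewrite dvdpZl.
  split; first by rewrite size_scale.
  move=> q q1; rewrite dvdpZr // => qd; rewrite eqp_sym.
  apply: (eqp_trans (eqp_scale _ c0)); rewrite eqp_sym -dvdp_size_eqp //.
  have q0 : q != 0 by apply: contraTneq qd => ->; rewrite dvd0p.
  have leqd := dvdp_leq d0 qd; have ledp := dvdp_leq p0 dp.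
  have q1' : (1 < size q)%N by rewrite ltn_neqAle eq_sym q1 size_poly_gt0.
  have /= := mind q (conj q1' (dvdp_trans qd dp)).
  by rewrite eqn_leq leqd leq_sub2lE.
by rewrite monicE lead_coefZ mulVf // lead_coef_eq0.
Qed.

(** A Bezout relation [s * a + t * b = 1] makes [(s * a)(zeta)] an idempotent. *)
Lemma coprime_factor_trivial p a b : endo_indecomposable zeta ->
  is_minpoly zeta p -> p = a * b -> coprimep a b ->
  size a = 1%N \/ size b = 1%N.
Proof.
move=> indec [mon minp] def /Bezout_eq1_coprimepP[[s t] /= st].
have p0 : p != 0 by apply: monic_neq0.
have [a0 b0] : a != 0 /\ b != 0.
  by split; apply: contraNneq p0 => z; rewrite def z ?mul0r ?mulr0.
pose f := endo_horner (s * a) zeta.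
have f1 : f - \1%VF = endo_horner (- (t * b)) zeta.
  by rewrite /f -(endo_horner1 zeta) -endo_hornerB -st opprD addNKr.
have ff : (f \o f = f)%VF.
  apply/eqP; rewrite -subr_eq0 -{3}[f]comp_lfun1r -comp_lfunNr -comp_lfunDr f1.
  rewrite /f -endo_hornerM; apply/eqP/minp.
  by rewrite def; apply/dvdpP; exists (- (s * t)); ring.
have fz : (f \o zeta = zeta \o f)%VF.
  by rewrite /f -{2 3}[zeta]endo_hornerX -!endo_hornerM mulrC.
have [f0|f1'] := indecomposable_endo_idempotent indec ff fz.
  right; have /dvdpP[c cE] : p %| s * a by apply/minp.
  apply/eqP; rewrite -dvdp1 -st (dvdp_addl _ (dvdp_mull t (dvdpp b))).
  by rewrite cE def mulrA dvdp_mull.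
left; have /dvdpP[c cE] : p %| - (t * b).
  by apply/minp; rewrite -f1 f1' subrr.
apply/eqP; rewrite -dvdp1 -st (dvdp_addr _ (dvdp_mull s (dvdpp a))).
by rewrite -dvdpNr cE def mulrCA dvdp_mulr.
Qed.

Lemma indecomposable_primary p : endo_indecomposable zeta -> is_minpoly zeta p ->
  exists r m, [/\ irreducible_poly r, r \is monic, (0 < m)%N & p = r ^+ m].
Proof.
move=> indec pmin; have [mon minp] := pmin.
have p0 : p != 0 by apply: monic_neq0.
have p1 : (1 < size p)%N.
  rewrite ltn_neqAle eq_sym size_poly_gt0 p0 andbT.
  have [U0 _] := indec; apply: contra U0 => /eqP sz.
  have /minp : p %| 1 by rewrite dvdp1 sz.
  rewrite endo_horner1 => id0; rewrite -vpick0.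
  by rewrite -[vpick _]id_lfunE id0 zero_lfunE.
have [r [irr monr rp]] := exists_irreducible_factor p1.
have ex_pow : exists m, r ^+ m %| p by exists 0; rewrite expr0 dvd1p.
have [|m rmp maxm] := @ex_maxnP (fun m => r ^+ m %| p) (size p) ex_pow.
  move=> m rmp; apply: leq_trans (dvdp_leq p0 rmp).
  apply: leq_trans (leq_pred _); rewrite size_exp leq_pmull //.
  by have := irr.1; case: (size r) => [|[]].
have [b def] := dvdpP _ _ rmp.
have m0 : (0 < m)%N by rewrite maxm // expr1.
have cop : coprimep b (r ^+ m).
  rewrite coprimep_pexpr // coprimep_sym irreducible_poly_coprime //.
  apply: contraTN (leqnn m.+1) => /dvdpP[c cE]; rewrite -leqNgt maxm //.
  by rewrite def cE exprS -mulrA dvdp_mull.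
exists r, m; split=> //.
have [sb|srm] := coprime_factor_trivial indec pmin def cop.
  have monb : b \is monic by rewrite -(monicMr _ (monic_exp m monr)) -def.
  have : b == 1 by rewrite -eqp_monic ?monic1 // -size_poly_eq1 sb.
  by rewrite def => /eqP->; rewrite mul1r.
have := irr.1; have := dvdp_leq (monic_neq0 (monic_exp m monr)) (dvdp_exp2l r m0).
by rewrite expr1 srm; lia.
Qed.

End MinimalPolynomial.

(** * Cyclic endomorphisms *)

Lemma lfun_bijective_inverse (k : fieldType) (U V : vectType k)
    (f : 'Hom(U, V)) : bijective f ->
  exists g : 'Hom(V, U), cancel f g /\ cancel g f.
Proof.
move=> bij; have fI := bij_inj bij; exists (f^-1)%VF.
have fK : cancel f (f^-1)%VF by apply/lker0_lfunK/lker0P.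
split=> // v; have [g gK Kg] := bij.
by rewrite -[v]Kg fK.
Qed.

Lemma lfun_injective_bijective (k : fieldType) (U V : vectType k)
    (f : 'Hom(U, V)) :
  injective f -> (\dim {:V} <= \dim {:U})%N -> bijective f.
Proof.
move=> fI le; exists (f^-1)%VF; first by apply/lker0_lfunK/lker0P.
move=> v; apply: limg_lfunVK; suff -> : limg f = fullv by apply: memvf.
have /lker0P/eqP ker0 := fI.
by apply/eqP; rewrite eqEdim subvf limg_dim_eq // ker0 capv0.
Qed.

Lemma lfun_bijective_dim (k : fieldType) (U V : vectType k) (f : 'Hom(U, V)) :
  bijective f -> \dim {:U} = \dim {:V}.
Proof.
move=> /lfun_bijective_inverse[g [fK gK]].
have fI : lker f == 0%VS by apply/lker0P/(can_inj fK).
rewrite -(@limg_dim_eq _ _ _ f fullv) ?(eqP fI) ?capv0 //; congr (\dim _).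
apply/eqP; rewrite eqEsubv subvf; apply/subvP => v _.
by rewrite -[v]gK memv_img ?memvf.
Qed.

Section EndoIso.
Variable k : fieldType.

Lemma endo_iso_sym (U U' : vectType k) (zeta : 'End(U)) (zeta' : 'End(U')) :
  endo_iso zeta zeta' -> endo_iso zeta' zeta.
Proof.
move=> [f [/lfun_bijective_inverse[g [fK gK]] fz]].
exists g; split; first by exists f.
apply/lfunP => u; rewrite !comp_lfunE -{1}[u]gK.
by move/lfunP: fz => /(_ (g u)); rewrite !comp_lfunE => <-; rewrite fK.
Qed.

Lemma endo_iso_trans (U1 U2 U3 : vectType k) (z1 : 'End(U1)) (z2 : 'End(U2))
    (z3 : 'End(U3)) :
  endo_iso z1 z2 -> endo_iso z2 z3 -> endo_iso z1 z3.
Proof.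
move=> [f [bf fz]] [g [bg gz]]; exists (g \o f)%VF; split.
  by apply: (eq_bij (bij_comp bg bf)) => u; rewrite comp_lfunE.
by rewrite -comp_lfunA fz comp_lfunA gz comp_lfunA.
Qed.

Lemma endo_iso_minpoly (U U' : vectType k) (zeta : 'End(U)) (zeta' : 'End(U')) p :
  endo_iso zeta zeta' -> is_minpoly zeta p -> is_minpoly zeta' p.
Proof.
move=> [f [/lfun_bijective_inverse[g [fK gK]] fz]] [mon minp]; split=> // q.
have fq u : f (endo_horner q zeta u) = endo_horner q zeta' (f u).
  by rewrite -!comp_lfunE (endo_horner_intertwine q fz).
split=> [q0|/minp q0]; last first.
  by apply/lfunP => u; rewrite -[u]gK -fq q0 !zero_lfunE linear0.
by apply/minp/lfunP => u; apply: (can_inj fK); rewrite fq q0 !zero_lfunE linear0.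
Qed.

Lemma is_minpoly_unique (U : vectType k) (zeta : 'End(U)) p q :
  is_minpoly zeta p -> is_minpoly zeta q -> p = q.
Proof.
move=> [monp minp] [monq minq]; apply/eqP; rewrite -eqp_monic // /eqp.
by apply/andP; split; [apply/minp/minq | apply/minq/minp]; apply: dvdpp.
Qed.

End EndoIso.

(** Multiplication by ['X] on polynomials modulo [p]. *)
Section Companion.
Variables (k : fieldType) (p : {poly k}).
Local Notation n := (size p).-1.
Local Notation quot := {poly_(size p).-1 k}.

Lemma npoly_inj (u v : quot) : u = v :> {poly k} -> u = v.
Proof. exact: val_inj. Qed.

Definition reduce (q : {poly k}) : quot := npolyp n (q %% p).

Fact companion_linear : linear (fun u : quot => reduce ((u : {poly k}) * 'X)).
Proof.
move=> a u v; apply: npoly_inj; apply/polyP => i; rewrite coef_npolyp.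
rewrite -[(a *: u + v : quot) : {poly k}]/(a *: (u : {poly k}) + v).
rewrite -[RHS]/((a *: (reduce ((u : {poly k}) * 'X) : {poly k})
                + reduce ((v : {poly k}) * 'X))`_i).
rewrite coefD coefZ !coef_npolyp mulrDl -scalerAl modpD modpZl coefD coefZ.
by case: ifP; rewrite ?mulr0 ?addr0.
Qed.

Definition companion_map : {linear quot -> quot} :=
  HB.pack (fun u : quot => reduce ((u : {poly k}) * 'X))
    (GRing.isLinear.Build k _ _ _ _ companion_linear).

Definition companion : 'End(quot) := linfun companion_map.

Hypothesis mon : p \is monic.

Lemma size_monic : size p = n.+1.
Proof. by rewrite prednK // size_poly_gt0 monic_neq0. Qed.

Lemma reduceE q : reduce q = q %% p :> {poly k}.
Proof. by rewrite npolypK // -ltnS -size_monic ltn_modp monic_neq0. Qed.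

Lemma mod_npoly (u : quot) : (u : {poly k}) %% p = u.
Proof.
by apply/modp_small/(leq_ltn_trans (size_npoly u)); rewrite prednK // size_monic.
Qed.

Lemma companionE u : companion u = ((u : {poly k}) * 'X) %% p :> {poly k}.
Proof. by rewrite lfunE reduceE. Qed.

Lemma companion_hornerE q (u : quot) :
  endo_horner q companion u = (q * u) %% p :> {poly k}.
Proof.
elim/poly_ind: q => [|q c IH].
  by rewrite endo_horner0 zero_lfunE mul0r mod0p.
rewrite endo_hornerD add_lfunE endo_hornerMX comp_lfunE endo_hornerC.
rewrite scale_lfunE id_lfunE.
transitivity ((companion (endo_horner q companion u) : {poly k}) + c *: (u : {poly k})).
  by [].
rewrite companionE IH [_ * 'X]mulrC modp_mul mulrDl mul_polyC modpD modpZl.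
by rewrite mod_npoly mulrA [q * 'X]mulrC.
Qed.

Lemma companion_minpoly : is_minpoly companion p.
Proof.
split=> // q; split=> [q0|pq]; last first.
  apply/lfunP => u; apply: npoly_inj; rewrite companion_hornerE zero_lfunE.
  by apply/eqP; rewrite -[_ == _]/(p %| _) dvdp_mulr.
have [n0|n0] := posnP n.
  by rewrite (_ : p %| q) // (dvdp_trans _ (dvd1p q)) // dvdp1 size_monic n0.
have := companion_hornerE q (reduce 1); rewrite q0 zero_lfunE reduceE modp_mul mulr1.
by move/esym/eqP.
Qed.

(** An endomorphism commuting with multiplication by ['X] is multiplication by
    its value [f] at [1]. If it is idempotent, [r ^+ m] divides [f * (f - 1)],
    and [r] cannot divide both coprime factors. *)
Lemma companion_indecomposable r m : irreducible_poly r -> (0 < m)%N ->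
  p = r ^+ m -> endo_indecomposable companion.
Proof.
move=> irr m0 def.
have n0 : (0 < n)%N.
  rewrite def size_exp muln_gt0 m0 andbT.
  by have := irr.1; case: (size r) => [|[]].
apply: indecomposable_endoI; first by rewrite -dimv_eq0 dim_polyn -lt0n.
move=> e ee ez; pose f : {poly k} := e (reduce 1).
have eE (u : quot) : e u = (f * u) %% p :> {poly k}.
  have def_u : u = endo_horner u companion (reduce 1).
    apply: npoly_inj; rewrite companion_hornerE reduceE modp_mul mulr1.
    by rewrite mod_npoly.
  rewrite {1}def_u -comp_lfunE (endo_horner_intertwine _ ez) comp_lfunE.
  by rewrite companion_hornerE mulrC.
have : p %| f * (f - 1).
  have : e (e (reduce 1)) = f :> {poly k} by rewrite -comp_lfunE ee.
  rewrite eE -/f => ff; suff -> : f * (f - 1) = (f * f) %/ p * p by apply: dvdp_mull.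
  by rewrite mulrBr mulr1; apply/eqP; rewrite subr_eq -[X in _ + X]ff -divp_eq.
have [rf|rf] := boolP (r %| f).
  rewrite Gauss_dvdpl; last first.
    rewrite def coprimep_pexpl // irreducible_poly_coprime //.
    apply/negP => rf1; have := dvdp_sub rf rf1; rewrite subKr.
    by rewrite dvdp1; have := irr.1; case: (size r) => [|[]].
  move=> pf; left; apply/lfunP => u; apply: npoly_inj; rewrite eE zero_lfunE.
  by apply/eqP; rewrite -[_ == _]/(p %| _) dvdp_mulr.
rewrite Gauss_dvdpr; last by rewrite def coprimep_pexpl // irreducible_poly_coprime.
move=> pf1; right; apply/lfunP => u; apply: npoly_inj; rewrite eE id_lfunE.
rewrite -[f](subrK 1) mulrDl mul1r modpD modp_eq0 ?dvdp_mulr // add0r.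
by rewrite mod_npoly.
Qed.

End Companion.

(** A vector outside the kernel of [r ^+ m.-1] generates a submodule isomorphic
    to [k['X]] modulo [r ^+ m] that has an invariant complement; by
    indecomposability the complement is zero. *)
Lemma indecomposable_companion (k : fieldType) (U : vectType k)
    (zeta : 'End(U)) : endo_indecomposable zeta ->
  exists r m, [/\ irreducible_poly r, r \is monic, (0 < m)%N,
    is_minpoly zeta (r ^+ m) & endo_iso (companion (r ^+ m)) zeta].
Proof.
move=> indec; have [p pmin] := exists_minpoly zeta.
have [r [m [irr mon m0 def]]] := indecomposable_primary indec pmin.
have monp : r ^+ m \is monic by apply: monic_exp.
exists r, m; split=> //; first by rewrite -def.
have [_ minp] := pmin; rewrite def in minp.
have rm0 : endo_horner (r ^+ m) zeta = 0 by apply/minp.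
have : endo_horner (r ^+ m.-1) zeta != 0.
  apply/eqP => /minp; rewrite -{1}(prednK m0) exprS => dvd.
  have r0 := monic_neq0 (monic_exp m.-1 mon).
  have := dvdp_leq r0 dvd; rewrite size_mul ?(monic_neq0 mon) //.
  by have := irr.1; have := size_poly_gt0 (r ^+ m.-1); rewrite r0; lia.
case/lfunPn=> v; rewrite zero_lfunE => topv.
have [phi [phi1 _]] : exists phi : 'Hom(U, k^o),
    phi (endo_horner (r ^+ m.-1) zeta v) = 1 /\ forall w, w \in 0%VS -> phi w = 0.
  by apply: separating_functional; rewrite memv0.
have top : phi (endo_horner (r ^+ m.-1) zeta v) != 0 by rewrite phi1 oner_eq0.
have killv : endo_horner (r ^+ m) zeta v = 0 by rewrite rm0 zero_lfunE.
have killphi w : phi (endo_horner (r ^+ m) zeta w) = 0.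
  by rewrite rm0 zero_lfunE linear0.
have spanP := cyclic_spanP mon killv.
have cokP := cyclic_cokerP mon killphi.
have dimS := dim_cyclic_span irr mon m0 killv top.
have S0 := cyclic_span_neq0 mon killv top.
have full := cyclic_add irr mon m0 killv killphi top.
have cap := cyclic_cap irr mon m0 killv killphi top.
set Sp := cyclic_span _ _ _ _ in spanP dimS S0 full cap.
set K := cyclic_coker _ _ _ _ in cokP full cap.
have K0 : K = 0%VS.
  apply/eqP; apply: contraT => K0; have [_ []] := indec.
  exists Sp, K; split=> //; apply/subvP => _ /memv_imgP[w wS ->].
    move/spanP: wS => [q ->]; apply/spanP; exists ('X * q).
    by rewrite endo_hornerME endo_hornerX.
  move/cokP: wS => w0; apply/cokP => q.
  have -> : endo_horner q zeta (zeta w) = endo_horner (q * 'X) zeta w.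
    by rewrite endo_hornerME endo_hornerX.
  exact: w0.
rewrite K0 addv0 in full.
exists (linfun (cyclic_map zeta r m v)); split.
  apply: lfun_injective_bijective; last by rewrite -full dimS dim_polyn.
  apply/lker0P; rewrite -dimv_eq0; apply/eqP.
  have := limg_ker_dim (linfun (cyclic_map zeta r m v)) fullv.
  by rewrite capfv dim_polyn -[limg _]/Sp dimS => e; apply: (@addIn _ _ 0 e).
apply/lfunP => q; rewrite !comp_lfunE !lfunE /= reduceE //.
have -> : zeta (endo_horner (q : {poly k}) zeta v)
    = endo_horner ((q : {poly k}) * 'X) zeta v.
  by rewrite mulrC endo_hornerME endo_hornerX.
rewrite [in RHS](divp_eq ((q : {poly k}) * 'X) (r ^+ m)) endo_hornerD add_lfunE.
by rewrite endo_hornerME killv linear0 add0r.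
Qed.

(** * Skew-invariant pairings and even polynomials *)

(** An isomorphism from [zeta] to [- zeta^*] that is skew-symmetric when read as
    a bilinear form. *)
Definition skew_pairing (k : fieldType) (U : vectType k) (zeta : 'End(U))
    (q : U -> U -> k) : Prop :=
  [/\ forall u, scalar (q u), forall u v, q u v = - q v u,
      forall u, (forall v, q u v = 0) -> u = 0
    & forall u v, q (zeta u) v = - q u (zeta v)].

Lemma skew_form_dual (k : fieldType) (V : vectType k) (B : V -> V -> k) :
  (forall u, scalar (B u)) -> (forall u v, B u v = - B v u) ->
  (forall u, (forall v, B u v = 0) -> u = 0) ->
  exists f : 'Hom(V, dual V), bijective f /\ forall u v, f u v = B u v.
Proof.
move=> lin skew nondeg.
pose BL u : {linear V -> k^o} :=
  HB.pack (B u) (GRing.isLinear.Build k V k^o _ (B u) (lin u)).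
pose f (u : V) : dual V := linfun (BL u).
have fE u v : f u v = B u v by rewrite lfunE.
have flin : linear f.
  move=> a u v; apply/lfunP => w; rewrite add_lfunE scale_lfunE !fE.
  by rewrite skew lin opprD -mulrN -!(skew _ w).
pose fL : {linear V -> dual V} :=
  HB.pack f (GRing.isLinear.Build k V (dual V) _ f flin).
exists (linfun fL); split=> [|u v]; last by rewrite [linfun _ _]lfunE fE.
apply: lfun_injective_bijective; last by rewrite !dimvf /dim /= muln1.
apply/lker0P; rewrite -subv0; apply/subvP => u; rewrite memv_ker memv0 lfunE /=.
by move=> /eqP fu0; apply/eqP/nondeg => v; rewrite -fE fu0 zero_lfunE.
Qed.

Section Transposition.
Variables (k : fieldType) (U : vectType k) (zeta : 'End(U)).

Lemma transposeE (phi : 'Hom(U, k^o)) : transpose zeta phi = (phi \o zeta)%VF.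
Proof. by rewrite lfunE. Qed.

Lemma transpose_horner q phi :
  endo_horner q (transpose zeta) phi = (phi \o endo_horner q zeta)%VF.
Proof.
elim/poly_ind: q => [|q c IH].
  by rewrite !endo_horner0 zero_lfunE comp_lfun0r.
rewrite !endo_hornerD !endo_hornerC add_lfunE endo_hornerMX comp_lfunE IH transposeE.
rewrite scale_lfunE id_lfunE comp_lfunDr -comp_lfunZr comp_lfun1r -comp_lfunA.
by congr (_ + _); congr (_ \o _)%VF; rewrite endo_hornerM endo_hornerX.
Qed.

Lemma transpose_horner_eq0 q :
  endo_horner q (transpose zeta) = 0 <-> endo_horner q zeta = 0.
Proof.
split=> [q0|q0]; last first.
  by apply/lfunP => phi; rewrite transpose_horner q0 comp_lfun0r zero_lfunE.
apply/lfunP => u; rewrite zero_lfunE; apply/eqP; apply: contraT.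
rewrite -memv0 => /separating_functional[phi [phi1 _]].
have := transpose_horner q phi; rewrite q0 zero_lfunE => /lfunP/(_ u).
by rewrite comp_lfunE phi1 zero_lfunE => /eqP; rewrite eq_sym oner_eq0.
Qed.

Lemma skew_pairing_iso q :
  skew_pairing zeta q -> endo_iso zeta (- transpose zeta).
Proof.
move=> [lin skew nondeg inv]; have [f [bf fE]] := skew_form_dual lin skew nondeg.
exists f; split=> //; apply/lfunP => u; rewrite !comp_lfunE opp_lfunE [transpose _ _]lfunE.
by apply/lfunP => v; rewrite opp_lfunE [precomp _ _ _]comp_lfunE !fE inv.
Qed.

End Transposition.

Lemma skew_pairing_transport (k : fieldType) (U U' : vectType k)
    (zeta : 'End(U)) (zeta' : 'End(U')) q :
  endo_iso zeta zeta' -> skew_pairing zeta q -> exists q', skew_pairing zeta' q'.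
Proof.
move=> [f [/lfun_bijective_inverse[g [fK gK]] fz]] [lin skew nondeg inv].
have fzE u : f (zeta u) = zeta' (f u) by rewrite -!comp_lfunE fz.
have gz u : g (zeta' u) = zeta (g u) by rewrite -{1}[u]gK -fzE fK.
exists (fun u v => q (g u) (g v)); split=> //.
- by move=> u a v w; rewrite linearP lin.
- move=> u u0; apply: (can_inj gK); rewrite linear0; apply: nondeg => v.
  by rewrite -[v]fK.
- by move=> u v; rewrite !gz inv.
Qed.

Definition even_polynomial (k : fieldType) (p : {poly k}) := p \Po - 'X = p.

Section EvenPolynomials.
Variable k : fieldType.
Hypothesis two : (2 : k) != 0.
Implicit Types (p q r : {poly k}).

Lemma size_NX : size (- 'X : {poly k}) = 2%N.
Proof. by rewrite size_polyN size_polyX. Qed.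

Lemma coef_comp_NX q i : (q \Po - 'X)`_i = (-1) ^+ i * q`_i.
Proof.
elim/poly_ind: q i => [|q c IH] i; first by rewrite comp_poly0 coef0 mulr0.
rewrite comp_polyD comp_polyM comp_polyX comp_polyC mulrN.
rewrite !coefD coefN !coefMX coefC.
by case: i => [|i] /=; rewrite ?oppr0 ?mul1r // !addr0 IH exprS mulN1r mulNr.
Qed.

Lemma lead_coef_comp_NX q :
  lead_coef (q \Po - 'X) = (-1) ^+ (size q).-1 * lead_coef q.
Proof. by rewrite /lead_coef size_comp_poly2 ?size_NX // coef_comp_NX. Qed.

Lemma mod_comp_NX p q : p \is monic -> even_polynomial p ->
  (q %% p) \Po - 'X = (q \Po - 'X) %% p.
Proof.
move=> mon even; apply: (@modpP _ _ ((q %/ p) \Po - 'X)).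
  by rewrite {1}(divp_eq q p) comp_polyD comp_polyM even.
by rewrite size_comp_poly2 ?size_NX // ltn_modp monic_neq0.
Qed.

(** [- zeta^*] is annihilated by [p] exactly when [zeta] is annihilated by
    [p(- 'X)], so the latter is divisible by [p]; they have the same degree, and
    the same leading coefficient when that degree is even. *)
Lemma minpoly_even (U : vectType k) (zeta : 'End(U)) p :
  is_minpoly zeta p -> ~~ odd (size p).-1 ->
  endo_iso zeta (- transpose zeta) -> even_polynomial p.
Proof.
move=> pmin even iso; have [mon minp] := pmin.
have [_ minp'] := endo_iso_minpoly iso pmin.
have dvd : p %| p \Po - 'X.
  apply/minp/transpose_horner_eq0; rewrite -endo_hornerNX.
  by apply/minp'.
have mon' : p \Po - 'X \is monic.
  by rewrite monicE lead_coef_comp_NX -signr_odd (negPf even) mul1r -monicE.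
apply/eqP; rewrite /even_polynomial eq_sym -eqp_monic // -dvdp_size_eqp //.
by rewrite size_comp_poly2 // size_NX.
Qed.

(** The form sends [u] and [v] to the coefficient of degree [n - 1] in
    [u('X) * v(- 'X)] modulo [p]. It is skew because ['X |-> - 'X] is an
    involution of the quotient that changes the sign of this coefficient, [n - 1]
    being odd. It is nondegenerate because a power of ['X] brings the leading
    coefficient of [u] to degree [n - 1]. *)
Lemma companion_skew_pairing p : p \is monic -> even_polynomial p ->
  ~~ odd (size p).-1 -> exists form, skew_pairing (companion p) form.
Proof.
move=> mon even_p even_n; set n := (size p).-1 in even_n *.
pose form (u v : {poly_n k}) : k := (((u : {poly k}) * ((v : {poly k}) \Po - 'X)) %% p)`_n.-1.
exists form; rewrite /form; split.
- move=> u a v w /=.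
  rewrite -[comp_poly _ (_ + _)]/((a *: (v : {poly k}) + w) \Po - 'X).
  by rewrite comp_polyD comp_polyZ mulrDr -scalerAr modpD modpZl coefD coefZ.
- move=> u v; have [n0|n0] := posnP n.
    have z (x : {poly_n k}) : x = 0 :> {poly k}.
      by apply/eqP; rewrite -size_poly_leq0 (leq_trans (size_npoly x)) ?n0.
    by rewrite (z u) (z v) comp_poly0 mulr0 mod0p coef0 oppr0.
  rewrite -[in LHS](comp_polyNXK ((u : {poly k}) * _)) -(mod_comp_NX _ mon even_p).
  rewrite coef_comp_NX comp_polyM comp_polyNXK mulrC -signr_odd.
  by rewrite -[odd n.-1]negbK -oddS prednK // even_n mulrN1 [in LHS]mulrC.
- move=> u nondeg; apply: npoly_inj; apply/eqP; apply: contraT => u0.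
  have su := size_npoly u; pose d := (size (u : {poly k})).-1.
  have sd : size (u : {poly k}) = d.+1 by rewrite prednK // size_poly_gt0.
  have szv : (size ('X^(n.-1 - d) : {poly k}) <= n)%N.
    by rewrite size_polyXn; move: su; rewrite sd; lia.
  have := nondeg (npolyp n 'X^(n.-1 - d)); rewrite npolypK //.
  have -> : ('X^(n.-1 - d) \Po - 'X : {poly k}) = (-1) ^+ (n.-1 - d) *: 'X^(n.-1 - d).
    apply/polyP => i; rewrite coef_comp_NX coefZ coefXn.
    by case: eqP => [->|_]; rewrite ?mulr0.
  rewrite -scalerAr modpZl coefZ modp_small; last first.
    rewrite (size_monic mon) -/n ltnS (leq_trans (size_polyMleq _ _)) //.
    by rewrite size_polyXn; move: su; rewrite sd; lia.
  rewrite coefMXn; move: su; rewrite sd => su.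
  have -> : (n.-1 < n.-1 - d)%N = false by lia.
  have -> : (n.-1 - (n.-1 - d))%N = d by lia.
  move=> /eqP; rewrite mulf_eq0 signr_eq0 /= -/(lead_coef _).
  by rewrite lead_coef_eq0 (negPf u0).
move=> u v; rewrite !companionE //.
rewrite (mod_comp_NX _ mon even_p) comp_polyM comp_polyX.
rewrite modp_mul; move: (polyn u) (polyn v \Po - 'X) => a b.
have -> : a * (b * - 'X) = - (b * (a * 'X)) by ring.
by rewrite modpN coefN opprK mulrC modp_mul.
Qed.

Lemma coef_even_polynomial r i : even_polynomial r -> odd i -> r`_i = 0.
Proof.
move=> even oddi; have := coef_comp_NX r i.
rewrite even -signr_odd oddi mulN1r => /eqP.
rewrite -subr_eq0 opprK -mulr2n -mulr_natl mulf_eq0 (negPf two).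
by move/eqP.
Qed.

Lemma even_polynomialP r :
  even_polynomial r <-> exists p, r = p \Po 'X^2.
Proof.
split=> [even|[p ->]].
  exists (even_poly r); apply/polyP => i; rewrite coef_comp_poly_Xn //.
  rewrite dvdn2; case: (boolP (odd i)) => [oddi|eveni] /=.
    exact: coef_even_polynomial.
  by rewrite coef_even_poly divn2 even_halfK.
rewrite /even_polynomial -comp_polyA; congr (p \Po _).
by rewrite comp_Xn_poly sqrrN.
Qed.

Lemma even_polynomial_size r : r != 0 -> even_polynomial r -> ~~ odd (size r).-1.
Proof.
move=> r0 even; apply: contra r0 => oddn.
by rewrite -lead_coef_eq0 /lead_coef (coef_even_polynomial even).
Qed.

(** If [r ^+ m] is even then [r(- 'X)] is associated to [r]. Either it equals
    [r], which is then even, or it equals [- r]; in that case ['X] divides [r], so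
    [r = 'X], and [m] is even for reasons of degree. *)
Lemma primary_even_parameter r m : irreducible_poly r -> r \is monic ->
  (0 < m)%N -> even_polynomial (r ^+ m) -> parameter_poly (r ^+ m).
Proof.
move=> irr mon m0 even.
have evenE : (r \Po - 'X) ^+ m = r ^+ m by rewrite -[RHS]even rmorphXn.
have r0 := monic_neq0 mon.
have dvd : r %| r \Po - 'X.
  apply: contraT; rewrite -irreducible_poly_coprime // => cop.
  have := coprimep_expr m cop; rewrite evenE coprimep_pexpr // coprimepp.
  by move=> /eqP sz; have := irr.1; rewrite sz.
have : r %= r \Po - 'X by rewrite -dvdp_size_eqp // size_comp_poly2 // size_NX.
have [odd_r|even_r] := boolP (odd (size r).-1); last first.
  left; exists m, r; split=> //; apply/even_polynomialP; apply/eqP.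
  rewrite /even_polynomial eq_sym -eqp_monic //.
  by rewrite monicE lead_coef_comp_NX -signr_odd (negPf even_r) mul1r -monicE.
move=> eqp_r; right.
have defr : r \Po - 'X = - r.
  apply: oppr_inj; rewrite opprK; apply/eqP; rewrite eq_sym -eqp_monic //.
    by rewrite -scaleN1r (eqp_trans eqp_r) // eqp_sym eqp_scale // oppr_eq0 oner_eq0.
  by rewrite monicE lead_coefN lead_coef_comp_NX -signr_odd odd_r mulN1r opprK -monicE.
have rX : 'X %| r.
  rewrite -['X]subr0 dvdp_XsubCl /root horner_coef0.
  have := coef_comp_NX r 0; rewrite defr coefN mul1r => /eqP.
  by rewrite eq_sym -subr_eq0 opprK -mulr2n -mulr_natl mulf_eq0 (negPf two).
have defX : r = 'X.
  have : 'X %= r by apply: irr.2 => //; rewrite size_polyX.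
  by rewrite eqp_monic ?monicX // => /eqP.
have even_m : ~~ odd m.
  have := even_polynomial_size (monic_neq0 (monic_exp m mon)) even.
  by rewrite defX size_polyXn.
exists m./2; split; first by case: m m0 even_m {evenE even} => [|[]].
by rewrite defX -exprM mul2n even_halfK.
Qed.

Lemma parameter_poly_primary p : parameter_poly p ->
  even_polynomial p /\
  exists r m, [/\ irreducible_poly r, r \is monic, (0 < m)%N & p = r ^+ m].
Proof.
move=> [[m [r [m0 mon irr even ->]]]|[m [m0 ->]]].
  split; last by exists r, m.
  by rewrite /even_polynomial rmorphXn /=; move/even_polynomialP: even => ->.
split; first by rewrite /even_polynomial !rmorphXn /= comp_polyX sqrrN.
exists 'X, (2 * m)%N; split; rewrite ?monicX ?muln_gt0 ?exprM //.
by rewrite -['X]subr0; apply: irredp_XsubC.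
Qed.

(** Skew-symmetry is a gain over the definition of admissibility, where the
    isomorphism from [zeta] to [- zeta^*] may have any symmetry. The cyclic model
    has a skew one. *)
Lemma admissible_skew_pairing (U : vectType k) (zeta : 'End(U)) :
  admissible zeta -> exists form, skew_pairing zeta form.
Proof.
move=> [indec even iso].
have [r [m [irr mon m0 pmin ciso]]] := indecomposable_companion indec.
have [f [bf _]] := ciso; have := lfun_bijective_dim bf; rewrite dim_polyn => dimU.
have even_n : ~~ odd (size (r ^+ m)).-1 by rewrite dimU.
have even_p := minpoly_even pmin even_n iso.
have [form formP] := companion_skew_pairing (monic_exp m mon) even_p even_n.
exact: skew_pairing_transport ciso formP.
Qed.

Lemma admissible_parameter (U : vectType k) (zeta : 'End(U)) :
  admissible zeta -> exists p, is_minpoly zeta p /\ parameter_poly p.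
Proof.
move=> [indec even iso].
have [r [m [irr mon m0 pmin ciso]]] := indecomposable_companion indec.
have [f [bf _]] := ciso; have := lfun_bijective_dim bf; rewrite dim_polyn => dimU.
exists (r ^+ m); split=> //; apply: primary_even_parameter => //.
by apply: minpoly_even pmin _ iso; rewrite dimU.
Qed.

Lemma parameter_admissible p : parameter_poly p ->
  exists (U : vectType k) (zeta : 'End(U)), admissible zeta /\ is_minpoly zeta p.
Proof.
move=> /parameter_poly_primary[even [r [m [irr mon m0 def]]]].
have monp : p \is monic by rewrite def monic_exp.
have even_n := even_polynomial_size (monic_neq0 monp) even.
exists {poly_(size p).-1 k}, (companion p); split; last exact: companion_minpoly.
have [form /skew_pairing_iso iso] := companion_skew_pairing monp even even_n.
split=> //; last by rewrite dim_polyn.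
exact: companion_indecomposable irr m0 def.
Qed.

Lemma indecomposable_iso_minpoly (U U' : vectType k) (zeta : 'End(U))
    (zeta' : 'End(U')) p p' :
  endo_indecomposable zeta -> endo_indecomposable zeta' ->
  is_minpoly zeta p -> is_minpoly zeta' p' -> (endo_iso zeta zeta' <-> p = p').
Proof.
move=> indec indec' pmin pmin'; split=> [iso|eqp].
  exact: is_minpoly_unique (endo_iso_minpoly iso pmin) pmin'.
have [r [m [_ _ _ qmin iso]]] := indecomposable_companion indec.
have [r' [m' [_ _ _ qmin' iso']]] := indecomposable_companion indec'.
apply: endo_iso_trans (endo_iso_sym iso) _.
rewrite (is_minpoly_unique qmin pmin) eqp (is_minpoly_unique pmin' qmin').
exact: iso'.
Qed.

End EvenPolynomials.

(** * The sextuple of an endomorphism *)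

Lemma bijective_injective (k : fieldType) (U V : vectType k) (f : 'Hom(U, V)) :
  bijective f -> injective f /\ forall v, exists u, v = f u.
Proof. by move=> [g fK gK]; split=> [|v]; [apply: can_inj fK | exists (g v)]. Qed.

Section SextupleTransport.
Variables (k : fieldType) (V V' : vectType k).

Lemma sextuple_isoP (S : sextuple V) (S' : sextuple V') (f : 'Hom(V, V')) :
  bijective f ->
  (forall i v, (f v \in sextI S' i) = (v \in sextI S i)) ->
  (forall i v, (f v \in sextC S' i) = (v \in sextC S i)) ->
  sextuple_iso S S'.
Proof.
move=> bf fI fC; have [_ surj] := bijective_injective bf.
exists f; split=> // i; split; apply/vspaceP => v; apply/memv_imgP/idP.
- by case=> u uI ->; rewrite fI.
- by have [u ->] := surj v; rewrite fI => uI; exists u.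
- by case=> u uC ->; rewrite fC.
- by have [u ->] := surj v; rewrite fC => uC; exists u.
Qed.

Lemma sextuple_iso_mem (S : sextuple V) (S' : sextuple V') (f : 'Hom(V, V')) :
  bijective f ->
  (forall i, (f @: sextI S i)%VS = sextI S' i /\ (f @: sextC S i)%VS = sextC S' i) ->
  (forall i v, (f v \in sextI S' i) = (v \in sextI S i)) /\
  (forall i v, (f v \in sextC S' i) = (v \in sextC S i)).
Proof.
move=> bf fS; have [inj _] := bijective_injective bf.
have imgE W v : (f v \in (f @: W)%VS) = (v \in W).
  by apply/memv_imgP/idP => [[u uW /inj->]//|vW]; exists v.
by split=> i v; have [eI eC] := fS i; rewrite -?eI -?eC imgE.
Qed.

End SextupleTransport.

Section SextupleIso.
Variables (k : fieldType) (V V' : vectType k).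

Lemma sextuple_iso_sym (S : sextuple V) (S' : sextuple V') :
  sextuple_iso S S' -> sextuple_iso S' S.
Proof.
move=> [f [bf fS]]; have [fI fC] := sextuple_iso_mem bf fS.
have [g [fK gK]] := lfun_bijective_inverse bf.
apply: (sextuple_isoP (f := g)) => [|i v|i v]; first by exists f.
  by rewrite -fI gK.
by rewrite -fC gK.
Qed.

Lemma sextuple_iso_indecomposable (S : sextuple V) (S' : sextuple V') :
  sextuple_iso S S' -> sextuple_indecomposable S -> sextuple_indecomposable S'.
Proof.
move=> [f [bf fS]] indec; have [fI fC] := sextuple_iso_mem bf fS.
have [g [fK gK]] := lfun_bijective_inverse bf.
apply: indecomposable_sextupleI.
  by rewrite -dimv_eq0 -(lfun_bijective_dim bf) dimv_eq0; case: indec.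
move=> p pp pS'; have ppE u : p (p u) = p u by rewrite -comp_lfunE pp.
have [||p0|p1] := @indecomposable_sextuple_idempotent _ _ S (g \o p \o f)%VF indec.
- by apply/lfunP => u; rewrite !comp_lfunE gK ppE.
- move=> i; have [pI pC] := pS' i.
  split; apply/subvP => _ /memv_imgP[v vW ->]; rewrite !comp_lfunE.
    by rewrite -fI gK (subvP pI) // memv_img // fI.
  by rewrite -fC gK (subvP pC) // memv_img // fC.
- left; apply/lfunP => u; move/lfunP: p0 => /(_ (g u)).
  by rewrite !comp_lfunE gK !zero_lfunE => /(congr1 f); rewrite gK linear0.
right; apply/lfunP => u; move/lfunP: p1 => /(_ (g u)).
by rewrite !comp_lfunE gK !id_lfunE => /(congr1 f); rewrite !gK.
Qed.

End SextupleIso.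

Section EndoSextuple.
Variables (k : fieldType) (U : vectType k) (eta : 'End(U)).
Local Notation S := (endo_sextuple eta).
Implicit Types x y z : U.

Lemma mem_endoI0 x y z : ((x, y, z) \in sextI S i0) = (y == 0) && (z == 0).
Proof.
apply/memv_imgP/andP => [[u _]|[/eqP-> /eqP->]].
  by rewrite lfunE => -[_ -> ->]; rewrite !eqxx.
by exists x; rewrite ?memvf // lfunE.
Qed.

Lemma mem_endoI1 x y z : ((x, y, z) \in sextI S i1) = (x == 0) && (y == 0).
Proof.
apply/memv_imgP/andP => [[u _]|[/eqP-> /eqP->]].
  by rewrite lfunE => -[-> -> _]; rewrite !eqxx.
by exists z; rewrite ?memvf // lfunE.
Qed.

Lemma mem_endoI2 x y z :
  ((x, y, z) \in sextI S i2) = (x == - eta y) && (z == - y).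
Proof.
apply/memv_imgP/andP => [[u _]|[/eqP-> /eqP->]].
  by rewrite lfunE => -[-> -> ->]; rewrite !eqxx.
by exists y; rewrite ?memvf // lfunE.
Qed.

Lemma mem_endoC0 x y z : ((x, y, z) \in sextC S i0) = (z == 0).
Proof.
apply/memv_imgP/eqP => [[u _]|->].
  by rewrite lfunE => -[_ _ ->].
by exists (x, y); rewrite ?memvf // lfunE.
Qed.

Lemma mem_endoC1 x y z : ((x, y, z) \in sextC S i1) = (x == 0).
Proof.
apply/memv_imgP/eqP => [[u _]|->].
  by rewrite lfunE => -[-> _ _].
by exists (y, z); rewrite ?memvf // lfunE.
Qed.

Lemma mem_endoC2 x y z : ((x, y, z) \in sextC S i2) = (x + y + z == eta z).
Proof.
apply/memv_addP/eqP => [[_ /memv_imgP[a _ ->] [_ /memv_imgP[b _ ->]]]|def].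
  rewrite !lfunE /= => -[-> -> ->]; rewrite add0r lfunN.
  by rewrite addrACA subrr add0r addrK.
exists (- (y + z), y + z, 0).
  by apply/memv_imgP; exists (- (y + z)); rewrite ?memvf // lfunE /= /mapD3 opprK.
exists (eta z, - z, z).
  by apply/memv_imgP; exists (- z); rewrite ?memvf // lfunE /= /mapI3 lfunN !opprK.
congr (_, _, _); rewrite /= ?add0r ?addrK //.
by rewrite -def -(addrA x) [x + _]addrC addKr.
Qed.

Definition mem_endo :=
  (mem_endoI0, mem_endoI1, mem_endoI2, mem_endoC0, mem_endoC1, mem_endoC2).

End EndoSextuple.

Lemma sub_imgP (k : fieldType) (V V' : vectType k) (f : 'Hom(V, V')) W W' :
  (f @: W <= W')%VS -> forall v, v \in W -> f v \in W'.
Proof. by move=> sub v vW; apply: (subvP sub); apply: memv_img. Qed.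

Section EndoSextupleHom.
Variables (k : fieldType) (U U' : vectType k) (eta : 'End(U)) (eta' : 'End(U')).

Fact diagonal_linear (a : 'Hom(U, U')) :
  linear (fun v : U * U * U => (a v.1.1, a v.1.2, a v.2)).
Proof. by move=> c u v; rewrite /= !linearP. Qed.

Definition diagonal_map (a : 'Hom(U, U')) : {linear (U * U * U)%type -> (U' * U' * U')%type} :=
  HB.pack (fun v : U * U * U => (a v.1.1, a v.1.2, a v.2))
    (GRing.isLinear.Build k _ _ _ _ (diagonal_linear a)).

Definition diagonal (a : 'Hom(U, U')) : 'Hom((U * U * U)%type, (U' * U' * U')%type) :=
  linfun (diagonal_map a).

Lemma diagonalE a x y z : diagonal a (x, y, z) = (a x, a y, a z).
Proof. by rewrite lfunE. Qed.

Lemma diagonal_hom a : (a \o eta = eta' \o a)%VF ->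
  sextuple_hom (endo_sextuple eta) (endo_sextuple eta') (diagonal a).
Proof.
move=> ae; have aeE u : a (eta u) = eta' (a u) by rewrite -!comp_lfunE ae.
apply: ord3P; split; apply/subvP => _ /memv_imgP[[[x y] z] + ->];
  rewrite diagonalE !mem_endo.
- by move=> /andP[/eqP-> /eqP->]; rewrite linear0 eqxx.
- by move=> /eqP->; rewrite linear0.
- by move=> /andP[/eqP-> /eqP->]; rewrite linear0 eqxx.
- by move=> /eqP->; rewrite linear0.
- by move=> /andP[/eqP-> /eqP->]; rewrite !lfunN aeE !eqxx.
by move=> /eqP e; rewrite -aeE -e !lfunD.
Qed.

(** The three coordinate subspaces of [U * U * U] are [I i0], [C i0 :&: C i1] and
    [I i1], so a homomorphism preserves the coordinates. Vectors [(x, - x, 0)] of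
    [C i2] force the first two components to agree, and [I i2] compares the last
    two and gives the commutation with [eta]. *)
Lemma endo_sextuple_hom_diagonal f :
  sextuple_hom (endo_sextuple eta) (endo_sextuple eta') f ->
  exists2 a : 'Hom(U, U'), (a \o eta = eta' \o a)%VF & f = diagonal a.
Proof.
move=> hom.
have fI i := sub_imgP (hom i).1; have fC i := sub_imgP (hom i).2.
pose proj (v : U' * U' * U') := v.1.2.
have projlin : linear proj by [].
pose projL : {linear (U' * U' * U')%type -> U'} :=
  HB.pack proj (GRing.isLinear.Build k _ _ _ proj projlin).
pose mid (y : U) : U * U * U := (0, y, 0).
have midlin : linear mid.
  by move=> c u v; congr (_, _, _); rewrite /= ?scaler0 ?addr0.
pose midL : {linear U -> (U * U * U)%type} :=
  HB.pack mid (GRing.isLinear.Build k _ _ _ mid midlin).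
pose a : 'Hom(U, U') := (linfun projL \o f \o linfun midL)%VF.
have fmid y : f (0, y, 0) = (0, a y, 0).
  have : f (0, y, 0) \in sextC (endo_sextuple eta') i0 by apply: fC; rewrite (mem_endo eta).
  have : f (0, y, 0) \in sextC (endo_sextuple eta') i1 by apply: fC; rewrite (mem_endo eta).
  rewrite !comp_lfunE !lfunE /= /proj /mid.
  by case: (f (0, y, 0)) => [[x' y'] z'] /=; rewrite !(mem_endo eta') => /eqP-> /eqP->.
clearbody a.
have ffirst x : f (x, 0, 0) = (a x, 0, 0).
  have : f (x, 0, 0) \in sextI (endo_sextuple eta') i0.
    by apply: fI; rewrite (mem_endo eta) !eqxx.
  have : f (x, - x, 0) \in sextC (endo_sextuple eta') i2.
    by apply: fC; rewrite (mem_endo eta) subrr addr0 linear0.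
  have -> : (x, - x, 0) = (x, 0, 0) - (0, x, 0) :> U * U * U.
    by congr (_, _, _); rewrite /= ?subr0 ?sub0r.
  rewrite lfunB fmid; case: (f (x, 0, 0)) => [[x' y'] z'].
  rewrite [X in X \in _](_ : _ = (x', y' - a x, z') :> U' * U' * U'); last first.
    by congr (_, _, _); rewrite /= subr0.
  rewrite !(mem_endo eta') => e /andP[/eqP y0 /eqP z0]; move: e.
  by rewrite y0 z0 linear0 sub0r addr0 subr_eq0 => /eqP->.
have third y : f (- eta y, y, - y) = (- a (eta y), a y, 0) + f (0, 0, - y).
  have -> : (- eta y, y, - y) = (- eta y, 0, 0) + (0, y, 0) + (0, 0, - y) :> U * U * U.
    by congr (_, _, _); rewrite /= ?addr0 ?add0r.
  rewrite !lfunD fmid ffirst lfunN; congr (_ + _).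
  by congr (_, _, _); rewrite /= ?addr0 ?add0r.
have flast_ae y : f (0, 0, - y) = (0, 0, - a y) /\ a (eta y) = eta' (a y).
  have : f (0, 0, - y) \in sextI (endo_sextuple eta') i1.
    by apply: fI; rewrite (mem_endo eta) !eqxx.
  have : f (- eta y, y, - y) \in sextI (endo_sextuple eta') i2.
    by apply: fI; rewrite (mem_endo eta) !eqxx.
  rewrite third; case: (f (0, 0, - y)) => [[x' y'] z'] + h.
  move: h; rewrite (mem_endo eta') => /andP[/eqP-> /eqP->].
  rewrite [X in X \in _](_ : _ = (- a (eta y), a y, z') :> U' * U' * U'); last first.
    by congr (_, _, _); rewrite /= ?addr0 ?add0r.
  by rewrite (mem_endo eta') => /andP[/eqP/oppr_inj-> /eqP->].
exists a; first by apply/lfunP => y; rewrite !comp_lfunE (flast_ae y).2.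
apply/lfunP => -[[x y] z]; rewrite diagonalE.
have -> : (x, y, z) = (x, 0, 0) + (0, y, 0) + (0, 0, - - z) :> U * U * U.
  by congr (_, _, _); rewrite /= ?addr0 ?add0r ?opprK.
rewrite !lfunD ffirst fmid (flast_ae (- z)).1.
by congr (_, _, _); rewrite /= ?addr0 ?add0r // lfunN opprK.
Qed.

Lemma endo_sextuple_iso :
  sextuple_iso (endo_sextuple eta) (endo_sextuple eta') <-> endo_iso eta eta'.
Proof.
split=> [[f [bf fS]]|[a [ba ae]]]; last first.
  have [b [aK bK]] := lfun_bijective_inverse ba.
  have aI := can_inj aK; have a0 u : (a u == 0) = (u == 0).
    by rewrite -(inj_eq aI) linear0.
  have aeE u : a (eta u) = eta' (a u) by rewrite -!comp_lfunE ae.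
  apply: (@sextuple_isoP _ _ _ _ _ (diagonal a)).
  - exists (fun v => (b v.1.1, b v.1.2, b v.2)) => -[[x y] z].
      by rewrite diagonalE /= !aK.
    by rewrite diagonalE /= !bK.
  - apply: ord3P => -[[x y] z]; rewrite diagonalE !mem_endo ?a0 //.
    by rewrite -aeE -!lfunN !(inj_eq aI).
  apply: ord3P => -[[x y] z]; rewrite diagonalE !mem_endo ?a0 //.
  by rewrite -aeE -!lfunD (inj_eq aI).
have [inj surj] := bijective_injective bf.
have [|a ae def] := @endo_sextuple_hom_diagonal f.
  by move=> i; have [-> ->] := fS i; rewrite !subvv.
exists a; split=> //; apply: lfun_injective_bijective.
  move=> u u' eqa; have := @inj (u, 0, 0) (u', 0, 0).
  by rewrite def !diagonalE eqa => /(_ erefl) [].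
rewrite -(@limg_dim_eq _ _ _ a fullv).
  apply/dimvS/subvP => u' _; have [[[x y] z]] := surj (u', 0, 0).
  by rewrite def diagonalE => -[-> _ _]; rewrite memv_img ?memvf.
apply/eqP; rewrite -subv0; apply/subvP => u /memv_capP[_].
rewrite memv_ker memv0 => /eqP au; have := @inj (u, 0, 0) 0.
by rewrite def diagonalE au !linear0 => /(_ erefl) [->].
Qed.

End EndoSextupleHom.

Section EndoSextupleIndecomposable.
Variables (k : fieldType) (U : vectType k) (eta : 'End(U)).

Lemma dim_triple : \dim {: (U * U * U)%type} = (3 * \dim {:U})%N.
Proof.
rewrite !dimvf -[dim (U * U * U)%type]/(dim U + dim U + dim U)%N.
by rewrite !mulSn mul0n addn0 addnA.
Qed.

Lemma endo_sextuple_indecomposable :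
  sextuple_indecomposable (endo_sextuple eta) <-> endo_indecomposable eta.
Proof.
split=> indec.
  apply: indecomposable_endoI.
    by have [+ _] := indec; rewrite -!dimv_eq0 dim_triple muln_eq0.
  move=> p pp pe.
  have [||d0|d1] := @indecomposable_sextuple_idempotent _ _ _ (diagonal p) indec.
  - apply/lfunP => -[[x y] z]; rewrite comp_lfunE !diagonalE.
    by rewrite -!comp_lfunE pp.
  - exact: diagonal_hom.
  - left; apply/lfunP => u; move/lfunP: d0 => /(_ (u, 0, 0)).
    by rewrite diagonalE !zero_lfunE => -[].
  right; apply/lfunP => u; move/lfunP: d1 => /(_ (u, 0, 0)).
  by rewrite diagonalE !id_lfunE => -[].
apply: indecomposable_sextupleI.
  by have [+ _] := indec; rewrite -!dimv_eq0 dim_triple muln_eq0.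
move=> p pp /endo_sextuple_hom_diagonal[a ae def].
have [|a0|a1] := indecomposable_endo_idempotent indec _ ae.
- apply/lfunP => u; move/lfunP: pp => /(_ (u, 0, 0)).
  by rewrite def !comp_lfunE !diagonalE => -[].
- by left; rewrite def a0; apply/lfunP => -[[x y] z]; rewrite diagonalE !zero_lfunE.
by right; rewrite def a1; apply/lfunP => -[[x y] z]; rewrite diagonalE !id_lfunE.
Qed.

End EndoSextupleIndecomposable.

(** * From skew pairings to isotropic triples *)

Section SkewForms.
Variables (k : fieldType) (V : vectType k).

Section Scalar.
Variable B : V -> V -> k.
Hypotheses (lin : forall u, scalar (B u)) (skew : forall u v, B u v = - B v u).

Lemma scalarD u v w : B u (v + w) = B u v + B u w.
Proof. by have := lin u 1 v w; rewrite scale1r mul1r. Qed.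

Lemma scalar0 u : B u 0 = 0.
Proof. by have := scalarD u 0 0; rewrite addr0 => /eqP; rewrite -subr_eq0 opprD addNKr oppr_eq0 => /eqP. Qed.

Lemma scalarZ u a v : B u (a *: v) = a * B u v.
Proof. by have := lin u a v 0; rewrite scalar0 !addr0. Qed.

Lemma scalarN u v : B u (- v) = - B u v.
Proof. by rewrite -scaleN1r scalarZ mulN1r. Qed.

Lemma scalarDl u v w : B (u + v) w = B u w + B v w.
Proof. by rewrite skew scalarD opprD -!(skew _ w). Qed.

Lemma scalar0l u : B 0 u = 0.
Proof. by rewrite skew scalar0 oppr0. Qed.

Lemma scalarZl a u v : B (a *: u) v = a * B u v.
Proof. by rewrite skew scalarZ -mulrN -skew. Qed.

Lemma scalarNl u v : B (- u) v = - B u v.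
Proof. by rewrite skew scalarN -skew. Qed.

Lemma skew_form_of : exists form : {skew_symmetric V}, forall u v, form u v = B u v.
Proof.
have z1 u' : zmod_morphism (B ^~ u').
  by move=> u v; rewrite scalarDl scalarNl.
have z2 u : zmod_morphism (B u) by move=> v w; rewrite scalarD scalarN.
have s1 u' : scalable_for *%R (B ^~ u') by move=> a u; rewrite scalarZl.
have s2 u : scalable_for (idfun \; *%R) (B u) by move=> a v; rewrite scalarZ.
have herm u v : B u v = (-1) ^+ true * idfun (B v u).
  by rewrite expr1 mulN1r /= -skew.
pose form : {skew_symmetric V} := HB.pack B
  (isBilinear.Build k V V k _ _ B z1 z2 s1 s2)
  (isHermitianSesquilinear.Build k V true idfun B herm).
by exists form.
Qed.

End Scalar.

Variable form : {skew_symmetric V}.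

Lemma skew_form_scalar u : scalar (form u).
Proof. by move=> a v w; rewrite linearPr. Qed.

Lemma skew_form_skew u v : form u v = - form v u.
Proof. by rewrite hermC expr1 mulN1r. Qed.

End SkewForms.

Section TripleDecomposition.
Variables (k : fieldType) (V : vectType k) (T : isotropic_triple V).
Local Notation w := (triple_form T).

Lemma splits_mem (U' U'' W : {vspace V}) :
  (forall v, v \in W -> exists v' v'', [/\ v = v' + v'', v' \in (W :&: U')%VS
     & v'' \in (W :&: U'')%VS]) -> splits U' U'' W.
Proof.
move=> dec; apply/eqP; rewrite eqEsubv subv_add !capvSl !andbT.
by apply/subvP => v /dec[v' [v'' [-> v'W v''W]]]; apply: memv_add.
Qed.

(** An orthogonal splitting of the [I i] also splits their orthogonal
    complements. *)
Lemma indecomposable_sextuple_triple :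
  sextuple_indecomposable (underlying_sextuple T) -> triple_nonsplit T.
Proof.
move=> indec; split=> //; have [V0 nodec] := indec; split=> //.
move=> [U' [U'' [dec orth splI]]]; case: nodec; exists U', U''.
split=> // i; split; first exact: splI.
have [_ _ full _] := dec.
have orth12 u u' : u \in U' -> u' \in U'' -> w u u' = 0.
  by move=> uU u'U; apply: (orthovP orth).
have orth21 u u' : u \in U'' -> u' \in U' -> w u u' = 0.
  by move=> uU u'U; rewrite skew_form_skew orth12 ?oppr0.
apply: splits_mem => v vC; have vf : v \in (U' + U'')%VS by rewrite full memvf.
have [v' v'U [v'' v''U def]] := memv_addP vf.
have key z : z \in tripleI T i -> w v z = 0.
  by move=> zI; move/mem_orthovP: vC; apply.
have zdec z : z \in tripleI T i -> exists z' z'', [/\ z = z' + z'',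
    z' \in tripleI T i, z'' \in tripleI T i, z' \in U' & z'' \in U''].
  rewrite {1}(splI i) => /memv_addP[z' /memv_capP[z'I z'U]].
  by move=> [z'' /memv_capP[z''I z''U] ->]; exists z', z''.
exists v', v''; split=> //; rewrite memv_cap ?v'U ?v''U andbT.
  apply/mem_orthovP => _ /zdec[z' [z'' [-> z'I z''I z'U z''U]]].
  rewrite (scalarD (skew_form_scalar w)) (orth12 v' z'') // addr0.
  have := key _ z'I.
  by rewrite def (scalarDl (skew_form_scalar w) (skew_form_skew w)) (orth21 v'' z') // addr0.
apply/mem_orthovP => _ /zdec[z' [z'' [-> z'I z''I z'U z''U]]].
rewrite (scalarD (skew_form_scalar w)) (orth21 v'' z') // add0r.
have := key _ z''I.
by rewrite def (scalarDl (skew_form_scalar w) (skew_form_skew w)) (orth12 v' z'') // add0r.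
Qed.

End TripleDecomposition.

Section TripleOfPairing.
Variables (k : fieldType) (two : (2 : k) != 0) (U : vectType k).
Variables (zeta : 'End(U)) (q : U -> U -> k).
Hypothesis pairing : skew_pairing zeta q.
Let eta : 'End(U) := 2^-1 *: \1%VF + zeta.
Local Notation V := (U * U * U)%type.

Let lin : forall u, scalar (q u). Proof. by case: pairing. Qed.
Let skew u v : q u v = - q v u. Proof. by case: pairing. Qed.
Let nondeg u : (forall v, q u v = 0) -> u = 0.
Proof. by have [_ _ + _] := pairing; apply. Qed.

(** Skew-invariance of [zeta], shifted by one half: it makes the third [C] the
    orthogonal of the third [I]. *)
Lemma pairing_half u v : q (eta u) v + q u (eta v) = q u v.
Proof.
have [_ _ _ inv] := pairing.
rewrite !add_lfunE !scale_lfunE !id_lfunE (scalarDl lin skew) (scalarD lin).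
rewrite (scalarZl lin skew) (scalarZ lin) inv.
rewrite addrACA [- _ + _]addrC subrr addr0 -mulrDr -mulr2n -[q u v *+ 2]mulr_natl.
by rewrite mulrA mulVf // mul1r.
Qed.

(** The form is determined by its restriction [q] to the middle coordinate. As
    [C i0] and [C i1] are the orthogonals of [I i0] and [I i1], the middle
    coordinate is orthogonal to the two others, which are isotropic, and
    [(x, - x, 0)] in [C i2] against [I i2] expresses the pairing of the outer
    coordinates by [q]. *)
Definition triple_pairing (u v : V) : k :=
  q u.1.2 v.1.2 - q u.1.1 v.2 + q v.1.1 u.2.

Lemma triple_pairing_scalar u : scalar (triple_pairing u).
Proof.
move=> a v w; rewrite /triple_pairing /= !(scalarD lin) !(scalarDl lin skew).
by rewrite !(scalarZ lin) !(scalarZl lin skew); ring.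
Qed.

Lemma triple_pairing_skew u v : triple_pairing u v = - triple_pairing v u.
Proof. by rewrite /triple_pairing [q u.1.2 _]skew; ring. Qed.

Lemma orth_endoI i v :
  reflect (forall x, x \in sextI (endo_sextuple eta) i -> triple_pairing v x = 0)
    (v \in sextC (endo_sextuple eta) i).
Proof.
have flip z : (forall x, q x z = 0) -> z = 0.
  by move=> z0; apply: nondeg => v'; rewrite skew z0 oppr0.
case: v => [[x y] z]; apply: (iffP idP); move: i; apply: ord3P.
- rewrite (mem_endo eta) => /eqP-> [[x' y'] z']; rewrite (mem_endo eta).
  move=> /andP[/eqP-> /eqP->].
  by rewrite /triple_pairing /= !(scalar0 lin) subr0 addr0.
- rewrite (mem_endo eta) => /eqP-> [[x' y'] z']; rewrite (mem_endo eta).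
  move=> /andP[/eqP-> /eqP->].
  by rewrite /triple_pairing /= !(scalar0 lin) !(scalar0l lin skew) subr0 addr0.
- rewrite (mem_endo eta) => /eqP e [[x' y'] z']; rewrite (mem_endo eta).
  move=> /andP[/eqP-> /eqP->]; rewrite /triple_pairing /=.
  have half := pairing_half y' z; rewrite -e !(scalarD lin) in half.
  rewrite (scalarN lin) (scalarNl lin skew) [q x y']skew [q y y']skew.
  transitivity (q y' z - (q (eta y') z + (q y' x + q y' y + q y' z))); first by ring.
  by rewrite half subrr.
- move=> orth; rewrite (mem_endo eta); apply/eqP/flip => x'.
  have := orth (x', 0, 0); rewrite (mem_endo eta) !eqxx => /(_ erefl).
  by rewrite /triple_pairing /= !(scalar0 lin) subr0 add0r.
- move=> orth; rewrite (mem_endo eta); apply/eqP/nondeg => z'.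
  have := orth (0, 0, z'); rewrite (mem_endo eta) !eqxx => /(_ erefl).
  rewrite /triple_pairing /= !(scalar0 lin) (scalar0l lin skew) addr0 sub0r.
  by move=> /eqP; rewrite oppr_eq0 => /eqP.
move=> orth; rewrite (mem_endo eta) -subr_eq0; apply/eqP/flip => y'.
have := orth (- eta y', y', - y'); rewrite (mem_endo eta) !eqxx => /(_ erefl).
rewrite /triple_pairing /= (scalarN lin) (scalarNl lin skew).
have half := pairing_half y' z; rewrite [q x y']skew [q y y']skew => e.
rewrite !(scalarD lin) (scalarN lin).
transitivity (- (- q y' y - - - q y' x + - q (eta y') z)
              + (q y' z - (q (eta y') z + q y' (eta z)))); first by ring.
by rewrite e half subrr oppr0 addr0.
Qed.

Lemma triple_of_pairing : endo_indecomposable eta ->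
  exists (V' : vectType k) (T : isotropic_triple V'),
    [/\ triple_nonsplit T, triple_continuous T
      & sextuple_iso (underlying_sextuple T) (endo_sextuple eta)].
Proof.
move=> indec.
have [form formE] := skew_form_of triple_pairing_scalar triple_pairing_skew.
have orthE i : orthov form (sextI (endo_sextuple eta) i) = sextC (endo_sextuple eta) i.
  apply/vspaceP => v; apply/mem_orthovP/orth_endoI => orth x xI.
    by rewrite -formE orth.
  by rewrite formE orth.
have sympl : is_psymplectic form.
  split=> // [|/pcharf0 char2]; last by move: two; rewrite -[2]/(2%:R) char2 eqxx.
  rewrite /nondegenerate -subv0; apply/subvP => v /mem_orthovP orth.
  have vC i : v \in sextC (endo_sextuple eta) i.
    by apply/orth_endoI => x _; rewrite -formE orth ?memvf.
  move: (vC i0) (vC i1); case: v orth {vC} => [[x y] z] orth; rewrite !(mem_endo eta).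
  move=> /eqP z0 /eqP x0; rewrite memv0; apply/eqP; congr (_, _, _) => //.
  apply: nondeg => y'; have := orth (0, y', 0) (memvf _); rewrite formE.
  by rewrite /triple_pairing /= (scalar0 lin) (scalar0l lin skew) subr0 addr0.
have iso i : (sextI (endo_sextuple eta) i
    <= orthov form (sextI (endo_sextuple eta) i))%VS.
  by rewrite orthE; apply: sext_sub.
pose T := @IsotropicTriple k _ form sympl (sextI (endo_sextuple eta)) iso.
have isoT : sextuple_iso (underlying_sextuple T) (endo_sextuple eta).
  apply: (sextuple_isoP (f := \1%VF)) => [|i v|i v].
  - by exists id => v; rewrite id_lfunE.
  - by rewrite id_lfunE.
  by rewrite id_lfunE /= orthE.
have indecT : sextuple_indecomposable (underlying_sextuple T).
  apply: (sextuple_iso_indecomposable (sextuple_iso_sym isoT)).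
  by apply/endo_sextuple_indecomposable.
exists _, T; split=> //; first exact: indecomposable_sextuple_triple.
split=> //; exists (\dim {:U}); have [U0 _] := indec.
have dim_inj (W : vectType k) (f : {linear W -> V}) : injective f ->
    \dim (limg (linfun f)) = \dim {:W}.
  move=> fI; apply: limg_dim_eq; apply/eqP; rewrite -subv0.
  apply/subvP => x /memv_capP[_]; rewrite memv_ker lfunE memv0 => /eqP fx0.
  by apply/eqP/fI; rewrite fx0 linear0.
have dimUU : \dim {: (U * U)%type} = (2 * \dim {:U})%N.
  by rewrite !dimvf -[dim (U * U)%type]/(dim U + dim U)%N mul2n addnn.
have dimI i : \dim (sextI (endo_sextuple eta) i) = \dim {:U}.
  move: i; apply: ord3P; apply: dim_inj => x x' //= [] //.
split; rewrite ?dim_triple //; first by rewrite lt0n dimv_eq0.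
move=> i; rewrite /= orthE; move: i; apply: ord3P.
- by rewrite -dimUU; apply: dim_inj => -[x y] [x' y'] /= [-> ->].
- by rewrite -dimUU; apply: dim_inj => -[x y] [x' y'] /= [-> ->].
rewrite /= /endC3 dimv_disjoint_sum.
  by rewrite !dim_inj ?mul2n ?addnn // => x x' /= [].
apply/eqP; rewrite -subv0; apply/subvP => v /memv_capP[/memv_imgP[x _ ->]].
move=> /memv_imgP[y _]; rewrite !lfunE /= => -[xE _ /eqP].
rewrite eq_sym oppr_eq0 => /eqP y0; rewrite memv0 xE y0 linear0 oppr0.
by apply/eqP; congr (_, _, _); rewrite /= oppr0.
Qed.

End TripleOfPairing.

(** * Triples in general position *)

Section NormalForm.
Variables (k : fieldType) (V : vectType k) (S : sextuple V) (n : nat).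
Local Notation C := (sextC S).
Local Notation I := (sextI S).
Hypotheses (dimV : \dim {:V} = (3 * n)%N)
  (dimC : forall i, \dim (C i) = (2 * n)%N) (dimI : forall i, \dim (I i) = n).
Hypothesis general : forall i j, i != j -> (I i :&: C j = 0)%VS.

Lemma general_full i j : i != j -> (I i + C j)%VS = fullv.
Proof.
move=> ij; apply/eqP; rewrite eqEdim subvf dimv_disjoint_sum ?general //.
by rewrite dimV dimC dimI; lia.
Qed.

(** The sextuple of a pair of maps [beta : X -> Y] and [gamma : Y -> X]; for
    [beta] and [gamma] bijective it is the sextuple of the inverse of their
    composite. *)
Definition arrow_form (X Y : vectType k) (beta : 'Hom(X, Y)) (gamma : 'Hom(Y, X))
    (f : 'Hom((X * Y * X)%type, V)) : Prop :=
  [/\ bijective f, \dim {:X} = n, \dim {:Y} = n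
    & forall x y z,
      ((f (x, y, z) \in I i0) = (y == 0) && (z == 0)) *
      ((f (x, y, z) \in I i1) = (x == 0) && (y == 0)) *
      ((f (x, y, z) \in I i2) = (y == - beta z) && (x == z)) *
      ((f (x, y, z) \in C i0) = (z == 0)) *
      ((f (x, y, z) \in C i1) = (x == 0)) *
      ((f (x, y, z) \in C i2) = (x + gamma y + gamma (beta z) == z))].

Lemma direct_projection (A B : {vspace V}) :
  (A :&: B = 0)%VS -> (A + B)%VS = fullv ->
  exists p : 'End(V), [/\ forall v, p v \in A, forall v, v - p v \in B,
    {in A, forall v, p v = v} & forall v, (p v == 0) = (v \in B)].
Proof.
move=> cap full; exists (daddv_pi A B).
have pB v : v - daddv_pi A B v \in B.
  have vf : v \in (A + B)%VS by rewrite full memvf.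
  by rewrite -{1}(daddv_pi_add cap vf) addrC addKr memv_pi.
split=> // v; [exact: memv_pi | exact: daddv_pi_id | ].
apply/eqP/idP => [p0|vB]; first by rewrite -[v]subr0 -p0.
apply/eqP; rewrite -memv0 -cap memv_cap memv_pi /=.
by rewrite -[daddv_pi A B v](subKr v) memvB.
Qed.

(** [X] is [I i2] and [Y] is [C i0 :&: C i1]. Since [V] is the direct sum of
    [I i0], [Y] and [I i1], a vector of [I i2] has three components; the two outer
    ones identify [I i0] and [I i1] with [X], and the middle one is, up to sign,
    [beta]. Projecting [Y] to [I i0] along [C i2] gives [gamma]. *)
Lemma arrow_form_exists : exists (X Y : vectType k) (beta : 'Hom(X, Y))
  (gamma : 'Hom(Y, X)) (f : 'Hom((X * Y * X)%type, V)), arrow_form beta gamma f.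
Proof.
pose M := (C i0 :&: C i1)%VS.
have IC i v : v \in I i -> v \in C i by apply: (subvP (sext_sub S i)).
have proj i j (ij : i != j) := direct_projection (general ij) (general_full ij).
have [p0 [p0I p0C p0id p00]] := proj i0 i1 isT.
have [p1 [p1I p1C p1id p10]] := proj i1 i0 isT.
have [r [rI rC rid r0]] := proj i0 i2 isT.
pose X := subvs_of (I i2); pose Y := subvs_of M.
have XI (x : X) : vsval x \in I i2 by apply: subvsP.
have YC (y : Y) : vsval y \in C i0 /\ vsval y \in C i1.
  by apply/memv_capP/subvsP.
have valX0 (x : X) j : i2 != j -> vsval x \in C j -> x = 0.
  move=> ij xC; apply: subvs_inj; apply/eqP; rewrite -memv0 -(general ij).
  by rewrite memv_cap XI.
pose a : 'Hom(X, V) := (p0 \o linfun (vsval : X -> V))%VF.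
have aE x : a x = p0 (vsval x) by rewrite comp_lfunE lfunE.
have a_ker : lker a == 0%VS.
  rewrite -subv0; apply/subvP => x; rewrite memv_ker aE p00 memv0 => xC.
  by apply/eqP/(valX0 _ i1).
have dimX : \dim {:X} = n by rewrite dimvf -(dimI i2).
have a_img : limg a = I i0.
  apply/eqP; rewrite eqEdim; apply/andP; split.
    by apply/subvP => _ /memv_imgP[x _ ->]; rewrite aE.
  by rewrite limg_dim_eq ?(eqP a_ker) ?capv0 // dimX dimI.
have aK := lker0_lfunK a_ker.
have aV u : u \in I i0 -> a ((a^-1)%VF u) = u.
  by rewrite -a_img => /limg_lfunVK.
clearbody a.
pose bt : 'Hom(X, Y) :=
  (linfun (vsproj M) \o ((p0 + p1 - \1) \o linfun (vsval : X -> V)))%VF.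
have midM v : v - p0 v - p1 v \in M.
  apply/memv_capP; split; last by apply: memvB => //; apply: IC.
  by rewrite addrAC; apply: memvB => //; apply: IC.
have btE z : vsval (bt z) = p0 (vsval z) + p1 (vsval z) - vsval z.
  rewrite comp_lfunE lfunE /= comp_lfunE lfunE /= vsprojK.
    by rewrite !add_lfunE opp_lfunE id_lfunE !lfunE.
  rewrite !add_lfunE opp_lfunE id_lfunE !lfunE /= -memvN.
  rewrite (_ : - _ = vsval z - p0 (vsval z) - p1 (vsval z)) //.
  by rewrite opprB opprD addrA.
clearbody bt.
pose gm : 'Hom(Y, X) := (a^-1 \o (r \o linfun (vsval : Y -> V)))%VF.
have gmE y : a (gm y) = r (vsval y) by rewrite !comp_lfunE lfunE /= aV.
clearbody gm.
pose g (v : X * Y * X) : V := p0 (vsval v.1.1) + vsval v.1.2 + p1 (vsval v.2).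
have glin : linear g.
  move=> c u v; rewrite /g /= !linearP /= !scalerDr.
  by rewrite [X in X + _ = _]addrACA [LHS]addrACA.
pose gL : {linear (X * Y * X)%type -> V} :=
  HB.pack g (GRing.isLinear.Build k _ V _ g glin).
pose f : 'Hom((X * Y * X)%type, V) := linfun gL.
have fE x y z : f (x, y, z) = p0 (vsval x) + vsval y + p1 (vsval z).
  by rewrite lfunE.
clearbody f.
have p0f x y z : p0 (f (x, y, z)) = p0 (vsval x).
  have [yC0 yC1] := YC y.
  rewrite fE !lfunD (p0id _ (p0I _)).
  have /eqP -> : p0 (vsval y) == 0 by rewrite p00.
  have /eqP -> : p0 (p1 (vsval z)) == 0 by rewrite p00 IC.
  by rewrite !addr0.
have p1f x y z : p1 (f (x, y, z)) = p1 (vsval z).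
  have [yC0 yC1] := YC y.
  rewrite fE !lfunD (p1id _ (p1I _)).
  have /eqP -> : p1 (vsval y) == 0 by rewrite p10.
  have /eqP -> : p1 (p0 (vsval x)) == 0 by rewrite p10 IC.
  by rewrite !add0r.
have p0inj (x x' : X) : p0 (vsval x) = p0 (vsval x') -> x = x'.
  by move=> e; apply: (can_inj aK); rewrite !aE.
have p1inj (z z' : X) : p1 (vsval z) = p1 (vsval z') -> z = z'.
  move=> e; apply/eqP; rewrite -subr_eq0; apply/eqP/(valX0 _ i0) => //.
  by rewrite -p10 (_ : vsval (z - z') = vsval z - vsval z') // lfunB e subrr.
have fmid x y z : vsval y = f (x, y, z) - p0 (f (x, y, z)) - p1 (f (x, y, z)).
  by rewrite p0f p1f fE addrAC addrK addrAC addrN add0r.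
have memC0 x y z : (f (x, y, z) \in C i0) = (z == 0).
  rewrite -p10 p1f; apply/eqP/eqP => [e|->]; last by rewrite !linear0.
  by apply: p1inj; rewrite e !linear0.
have memC1 x y z : (f (x, y, z) \in C i1) = (x == 0).
  rewrite -p00 p0f; apply/eqP/eqP => [e|->]; last by rewrite !linear0.
  by apply: p0inj; rewrite e !linear0.
have fz z : f (z, - bt z, z) = vsval z.
  rewrite fE (_ : vsval (- bt z) = - vsval (bt z)) // btE opprB opprD addrA.
  by rewrite -!addrA addNr addr0 addrC addrNK.
have f_inj : injective f.
  apply/lker0P; rewrite -subv0; apply/subvP => -[[x y] z].
  rewrite memv_ker memv0 => /eqP e.
  have z0 : z = 0 by apply/eqP; rewrite -(memC0 x y) e mem0v.
  have x0 : x = 0 by apply/eqP; rewrite -(memC1 x y z) e mem0v.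
  have y0 : vsval y = 0 by rewrite (fmid x y z) e !lfun0 !subr0.
  by rewrite x0 z0 (subvs_inj (y0 : vsval y = vsval 0)).
have dimM : \dim M = n.
  have := dimv_sum_cap (C i0) (C i1); rewrite !dimC -/M.
  suff -> : (C i0 + C i1)%VS = fullv by rewrite dimV; lia.
  apply/eqP; rewrite eqEsubv subvf -(general_full (isT : i0 != i1)).
  by rewrite addvS //; apply: sext_sub.
have dimY : \dim {:Y} = n by rewrite dimvf -dimM.
exists X, Y, bt, gm, f; split=> //.
  apply: lfun_injective_bijective => //; rewrite dimV dimvf.
  rewrite -[dim _]/(dim X + dim Y + dim X)%N -!dimvf dimX dimY.
  by rewrite !mulSn mul0n addn0 addnA.
have memI0 x y z : (f (x, y, z) \in I i0) = (y == 0) && (z == 0).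
  apply/idP/andP => [vI|[/eqP-> /eqP->]]; last first.
    by rewrite fE !linear0 !addr0.
  have z0 : z == 0 by rewrite -(memC0 x y) IC.
  have z1 : p1 (vsval z) = 0 by rewrite (eqP z0) !linear0.
  by split=> //; apply/eqP/subvs_inj; rewrite (fmid x y z) p1f z1 (p0id _ vI) subrr subr0.
have memI1 x y z : (f (x, y, z) \in I i1) = (x == 0) && (y == 0).
  apply/idP/andP => [vI|[/eqP-> /eqP->]]; last first.
    by rewrite fE !linear0 !add0r.
  have x0 : x == 0 by rewrite -(memC1 x y z) IC.
  have x1 : p0 (vsval x) = 0 by rewrite (eqP x0) !linear0.
  by split=> //; apply/eqP/subvs_inj; rewrite (fmid x y z) p0f x1 (p1id _ vI) subr0 subrr.
have memI2 x y z : (f (x, y, z) \in I i2) = (y == - bt z) && (x == z).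
  apply/idP/andP => [vI|[/eqP-> /eqP->]]; last by rewrite fz.
  have [t tE] : exists t : X, vsval t = f (x, y, z).
    by exists (vsproj (I i2) (f (x, y, z))); rewrite vsprojK.
  rewrite -fz in tE.
  by have := f_inj _ _ tE => -[<- <- <-].
move=> x y z; rewrite memC0 memC1 memI0 memI1 memI2; do 5?[split] => //.
have -> : f (x, y, z) = f (x - z, y + bt z, 0) + vsval z.
  rewrite -fz -lfunD; congr (f _).
  by congr (_, _, _); rewrite /= ?subrK ?addrK ?add0r.
rewrite (rpredDr _ (IC _ _ (XI z))) -r0 fE !linear0 addr0 lfunD (rid _ (p0I _)) -aE -gmE.
rewrite -lfunD -(linear0 a) (inj_eq (can_inj aK)).
by rewrite -[RHS]subr_eq0 lfunD addrAC addrA.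
Qed.

End NormalForm.

Section ArrowForm.
Variables (k : fieldType) (two : (2 : k) != 0).
Variables (V : vectType k) (S : sextuple V) (n : nat).
Variables (X Y : vectType k) (beta : 'Hom(X, Y)) (gamma : 'Hom(Y, X)).
Variable f : 'Hom((X * Y * X)%type, V).
Hypothesis form : arrow_form S n beta gamma f.

(** The pair of maps is one odd endomorphism [N] of the graded space [X * Y],
    and a homogeneous idempotent commuting with [N] acts on the sextuple. So
    [N] has a kernel of dimension at most one, whereas a kernel vector in each
    of [X] and [Y] would give dimension two. *)
Lemma arrow_form_kernels : sextuple_indecomposable S ->
  injective beta \/ injective gamma.
Proof.
move=> indec; have [bf _ _ memf] := form.
have [g [fK gK]] := lfun_bijective_inverse bf.
pose Nf (v : X * Y) : X * Y := (gamma v.2, beta v.1).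
have Nlin : linear Nf.
  by move=> c u v; congr (_, _); rewrite /= linearP.
pose NL : {linear (X * Y)%type -> (X * Y)%type} :=
  HB.pack Nf (GRing.isLinear.Build k _ _ _ Nf Nlin).
pose ef (v : X * Y) : X * Y := (v.1, - v.2).
have elin : linear ef.
  by move=> c u v; congr (_, _); rewrite /= opprD scalerN.
pose eL : {linear (X * Y)%type -> (X * Y)%type} :=
  HB.pack ef (GRing.isLinear.Build k _ _ _ ef elin).
pose N : 'End((X * Y)%type) := linfun NL; pose e : 'End((X * Y)%type) := linfun eL.
have NE x y : N (x, y) = (gamma y, beta x) by rewrite lfunE.
have eE x y : e (x, y) = (x, - y) by rewrite lfunE.
clearbody N e.
have chain : (\dim (lker N) <= 1)%N.
  apply: (graded_chain two (e := e)).
  - by apply/lfunP => -[x y]; rewrite comp_lfunE !eE opprK id_lfunE.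
  - apply/lfunP => -[x y]; rewrite opp_lfunE !comp_lfunE !NE !eE NE lfunN.
    by congr (_, _); rewrite /= opprK.
  move=> P PP PN Pe.
  have PNE v : P (N v) = N (P v) by rewrite -!comp_lfunE PN.
  have PeE v : P (e v) = e (P v) by rewrite -!comp_lfunE Pe.
  have PPE v : P (P v) = P v by rewrite -comp_lfunE PP.
  have half (W : vectType k) (w : W) : - w = w -> w = 0.
    move=> /eqP; rewrite eq_sym -subr_eq0 opprK -mulr2n -scaler_nat scaler_eq0.
    by rewrite (negPf two) => /eqP.
  have P1 x : P (x, 0) = ((P (x, 0)).1, 0).
    have := PeE (x, 0); rewrite eE oppr0; case: (P (x, 0)) => x' y' /=.
    by rewrite eE => -[/esym/half->].
  have P2 y : P (0, y) = (0, (P (0, y)).2).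
    have := PeE (0, - y); rewrite !eE opprK.
    have -> : (0, - y) = - (0, y) :> X * Y by congr (_, _); rewrite oppr0.
    rewrite lfunN; case: (P (0, y)) => x' y'.
    have -> : - (x', y') = (- x', - y') :> X * Y by [].
    by rewrite eE => -[/esym/half->].
  pose F (v : X * Y * X) : X * Y * X := ((P (v.1.1, 0)).1, (P (0, v.1.2)).2, (P (v.2, 0)).1).
  have Flin : linear F.
    have l1 c (x x' : X) : (c *: x + x', 0) = c *: (x, 0) + (x', 0) :> X * Y.
      by congr (_, _); rewrite /= scaler0 addr0.
    have l2 c (y y' : Y) : (0, c *: y + y') = c *: (0, y) + (0, y') :> X * Y.
      by congr (_, _); rewrite /= scaler0 addr0.
    by move=> c u v; rewrite /F /= !l1 l2 !linearP.
  pose FL : {linear (X * Y * X)%type -> (X * Y * X)%type} :=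
    HB.pack F (GRing.isLinear.Build k _ _ _ F Flin).
  pose p : 'End(V) := (f \o (linfun FL \o g))%VF.
  have pf x y z : p (f (x, y, z)) = f ((P (x, 0)).1, (P (0, y)).2, (P (z, 0)).1).
    by rewrite !comp_lfunE lfunE fK.
  clearbody p.
  have PX x : (P ((P (x, 0)).1, 0)).1 = (P (x, 0)).1 by rewrite -P1 PPE.
  have PY y : (P (0, (P (0, y)).2)).2 = (P (0, y)).2 by rewrite -P2 PPE.
  have PX0 : (P (0, 0)).1 = 0 by rewrite (lfun0 P).
  have PY0 : (P (0, 0)).2 = 0 by rewrite (lfun0 P).
  have Pg y : (P (gamma y, 0)).1 = gamma (P (0, y)).2.
    have := PNE (0, y); rewrite NE linear0 => ->.
    by rewrite [P (0, y)]P2 NE.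
  have Pb x : (P (0, beta x)).2 = beta (P (x, 0)).1.
    have := PNE (x, 0); rewrite NE linear0 => ->.
    by rewrite [P (x, 0)]P1 NE.
  have PD x x' : (P (x + x', 0)).1 = (P (x, 0)).1 + (P (x', 0)).1.
    by rewrite -[RHS]/(P (x, 0) + P (x', 0)).1 -lfunD; congr (P (_, _)).1; rewrite addr0.
  have PN2 y : (P (0, - y)).2 = - (P (0, y)).2.
    by rewrite -[RHS]/(- P (0, y)).2 -lfunN; congr (P (_, _)).2; rewrite oppr0.
  have [||p0|p1] := @indecomposable_sextuple_idempotent _ _ _ p indec.
  - apply/lfunP => v; rewrite -[v]gK; case: (g v) => [[x y] z].
    by rewrite comp_lfunE !pf !PX PY.
  - apply: ord3P; split; apply/subvP => _ /memv_imgP[v + ->];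
      rewrite -[v]gK; case: (g v) => [[x y] z]; rewrite pf !memf.
    + by move=> /andP[/eqP-> /eqP->]; rewrite PY0 PX0 !eqxx.
    + by move=> /eqP->; rewrite PX0.
    + by move=> /andP[/eqP-> /eqP->]; rewrite PY0 PX0 !eqxx.
    + by move=> /eqP->; rewrite PX0.
    + by move=> /andP[/eqP-> /eqP->]; rewrite PN2 Pb !eqxx.
    by move=> /eqP defz; rewrite -Pb -!Pg -!PD defz.
  - left; apply/lfunP => -[x y]; rewrite zero_lfunE.
    move/lfunP: p0 => /(_ (f (x, y, 0))); rewrite pf zero_lfunE -(lfun0 f).
    move=> /(can_inj fK)[x0 y0 _].
    have -> : (x, y) = (x, 0) + (0, y) :> X * Y by congr (_, _); rewrite ?addr0 ?add0r.
    by rewrite lfunD P1 P2 x0 y0; congr (_, _); rewrite /= addr0.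
  right; apply/lfunP => -[x y]; rewrite id_lfunE.
  move/lfunP: p1 => /(_ (f (x, y, 0))); rewrite pf id_lfunE.
  move=> /(can_inj fK)[x0 y0 _].
  have xy : (x, y) = (x, 0) + (0, y) :> X * Y by congr (_, _); rewrite ?addr0 ?add0r.
  by rewrite {1}xy lfunD P1 P2 x0 y0 -xy.
have [kb|kb] := eqVneq (lker beta) 0%VS; first by left; apply/lker0P/eqP.
have [kg|kg] := eqVneq (lker gamma) 0%VS; first by right; apply/lker0P/eqP.
set x := vpick (lker beta); set y := vpick (lker gamma).
have x0 : x != 0 by rewrite vpick0.
have y0 : y != 0 by rewrite vpick0.
have bx : beta x = 0 by apply/eqP; rewrite -memv_ker memv_pick.
have gy : gamma y = 0 by apply/eqP; rewrite -memv_ker memv_pick.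
pose u1 : (X * Y)%type := (x, 0); pose u2 : (X * Y)%type := (0, y).
have dim2 : \dim (0 + <[u1]> + <[u2]>)%VS = 2%N.
  rewrite !dim_add_line ?dimv0 //; first by rewrite memv0 xpair_eqE negb_and x0.
  rewrite add0v; apply: contra y0 => /vlineP[c [_ ->]].
  by rewrite scaler0.
have : (0 + <[u1]> + <[u2]> <= lker N)%VS.
  by rewrite !subv_add sub0v -!memvE !memv_ker !NE bx gy !linear0 eqxx.
by move/dimvS; rewrite dim2 => le2; have := leq_trans le2 chain.
Qed.

Lemma arrow_form_endo : injective beta -> injective gamma ->
  exists eta : 'End(Y), sextuple_iso S (endo_sextuple eta).
Proof.
move=> bI gI; have [bf dimX dimY memf] := form.
have [|b' [bK Kb]] := @lfun_bijective_inverse _ _ _ beta.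
  by apply: lfun_injective_bijective; rewrite // dimX dimY.
have [|c' [cK Kc]] := @lfun_bijective_inverse _ _ _ gamma.
  by apply: lfun_injective_bijective; rewrite // dimX dimY.
have c'I := can_inj Kc.
have [g [fK gK]] := lfun_bijective_inverse bf.
exists (c' \o b')%VF; apply: sextuple_iso_sym.
pose h (v : Y * Y * Y) : X * Y * X := (gamma v.1.1, v.1.2, b' v.2).
have hlin : linear h by move=> a u v; rewrite /h /= !linearP.
pose hL : {linear (Y * Y * Y)%type -> (X * Y * X)%type} :=
  HB.pack h (GRing.isLinear.Build k _ _ _ h hlin).
have g0 y : (gamma y == 0) = (y == 0) by rewrite -(inj_eq gI) linear0.
have b'0 y : (b' y == 0) = (y == 0) by rewrite -(inj_eq (can_inj Kb)) linear0.
have fhE x y z : (f \o linfun hL)%VF (x, y, z) = f (gamma x, y, b' z).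
  by rewrite comp_lfunE lfunE.
apply: (sextuple_isoP (f := (f \o linfun hL)%VF)).
- exists (fun v => (c' (g v).1.1, (g v).1.2, beta (g v).2)) => [[[x y] z]|v].
    by rewrite fhE fK /= cK Kb.
  by rewrite fhE Kc bK -[RHS]gK; case: (g v) => [[]].
- apply: ord3P => -[[x y] z]; rewrite fhE memf (mem_endo (c' \o b')%VF).
  + by rewrite b'0.
  + by rewrite g0.
  rewrite comp_lfunE Kb andbC -(inj_eq c'I) cK.
  apply/andP/andP => [[/eqP xE /eqP yE]|[/eqP xE /eqP zE]].
    by rewrite xE yE !lfunN !opprK !eqxx.
  by rewrite xE zE !lfunN !opprK !eqxx.
apply: ord3P => -[[x y] z]; rewrite fhE memf (mem_endo (c' \o b')%VF).
+ by rewrite b'0.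
+ by rewrite g0.
by rewrite comp_lfunE Kb -!lfunD -(inj_eq c'I) cK.
Qed.

End ArrowForm.

Section TripleToPairing.
Variables (k : fieldType) (two : (2 : k) != 0).
Variables (V : vectType k) (T : isotropic_triple V).
Local Notation S := (underlying_sextuple T).
Local Notation w := (triple_form T).
Let lin : forall u, scalar (w u) := skew_form_scalar w.
Let skew := skew_form_skew w.

Lemma triple_nondegenerate v : (forall u, w v u = 0) -> v = 0.
Proof.
move=> v0; have [/eqP rad _ _] := triple_symplectic T.
by apply/eqP; rewrite -memv0 -rad; apply/mem_orthovP.
Qed.

Lemma triple_represents (phi : 'Hom(V, k^o)) : exists d, forall v, phi v = w d v.
Proof.
have [f [bf fE]] := skew_form_dual (B := fun u v => w u v) lin skew triple_nondegenerate.
have [_ /(_ phi)[d ->]] := bijective_injective bf; by exists d.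
Qed.

(** Transversality passes to orthogonals: [V = I i + C j] implies
    [0 = C i :&: I j]. *)
Lemma triple_duality i j n : \dim {:V} = (3 * n)%N ->
  (forall i, \dim (sextC S i) = (2 * n)%N) -> (forall i, \dim (sextI S i) = n) ->
  (sextI S i :&: sextC S j = 0)%VS -> (sextI S j :&: sextC S i = 0)%VS.
Proof.
move=> dimV dimC dimI cap.
have full : (sextI S i + sextC S j)%VS = fullv.
  apply/eqP; rewrite eqEdim subvf dimv_disjoint_sum // dimV dimC dimI; lia.
apply/eqP; rewrite -subv0; apply/subvP => x /memv_capP[xI xC]; rewrite memv0.
apply/eqP/triple_nondegenerate => v.
have /memv_addP[a aI [b bC ->]] : v \in (sextI S i + sextC S j)%VS.
  by rewrite full memvf.
rewrite (scalarD lin); move/mem_orthovP: xC => -> //.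
by rewrite skew; move/mem_orthovP: bC => -> //; rewrite oppr0 addr0.
Qed.

(** Transporting the symplectic form to [U * U * U] and restricting it to the
    middle coordinate gives [q]. Orthogonality of [C i2] and [I i2] turns into [q (eta x) y + q x (eta y) = q x y]. *)
Lemma triple_pairing_of (U : vectType k) (eta : 'End(U)) :
  sextuple_iso S (endo_sextuple eta) ->
  exists q, skew_pairing (eta - 2^-1 *: \1%VF) q.
Proof.
move=> /sextuple_iso_sym[g [bg gS]]; have [gI gC] := sextuple_iso_mem bg gS.
have [ginj gsurj] := bijective_injective bg.
have orth i u v : u \in sextC (endo_sextuple eta) i ->
    v \in sextI (endo_sextuple eta) i -> w (g u) (g v) = 0.
  by rewrite -gC -gI => /mem_orthovP; apply.
pose E1 x : V := g (x, 0, 0); pose E2 x : V := g (0, x, 0); pose E3 x : V := g (0, 0, x).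
have gE x y z : g (x, y, z) = E1 x + E2 y + E3 z.
  by rewrite -!lfunD; congr (g (_, _, _)); rewrite /= ?addr0 ?add0r.
have E1D c x y : E1 (c *: x + y) = c *: E1 x + E1 y.
  by rewrite /E1 -linearP; congr (g (_, _, _)); rewrite /= scaler0 addr0.
have E2D c x y : E2 (c *: x + y) = c *: E2 x + E2 y.
  by rewrite /E2 -linearP; congr (g (_, _, _)); rewrite /= scaler0 addr0.
have E1N x : E1 (- x) = - E1 x.
  by rewrite /E1 -lfunN; congr (g (_, _, _)); rewrite /= oppr0.
have E2N x : E2 (- x) = - E2 x.
  by rewrite /E2 -lfunN; congr (g (_, _, _)); rewrite /= oppr0.
have E3N x : E3 (- x) = - E3 x.
  by rewrite /E3 -lfunN; congr (g (_, _, _)); rewrite /= oppr0.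
have w11 x y : w (E1 x) (E1 y) = 0.
  by apply: (orth i0); rewrite (mem_endo eta) ?eqxx.
have w21 x y : w (E2 x) (E1 y) = 0.
  by apply: (orth i0); rewrite (mem_endo eta) ?eqxx.
have w23 x y : w (E2 x) (E3 y) = 0.
  by apply: (orth i1); rewrite (mem_endo eta) ?eqxx.
have w33 x y : w (E3 x) (E3 y) = 0.
  by apply: (orth i1); rewrite (mem_endo eta) ?eqxx.
pose q (x y : U) : k := w (E2 x) (E2 y).
have w31 x y : w (E3 x) (E1 y) = - q x y.
  have : w (g (y, - y, 0)) (g (- eta x, x, - x)) = 0.
    by apply: (orth i2); rewrite (mem_endo eta) ?eqxx ?subrr ?addr0 ?linear0.
  have E30 : E3 0 = 0 by apply: linear0.
  rewrite !gE E30 addr0 E2N E3N E1N.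
  rewrite !(scalarDl lin skew) !(scalarD lin) !(scalarN lin) !(scalarNl lin skew).
  rewrite ?(scalarN lin) w11 w21 w23 [w (E1 _) (E2 _)]skew w21 [w (E1 _) (E3 _)]skew.
  rewrite -/(q y x) [q y x]skew -/(q x y) => e.
  by apply/eqP; rewrite -subr_eq0; apply/eqP; rewrite -[RHS]e; ring.
have half x y : q (eta x) y + q x (eta y) = q x y.
  have : w (g (- eta x, x, - x)) (g (- eta y, y, - y)) = 0.
    apply: (orth i2); last by rewrite (mem_endo eta) !eqxx.
    by rewrite (mem_endo eta) addrK lfunN.
  rewrite !gE !E1N !E3N.
  rewrite !(scalarDl lin skew) !(scalarD lin) !(scalarN lin) !(scalarNl lin skew).
  rewrite ?(scalarN lin) w11 w21 w23 w33 [w (E1 _) (E2 _)]skew w21.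
  rewrite [w (E3 _) (E2 _)]skew w23 [w (E1 _) (E3 _)]skew !w31.
  rewrite -/(q x y) [q y _]skew -/(q _ y) => e.
  by apply/eqP; rewrite -subr_eq0; apply/eqP; rewrite -[RHS]oppr0 -[in RHS]e; ring.
have qlin u : scalar (q u) by move=> c x y; rewrite /q E2D lin.
have qskew u v : q u v = - q v u by apply: skew.
exists q; split=> //.
- move=> u u0; suff : (0, u, 0) = 0 :> U * U * U by case.
  apply: ginj; rewrite linear0; apply: triple_nondegenerate => v.
  have [[[x y] z] ->] := gsurj v.
  by rewrite [g (x, y, z)]gE !(scalarD lin) -/(E2 u) w21 w23 -/(q u y) u0 !addr0.
move=> u v; rewrite !add_lfunE !opp_lfunE !scale_lfunE !id_lfunE.
rewrite (scalarDl qlin qskew) (scalarD qlin) (scalarNl qlin qskew) (scalarN qlin).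
rewrite (scalarZl qlin qskew) (scalarZ qlin) opprD opprK.
apply/eqP; rewrite -subr_eq0.
have -> : q (eta u) v - 2^-1 * q u v - (- q u (eta v) + 2^-1 * q u v)
    = q (eta u) v + q u (eta v) - 2 * 2^-1 * q u v by ring.
by rewrite half mulfV // mul1r subrr.
Qed.

End TripleToPairing.

(** A skew-symmetric matrix [A] of odd size has [\det A = - \det A]. *)
Lemma skew_pairing_even (k : fieldType) (U : vectType k) (zeta : 'End(U)) q :
  (2 : k) != 0 -> skew_pairing zeta q -> ~~ odd (\dim {:U}).
Proof.
move=> two [lin skew nondeg _]; set n := \dim _.
pose e := vbasis (fullv : {vspace U}).
pose A : 'M[k]_n := \matrix_(i, j) q e`_i e`_j.
have AT : A^T = - A.
  by apply/matrixP => i j; rewrite !mxE skew.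
have Aunit : A \in unitmx.
  rewrite -row_free_unit -kermx_eq0; apply/eqP/row_matrixP => i.
  rewrite row0; set r := row i _.
  have rA : r *m A = 0.
    by rewrite -row_mul mulmx_ker row0.
  pose u : U := \sum_j r 0 j *: e`_j.
  have qsum (F : 'I_n -> U) v (c : 'I_n -> k) :
      q v (\sum_j c j *: F j) = \sum_j c j * q v (F j).
    rewrite (big_morph (q v) (id1 := 0) (op1 := +%R)) ?(scalar0 lin) //.
      by apply: eq_bigr => j _; rewrite (scalarZ lin).
    by move=> x y; rewrite (scalarD lin).
  have u0 : u = 0.
    apply: nondeg => v; rewrite (coord_vbasis (memvf v)) qsum big1 // => j _.
    have -> : q u e`_j = (r *m A) 0 j.
      rewrite skew qsum mxE -sumrN; apply: eq_bigr => l _.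
      by rewrite [A _ _]mxE skew mulrN opprK.
    by rewrite rA mxE mulr0.
  apply/rowP => j; rewrite [RHS]mxE.
  have fr : free e := basis_free (vbasisP _).
  by rewrite -(coord_sum_free (fun j => r 0 j) j fr) -/u u0 linear0.
apply/negP => oddn; have := det_tr A; rewrite AT -scaleN1r detZ -signr_odd oddn mulN1r.
move=> /eqP; rewrite eq_sym -subr_eq0 opprK -mulr2n -mulr_natl mulf_eq0 (negPf two) /=.
by move: Aunit; rewrite unitmxE unitfE => /negPf->.
Qed.

Section Classification.
Variables (k : fieldType) (two : (2 : k) != 0).

(** Orthogonality excludes the exceptional tube, which puts the six subspaces
    in general position and brings the sextuple to the form of a pair [beta],
    [gamma]. The kernel of [beta] measures the failure of [I i0 + I i1 + I i2 = V]
    and that of [gamma] the orthogonal [C i0 :&: C i1 :&: C i2] of this sum, so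
    both are zero or neither is, and the latter is excluded. *)
Lemma triple_classification (V : vectType k) (T : isotropic_triple V) :
  triple_continuous T ->
  exists (U : vectType k) (eta : 'End(U)), half_shift_admissible eta /\
    sextuple_iso (underlying_sextuple T) (endo_sextuple eta).
Proof.
move=> [indec [n [n1 dimV dimC dimI]]]; set S := underlying_sextuple T in indec dimC dimI.
have semi : semistable S.
  apply: indecomposable_semistable indec _.
  by rewrite /weight sum3n !capvf !dimC !dimI dimV; lia.
have dual i j : (sextI S i :&: sextC S j = 0)%VS -> (sextI S j :&: sextC S i = 0)%VS.
  exact: triple_duality dimV dimC dimI.
have tube_free := no_exceptional_tube indec semi (fun a => conj (dual a (next a)) (dual (next a) a)).
have general i j : i != j -> (sextI S i :&: sextC S j = 0)%VS.
  have := (tube_free i0, tube_free i1, tube_free i2); rewrite !nextE.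
  by case=> -[[? ?] [? ?]] [? ?]; move: i j; do 2![apply: ord3P].
have [X [Y [beta [gamma [f form]]]]] := arrow_form_exists dimV dimC dimI general.
have [bf dimX dimY memf] := form; have [finj fsurj] := bijective_injective bf.
have lin := skew_form_scalar (triple_form T); have skew := skew_form_skew (triple_form T).
have orthI d : (forall i v, v \in sextI S i -> triple_form T d v = 0) ->
    forall i, d \in sextC S i.
  by move=> d0 i; apply/mem_orthovP => v; apply: d0.
(* A kernel vector [x] of [beta] gives [f (x, 0, x)] in [I i2] and in
   [I i0 + I i1], so the [I i] do not span [V], and a vector orthogonal to them
   all lies in every [C i]. *)
have beta_of_gamma : injective gamma -> injective beta.
  move=> gI; apply/lker0P; apply: contraT => kb.
  have [x xk x0] : exists2 x, x \in lker beta & x != 0.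
    by exists (vpick (lker beta)); rewrite ?memv_pick ?vpick0.
  pose W := (sextI S i0 + sextI S i1 + sextI S i2)%VS.
  have WV : W != fullv.
    apply/eqP => full; move: x0; rewrite -memv0.
    suff cap : ((sextI S i0 + sextI S i1) :&: sextI S i2 = 0)%VS.
      have : f (x, 0, x) \in (0 : {vspace V})%VS.
        rewrite -cap; apply/memv_capP; split; last first.
          by rewrite memf eqxx andbT; move: xk; rewrite memv_ker => /eqP->; rewrite oppr0.
        have -> : (x, 0, x) = (x, 0, 0) + (0, 0, x) :> X * Y * X.
          by congr (_, _, _); rewrite ?addr0 ?add0r.
        by rewrite lfunD memv_add // memf !eqxx.
      by rewrite !memv0 -(lfun0 f) (inj_eq finj) => /eqP[-> _]; rewrite eqxx.
    apply/eqP; rewrite -dimv_eq0.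
    have := dimv_sum_cap (sextI S i0 + sextI S i1) (sextI S i2).
    have := leq_of_leqif (dimv_add_leqif (sextI S i0) (sextI S i1)).
    rewrite -/W full dimV !dimI; lia.
  have [v _ vW] : exists2 v, v \in (fullv : {vspace V}) & v \notin W.
    by apply/subvPn; apply: contra WV; rewrite eqEsubv subvf.
  have [phi [phi1 phi0]] := separating_functional vW.
  have [d dE] := triple_represents T phi.
  have dC : forall i, d \in sextC S i.
    apply: orthI => i u uI; rewrite -dE; apply: phi0; apply: subvP u uI.
    move: i; apply: ord3P; last exact: addvSr.
      exact: subv_trans (addvSl _ _) (addvSl _ _).
    exact: subv_trans (addvSr _ _) (addvSl _ _).
  suff d0 : d = 0.
    by move: (oner_neq0 k); rewrite -phi1 dE d0 (scalar0l lin skew) eqxx.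
  have [[[x' y] z] def] := fsurj d.
  move: (dC i0) (dC i1) (dC i2); rewrite def !memf => /eqP-> /eqP->.
  rewrite add0r linear0 linear0 addr0 => /eqP gy.
  by rewrite (gI y 0) ?linear0 // gy.
(* A kernel vector [y] of [gamma] gives [f (0, y, 0)] in every [C i], hence
   orthogonal to all [I i]; these span [V] when [beta] is onto. *)
have gamma_of_beta : injective beta -> injective gamma.
  move=> bI; have [|b' [_ Kb]] := @lfun_bijective_inverse _ _ _ beta.
    by apply: lfun_injective_bijective; rewrite // dimX dimY.
  apply/lker0P; rewrite -subv0; apply/subvP => y; rewrite memv_ker memv0 => /eqP gy.
  suff : f (0, y, 0) = 0 by rewrite -(lfun0 f) => /finj[->].
  have yC : forall i, f (0, y, 0) \in sextC S i.
    by apply: ord3P; rewrite memf ?eqxx // gy !linear0 !addr0 eqxx.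
  apply: (@triple_nondegenerate _ _ T) => v; have [[[x1 y1] z1] ->] := fsurj v.
  pose t := b' (- y1).
  have -> : (x1, y1, z1) = (x1 - t, 0, 0) + (0, 0, z1 - t) + (t, y1, t) :> X * Y * X.
    by congr (_, _, _); rewrite /= ?addr0 ?add0r ?subrK.
  rewrite !lfunD !(scalarD lin).
  have orth i u : u \in sextI S i -> triple_form T (f (0, y, 0)) u = 0.
    by move=> uI; move/mem_orthovP: (yC i); apply.
  rewrite (orth i0 (f (_, 0, 0))) ?memf ?eqxx // (orth i1 (f (0, 0, _))) ?memf ?eqxx //.
  by rewrite (orth i2 (f (t, _, t))) ?addr0 // memf /t Kb opprK !eqxx.
have [bI gI] : injective beta /\ injective gamma.
  by have [bI|gI] := arrow_form_kernels two form indec; split; auto.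
have [eta isoT] := arrow_form_endo form bI gI; exists Y, eta; split=> //.
have indec_eta : endo_indecomposable eta.
  exact/endo_sextuple_indecomposable/(sextuple_iso_indecomposable isoT).
have [q pairing] := triple_pairing_of two isoT.
split=> //; exists (eta - 2^-1 *: \1%VF); split; last by rewrite addrC subrK.
split; [|exact: skew_pairing_even pairing|exact: skew_pairing_iso pairing].
have [Y0 _] := indec_eta; apply: indecomposable_endoI => // p pp pz.
apply: (indecomposable_endo_idempotent indec_eta) => //.
have -> : eta = (eta - 2^-1 *: \1%VF) + 2^-1 *: \1%VF by rewrite subrK.
rewrite comp_lfunDl comp_lfunDr pz; congr (_ + _).
by rewrite -comp_lfunZl -comp_lfunZr comp_lfun1l comp_lfun1r.
Qed.

End Classification.

Theorem corollary8p10 (k : fieldType) (kperfect : perfect_field k)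
    (kchar : 2%N \notin [pchar k]) :
  (* eta |-> S_eta is a bijection, up to isomorphism on both sides *)
  [/\ forall (U : vectType k) (eta : 'End(U)), half_shift_admissible eta ->
        exists (V : vectType k) (T : isotropic_triple V),
          [/\ triple_nonsplit T, triple_continuous T
            & sextuple_iso (underlying_sextuple T) (endo_sextuple eta)],
      forall (V : vectType k) (T : isotropic_triple V),
        triple_nonsplit T -> triple_continuous T ->
        exists (U : vectType k) (eta : 'End(U)), half_shift_admissible eta /\
          sextuple_iso (underlying_sextuple T) (endo_sextuple eta)
    & forall (U U' : vectType k) (eta : 'End(U)) (eta' : 'End(U')),
        half_shift_admissible eta -> half_shift_admissible eta' ->
        (sextuple_iso (endo_sextuple eta) (endo_sextuple eta') <->
         endo_iso eta eta')]
  /\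
  (* zeta |-> (minimal polynomial of zeta) is a bijection from isomorphism
     classes onto the parameter set *)
  [/\ forall (U : vectType k) (zeta : 'End(U)), admissible zeta ->
        exists p : {poly k}, is_minpoly zeta p /\ parameter_poly p,
      forall p : {poly k}, parameter_poly p ->
        exists (U : vectType k) (zeta : 'End(U)),
          admissible zeta /\ is_minpoly zeta p
    & forall (U U' : vectType k) (zeta : 'End(U)) (zeta' : 'End(U'))
        (p p' : {poly k}),
        admissible zeta -> admissible zeta' ->
        is_minpoly zeta p -> is_minpoly zeta' p' ->
        (endo_iso zeta zeta' <-> p = p')].
Proof.
have two : (2 : k) != 0 by apply: contra kchar => /eqP two0; rewrite inE two0 eqxx.
split.
- split=> [U eta [indec [zeta [adm defeta]]]|V T _|U U' eta eta' _ _].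
  + have [q pairing] := admissible_skew_pairing two adm.
    by move: indec; rewrite defeta; apply: triple_of_pairing pairing.
  + exact: triple_classification.
  exact: endo_sextuple_iso.
split=> [U zeta|p|U U' zeta zeta' p p' [indec _ _] [indec' _ _]].
- exact: admissible_parameter.
- exact: parameter_admissible.
exact: indecomposable_iso_minpoly.
Qed.
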